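(* Let $q(\bm u)$, $q(\bm z,T)$ (of the forms specified in the context, with parameters $\varpi'_{t,s,s_u}$ and $\pi'_{s,k}$) and $\bm\xi$ be given, and let $q(\bm\theta,\bm\tau,\bm\pi,\bm\beta)$ be the probability density determined by $$\ln q(\bm\theta,\bm\tau,\bm\pi,\bm\beta)=\mathbb{E}_{q(\bm u)\,q(\bm z,T)}\bigl[\ln\bigl(p(\bm x,\bm z,T,\bm\theta,\bm\tau,\bm\pi\mid\bm u)\,h(\bm u\mid\bm\beta,\bm\xi)\,p(\bm\beta)\bigr)\bigr]+\mathrm{const.},$$ where ''const.'' does not depend on $(\bm\theta,\bm\tau,\bm\pi,\bm\beta)$. Put $q(s\preceq\mathsf{s}(\bm u_t)):=\mathbb{E}_{q(\bm u_t)}[I\{s\preceq\mathsf{s}(\bm u_t)\}]$, $\bm Q_s:=\mathrm{diag}\{q(s\preceq\mathsf{s}(\bm u_1)),\dots,q(s\preceq\mathsf{s}(\bm u_n))\}$, $q(s\in\mathcal{L}_T):=\mathbb{E}_{q(T)}[I\{s\in\mathcal{L}_T\}]$. Then $$q(\bm\theta,\bm\tau,\bm\pi,\bm\beta)=q(\bm\pi)\prod_{k=1}^K q(\bm\theta_k,\tau_k)\prod_{s\in\mathcal{I}_{\max}}q(\bm\beta_s),$$ where: (i) $q(\bm\pi)=\mathrm{Dir}(\bm\pi\mid\bm\alpha')$ with $\alpha'_k:=\alpha_k+\sum_{s\in\mathcal{S}_{\max}}q(s\in\mathcal{L}_T)\,\pi'_{s,k}$; (ii) $q(\bm\theta_k,\tau_k)=\mathcal{N}(\bm\theta_k\mid\bm\mu'_k,(\tau_k\bm\Lambda'_k)^{-1})\,\mathrm{Gam}(\tau_k\mid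 a'_k,b'_k)$ with $$\bm\Lambda'_k:=\bm\Lambda+\sum_{s\in\mathcal{S}_{\max}}q(s\in\mathcal{L}_T)\pi'_{s,k}\bm X^\top\bm Q_s\bm X,\qquad \bm\mu'_k:=(\bm\Lambda'_k)^{-1}\Bigl(\bm\Lambda\bm\mu+\sum_{s\in\mathcal{S}_{\max}}q(s\in\mathcal{L}_T)\pi'_{s,k}\bm X^\top\bm Q_s\bm x\Bigr),$$ $$a'_k:=a+\frac12\sum_{s\in\mathcal{S}_{\max}}q(s\in\mathcal{L}_T)\pi'_{s,k}\mathrm{Tr}\{\bm Q_s\},$$ $$b'_k:=b+\frac12\Bigl(\bm\mu^\top\bm\Lambda\bm\mu+\sum_{s\in\mathcal{S}_{\max}}q(s\in\mathcal{L}_T)\pi'_{s,k}\bm x^\top\bm Q_s\bm x-(\bm\mu'_k)^\top\bm\Lambda'_k\bm\mu'_k\Bigr);$$ (iii) $q(\bm\beta_s)=\mathcal{N}(\bm\beta_s\mid\bm\eta'_s,(\bm L'_s)^{-1})$ with $$\bm L'_s:=\bm L_s+2\sum_{t=1}^n q(s\preceq\mathsf{s}(\bm u_t))\lambda(\xi_{s,t})\tilde{\bm t}\tilde{\bm t}^\top,\qquad \bm\eta'_s:=(\bm L'_s)^{-1}\Bigl(\bm L_s\bm\eta_s+\sum_{t=1}^n q(s\preceq\mathsf{s}(\bm u_t))\bigl(\varpi'_{t,s,s_1}-\tfrac12\bigr)\tilde{\bm t}\Bigr).$$ Moreover, the update formula of $\xi_{s,t}$ is $$\xi_{s,t}=\bigl(\tilde{\bm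 t}^\top\bigl((\bm L'_s)^{-1}+\bm\eta'_s(\bm\eta'_s)^\top\bigr)\tilde{\bm t}\bigr)^{1/2},$$ i.e., with $q(\bm u)$ and $q(\bm\beta)=\prod_s\mathcal{N}(\bm\beta_s\mid\bm\eta'_s,(\bm L'_s)^{-1})$ held fixed, these values maximize over the new $\bm\xi$ the quantity $\mathbb{E}_{q(\bm u)q(\bm\beta)}[\ln h(\bm u\mid\bm\beta,\bm\xi)]$ (the $\bm\xi$-dependent part of the variational lower bound).
   Context: **Trees.** $T_{\max}$ is the perfect binary rooted tree of depth $D_{\max}\ge 1$ with root $s_\lambda$; $\mathcal{I}_{\max}$, $\mathcal{L}_{\max}$ are its sets of inner and leaf nodes, $\mathcal{S}_{\max}=\mathcal{I}_{\max}\cup\mathcal{L}_{\max}$. $d_s$ is the depth of $s$ ($d_{s_\lambda}=0$). For $s\in\mathcal{I}_{\max}$, $s_0,s_1$ are its left and right children. $s'\preceq s$ means $s'$ is an ancestor of $s$ or equals $s$. $\mathcal{T}$ is the set of all regular rooted subtrees $T$ of $T_{\max}$ with root $s_\lambda$ (each node of $T$ has, in $T$, either both children or none); $\mathcal{I}_T,\mathcal{L}_T$ are the inner and leaf nodes of $T$. $I\{\cdot\}$ is the indicator function. **Variables.** $\bm u=\{\bm u_t\}_{t=1}^n$, $\bm u_t=[u_{t,0},\dots,u_{t,D_{\max}-1}]^\top\in\{0,1\}^{D_{\max}}$; $\mathsf{s}(\bm u_t)\in\mathcal{L}_{\max}$ is the leaf reached from the root by taking at depth $d$ the right branch if $u_{t,d}=1$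 and the left if $u_{t,d}=0$. $\bm z=\{\bm z_s\}_{s\in\mathcal{L}_T}$, each $\bm z_s\in\{0,1\}^K$ one-hot. $\bm\pi$ is a probability vector of length $K$. $\bm\theta=\{\bm\theta_k\}_{k=1}^K$, $\bm\theta_k\in\mathbb{R}^{D+1}$; $\bm\tau=\{\tau_k\}_{k=1}^K$, $\tau_k>0$. $\bm\beta=\{\bm\beta_s\}_{s\in\mathcal{I}_{\max}}$, $\bm\beta_s\in\mathbb{R}^2$. The data $\bm x=(x_1,\dots,x_n)^\top\in\mathbb{R}^n$ are fixed, $\tilde{\bm x}_t=[x_{t-1},\dots,x_{t-D},1]^\top$ (with $x_0,\dots,x_{1-D}$ given real numbers), $\bm X\in\mathbb{R}^{n\times(D+1)}$ is the matrix whose $t$-th row is $\tilde{\bm x}_t^\top$, $\tilde{\bm t}=[t,1]^\top$. **Model.** $p(\bm x,\bm z,T,\bm\theta,\bm\tau,\bm\pi\mid\bm u)=p(\bm x\mid\bm u,\bm z,\bm\theta,\bm\tau,T)\,p(\bm z\mid\bm\pi,T)\,p(T)\,p(\bm\pi)\,p(\bm\theta,\bm\tau)$ with - $p(\bm x\mid\bm u,\bm z,\bm\theta,\bm\tau,T)=\prod_{t=1}^n\prod_{s\in\mathcal{L}_T}\prod_{k=1}^K\mathcal{N}(x_t\mid\tilde{\bm x}_t^\top\bm\theta_k,\tau_k^{-1})^{z_{s,k}I\{s\preceq\mathsf{s}(\bm u_t)\}}$ ($\mathcal{N}(\cdot\mid m,V)$: normal density with mean $m$, (co)variance $V$); - $p(\bm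 z\mid\bm\pi,T)=\prod_{s\in\mathcal{L}_T}\prod_{k=1}^K\pi_k^{z_{s,k}}$; - $p(T)=\prod_{s\in\mathcal{I}_T}g_s\prod_{s\in\mathcal{L}_T}(1-g_s)$, $g_s\in[0,1]$, $g_s=0$ for $s\in\mathcal{L}_{\max}$; - $p(\bm\pi)=\mathrm{Dir}(\bm\pi\mid\bm\alpha)$, $\bm\alpha\in\mathbb{R}_{>0}^K$; - $p(\bm\theta,\bm\tau)=\prod_{k=1}^K\mathcal{N}(\bm\theta_k\mid\bm\mu,(\tau_k\bm\Lambda)^{-1})\,\mathrm{Gam}(\tau_k\mid a,b)$ ($\bm\mu\in\mathbb{R}^{D+1}$, $\bm\Lambda$ positive definite, shape $a>0$, rate $b>0$); - $p(\bm\beta)=\prod_{s\in\mathcal{I}_{\max}}\mathcal{N}(\bm\beta_s\mid\bm\eta_s,\bm L_s^{-1})$ ($\bm\eta_s\in\mathbb{R}^2$, $\bm L_s$ positive definite). **Local variational bound.** $\bm\xi=\{\xi_{s,t}\}_{s\in\mathcal{I}_{\max},1\le t\le n}$, $\xi_{s,t}\in\mathbb{R}$; $\sigma$ is the logistic sigmoid; $\lambda(\xi)=\frac{1}{2\xi}(\sigma(\xi)-\frac12)$, extended by continuity to $\lambda(0)=1/8$. For $u\in\{0,1\}$, $$h(u\mid\bm\beta_s,\xi_{s,t})=\sigma(\xi_{s,t})\exp\bigl\{\bm\beta_s^\top\tilde{\bm t}\,u-\tfrac12(\bm\beta_s^\top\tilde{\bm t}+\xi_{s,t})-\lambda(\xi_{s,t})((\bm\beta_s^\top\tilde{\bm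 t})^2-\xi_{s,t}^2)\bigr\},$$ $$h(\bm u\mid\bm\beta,\bm\xi)=\prod_{t=1}^n\prod_{s\in\mathcal{I}_{\max}}h(u_{t,d_s}\mid\bm\beta_s,\xi_{s,t})^{I\{s\preceq\mathsf{s}(\bm u_t)\}}.$$ **Variational distribution.** The variational distribution has the form $q(\bm u)\,q(\bm z,T)\,q(\bm\theta,\bm\tau,\bm\pi,\bm\beta)$. The given factors are of the form - $q(\bm u)=\prod_{t=1}^n q(\bm u_t)$, $q(\bm u_t)=\prod_{s\in\mathcal{I}_{\max}}\prod_{u\in\{0,1\}}(\varpi'_{t,s,s_u})^{I\{s_u\preceq\mathsf{s}(\bm u_t)\}}$ with $\varpi'_{t,s,s_u}\ge0$, $\varpi'_{t,s,s_0}+\varpi'_{t,s,s_1}=1$ ($0^0=1$); - $q(\bm z,T)=q(T)\prod_{s\in\mathcal{L}_T}q(\bm z_s)$, where $q(T)$ is a probability distribution on $\mathcal{T}$ and $q(\bm z_s)=\prod_{k=1}^K(\pi'_{s,k})^{z_{s,k}}$ with $\pi'_{s,k}\ge0$, $\sum_k\pi'_{s,k}=1$ for every $s\in\mathcal{S}_{\max}$. Log-factors of the model not involving $(\bm\theta,\bm\tau,\bm\pi,\bm\beta)$ are absorbed into ''const.''. *)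

(* Defs.v *)
From HB Require Import structures.
From mathcomp Require Import all_boot all_order all_algebra.
From mathcomp Require Import all_classical all_reals all_analysis.
Set Implicit Arguments.
Unset Strict Implicit.
Unset Printing Implicit Defensive.
Import Order.TTheory GRing.Theory Num.Theory.
Import numFieldNormedType.Exports.
Local Open Scope classical_set_scope.
Local Open Scope ring_scope.

(* The library's product measure \x of two sigma-finite measures, under a name of
   its own because \x is not canonically recognized as sigma-finite. *)
Section sigma_finite_product.
Context d1 d2 (T1 : measurableType d1) (T2 : measurableType d2) (R : realType).
Variable m1 : {sigma_finite_measure set T1 -> \bar R}.
Variable m2 : {sigma_finite_measure set T2 -> \bar R}.

Definition sfprod : set (T1 * T2) -> \bar R := (m1 \x m2)%E.

HB.instance Definition _ := Measure.on sfprod.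

Lemma sfprod_sigma_finite : sigma_finite setT sfprod.
Proof.
have /sigma_finiteP[F [TF ndF Foo]] := sigma_finiteT m1.
have /sigma_finiteP[G [TG ndG Goo]] := sigma_finiteT m2.
exists (fun n => F n `*` G n).
  rewrite -setXTT TF TG predeqE => -[x y]; split.
    move=> [/= [n _ Fnx] [k _ Gky]]; exists (maxn n k) => //; split.
    - by move: x Fnx; exact/subsetPset/ndF/leq_maxl.
    - by move: y Gky; exact/subsetPset/ndG/leq_maxr.
  by move=> [n _ []/= ? ?]; split; exists n.
move=> k; have [? ?] := Foo k; have [? ?] := Goo k.
split; first exact: measurableX.
by rewrite /sfprod product_measure1E// lte_mul_pinfty// ge0_fin_numE.
Qed.

HB.instance Definition _ :=
  Measure_isSigmaFinite.Build _ _ _ sfprod sfprod_sigma_finite.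

End sigma_finite_product.

Section power_measure.
Context d (T : measurableType d) (R : realType).
Variable mu : {sigma_finite_measure set T -> \bar R}.

Section cons_measure.
Variable n : nat.
Variable nu : {sigma_finite_measure set (n.-tuple T) -> \bar R}.

Definition tcons (p : T * n.-tuple T) : n.+1.-tuple T :=
  [the n.+1.-tuple T of p.1 :: p.2].

Lemma measurable_tcons : measurable_fun [set: T * n.-tuple T] tcons.
Proof. exact: measurable_cons measurable_fst measurable_snd. Qed.

Definition cons_measure : set (n.+1.-tuple T) -> \bar R :=
  pushforward (sfprod mu nu) tcons.

Let cons_measure0 : cons_measure set0 = 0%E.
Proof. by rewrite /cons_measure /pushforward preimage_set0 measure0. Qed.

Let cons_measure_ge0 A : (0 <= cons_measure A)%E.
Proof. by rewrite /cons_measure /pushforward; apply: measure_ge0. Qed.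

Let cons_measure_sigma_additive : semi_sigma_additive cons_measure.
Proof.
have mpre A : measurable A -> measurable (tcons @^-1` A).
  by move=> mA; rewrite -[X in measurable X]setTI; exact: measurable_tcons.
move=> F mF tF mUF; rewrite /cons_measure /pushforward preimage_bigcup.
apply: measure_semi_sigma_additive.
- by move=> n'; exact: mpre.
- apply/trivIsetP => /= i j _ _ ij; rewrite -preimage_setI.
  by move/trivIsetP : tF => /(_ _ _ _ _ ij) ->//; rewrite preimage_set0.
- by rewrite -preimage_bigcup; exact: mpre.
Qed.

HB.instance Definition _ := isMeasure.Build _ _ _ cons_measure
  cons_measure0 cons_measure_ge0 cons_measure_sigma_additive.

Lemma cons_measure_sigma_finite : sigma_finite [set: n.+1.-tuple T] cons_measure.
Proof.
have [F FT Foo] := sigma_finiteT (sfprod mu nu).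
pose uncons (v : n.+1.-tuple T) : T * n.-tuple T :=
  (thead v, [tuple of behead v]).
have mu_ : measurable_fun setT uncons.
  by apply/measurable_fun_pairP; split;
    [exact: measurable_tnth|exact: measurable_behead].
have unconsK p : uncons (tcons p) = p.
  by case: p => x t; rewrite /uncons /tcons theadE; congr pair; exact: val_inj.
exists (fun k => uncons @^-1` F k).
  rewrite -preimage_bigcup -FT preimage_setT //.
move=> k; have [mF Fk] := Foo k; split.
  by rewrite -[X in measurable X]setTI; exact: mu_.
rewrite /cons_measure /pushforward [X in sfprod _ _ X](_ : _ = F k)//.
by apply/seteqP; split => p /=; rewrite unconsK.
Qed.

HB.instance Definition _ :=
  Measure_isSigmaFinite.Build _ _ _ cons_measure cons_measure_sigma_finite.

End cons_measure.

Fixpoint power_measure (n : nat) :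
    {sigma_finite_measure set (n.-tuple T) -> \bar R} :=
  if n is n'.+1 then cons_measure (power_measure n')
  else dirac ([tuple] : 0.-tuple T).

End power_measure.

Section densities.
Context {R : realType}.

Definition lebesgue1 : {sigma_finite_measure set (measurableTypeR R) -> \bar R} :=
  lebesgue_measure.

Definition lebesgue_pow (n : nat) := power_measure lebesgue1 n.

Definition dot m (v w : 'cV[R]_m) : R := (v^T *m w) 0 0.

Definition posdefmx m (A : 'M[R]_m) : Prop :=
  A^T = A /\ forall v : 'cV[R]_m, v != 0 -> 0 < dot v (A *m v).

(* V is the covariance matrix, not the precision. *)
Definition mvnormal_pdf m (mu : 'cV[R]_m) (V : 'M[R]_m) (v : 'cV[R]_m) : R :=
  (Num.sqrt ((pi *+ 2) ^+ m * \det V))^-1 *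
  expR (- (dot (v - mu) (invmx V *m (v - mu)) / 2)).

(* The scalar density takes a variance; the library's normal_pdf takes a standard
   deviation. *)
Definition normal1_pdf (m V x : R) : R := normal_pdf m (Num.sqrt V) x.

Definition Gamma (a : R) : R :=
  \int[lebesgue_measure]_(t in `]0, +oo[%classic) (t `^ (a - 1) * expR (- t)).

(* Shape a, rate b. *)
Definition gamma_pdf (a b x : R) : R :=
  b `^ a / Gamma a * x `^ (a - 1) * expR (- b * x).

Definition dirichlet_pdf K (alpha p : 'I_K -> R) : R :=
  Gamma (\sum_(k < K) alpha k) / (\prod_(k < K) Gamma (alpha k)) *
  \prod_(k < K) p k `^ (alpha k - 1).

(* The boundary of the simplex is negligible for the Dirichlet densities. *)
Definition open_simplex K (p : 'I_K -> R) : Prop :=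
  (forall k, 0 < p k) /\ \sum_(k < K) p k = 1.

End densities.

Section trees.
Variable Dmax : nat.

(* A node of the perfect binary tree is the word of branches (false = left, true = right)
   leading to it from the root, so that ancestors are prefixes. *)
Definition node : finType := Dmax.-bseq bool.

Definition root_node : node := [bseq].
Definition depth (s : node) : nat := size s.
Definition is_inner (s : node) : bool := (depth s < Dmax)%N.
Definition inode : finType := {s : node | is_inner s}.

Definition preceq (s' s : node) : bool := prefix s' s.

Lemma child_subproof (s : inode) (b : bool) : (size (rcons (val s) b) <= Dmax)%N.
Proof. by rewrite size_rcons; exact: (valP s). Qed.

Definition child (s : inode) (b : bool) : node := Bseq (child_subproof s b).

Definition inode_depth (s : inode) : 'I_Dmax := Ordinal (valP s).

Definition leaf_of (v : Dmax.-tuple bool) : node := bseq_of_tuple v.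

Definition regular_subtree (A : {set node}) : bool :=
  [&& root_node \in A,
      [forall s in A, forall s', preceq s' s ==> (s' \in A)] &
      [forall s : inode, (child s false \in A) == (child s true \in A)]].

Definition tree : finType := {A : {set node} | regular_subtree A}.

Definition tree_inner (T : tree) : {set node} :=
  [set val s | s : inode & [exists b, child s b \in val T]].

Definition tree_leaves (T : tree) : {set node} := val T :\: tree_inner T.

Definition tree_leaf (T : tree) : finType := {s : node | s \in tree_leaves T}.

End trees.

Definition onehot (K : nat) : finType :=
  {e : {ffun 'I_K -> bool} | #|[pred k | e k]| == 1%N}.

Definition assignment (Dmax K : nat) (T : tree Dmax) : finType :=
  {ffun tree_leaf T -> onehot K}.

Definition entry Dmax K (T : tree Dmax) (z : assignment K T) (s : tree_leaf T)
    (k : 'I_K) : bool := val (z s) k.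

Section model.
Context {R : realType}.
Variables (Dmax K D n : nat).

Definition inputs : finType := {ffun 'I_n -> Dmax.-tuple bool}.

(* The index t : 'I_n stands for the time t.+1; the series x is indexed by int, and only
   its values at 1 - D, .., n matter. *)
Definition xtilde (x : int -> R) (t : 'I_n) : 'cV[R]_D.+1 :=
  \col_(i < D.+1) if (i < D)%N then x (t.+1%:Z - i.+1%:Z) else 1.

Definition xvec (x : int -> R) : 'cV[R]_n := \col_t x t.+1%:Z.

Definition design (x : int -> R) : 'M[R]_(n, D.+1) := \matrix_(t, i) xtilde x t i 0.

Definition ttilde (t : 'I_n) : 'cV[R]_2 :=
  \col_(i < 2) if i == 0 then t.+1%:R else 1.

Definition p_x (x : int -> R) (u : inputs) (T : tree Dmax) (z : assignment K T)
    (theta : 'I_K -> 'cV[R]_D.+1) (tau : 'I_K -> R) : R :=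
  \prod_(t < n) \prod_(s : tree_leaf T) \prod_(k < K)
    normal1_pdf (dot (xtilde x t) (theta k)) (tau k)^-1 (x t.+1%:Z)
      ^+ (entry z s k * preceq (val s) (leaf_of (u t))).

Definition p_z (p : 'I_K -> R) (T : tree Dmax) (z : assignment K T) : R :=
  \prod_(s : tree_leaf T) \prod_(k < K) p k ^+ entry z s k.

Definition p_T (g : node Dmax -> R) (T : tree Dmax) : R :=
  (\prod_(s in tree_inner T) g s) * (\prod_(s in tree_leaves T) (1 - g s)).

Definition normal_gamma_pdf (mu : 'cV[R]_D.+1) (Lam : 'M[R]_D.+1) (a b : R)
    (th : 'cV[R]_D.+1) (ta : R) : R :=
  mvnormal_pdf mu (invmx (ta *: Lam)) th * gamma_pdf a b ta.

Definition p_theta_tau (mu : 'cV[R]_D.+1) (Lam : 'M[R]_D.+1) (a b : R)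
    (theta : 'I_K -> 'cV[R]_D.+1) (tau : 'I_K -> R) : R :=
  \prod_(k < K) normal_gamma_pdf mu Lam a b (theta k) (tau k).

Definition beta_pdf (eta : inode Dmax -> 'cV[R]_2) (L : inode Dmax -> 'M[R]_2)
    (beta : inode Dmax -> 'cV[R]_2) : R :=
  \prod_(s : inode Dmax) mvnormal_pdf (eta s) (invmx (L s)) (beta s).

Definition sigmoid (y : R) : R := (1 + expR (- y))^-1.

Definition lambda (xi : R) : R :=
  if xi == 0 then 8^-1 else (2 * xi)^-1 * (sigmoid xi - 2^-1).

Definition h_loc (b : bool) (be : 'cV[R]_2) (t : 'I_n) (xi : R) : R :=
  let y := dot be (ttilde t) in
  sigmoid xi * expR (y * b%:R - 2^-1 * (y + xi) - lambda xi * (y ^+ 2 - xi ^+ 2)).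

Definition h_bound (u : inputs) (beta : inode Dmax -> 'cV[R]_2)
    (xi : inode Dmax -> 'I_n -> R) : R :=
  \prod_(t < n) \prod_(s : inode Dmax)
    h_loc (tnth (u t) (inode_depth s)) (beta s) t (xi s t)
      ^+ preceq (val s) (leaf_of (u t)).

Definition p_joint (x : int -> R) (g : node Dmax -> R) (alpha : 'I_K -> R)
    (mu : 'cV[R]_D.+1) (Lam : 'M[R]_D.+1) (a b : R)
    (theta : 'I_K -> 'cV[R]_D.+1) (tau p : 'I_K -> R)
    (u : inputs) (T : tree Dmax) (z : assignment K T) : R :=
  p_x x u z theta tau * p_z p z * p_T g T * dirichlet_pdf alpha p *
  p_theta_tau mu Lam a b theta tau.

(* ln (p_joint h p(beta)) with the factor p(T), which depends on no continuous parameter,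
   split off (see ln_jointE). Since g_s may be 0 or 1, p(T) may vanish; then ln (p_T g T)
   is the library's ln 0 = 0, i.e. this term goes into the additive constant instead of
   making the expectation infinite. *)
Definition ln_joint (x : int -> R) (g : node Dmax -> R) (alpha : 'I_K -> R)
    (mu : 'cV[R]_D.+1) (Lam : 'M[R]_D.+1) (a b : R)
    (eta : inode Dmax -> 'cV[R]_2) (L : inode Dmax -> 'M[R]_2)
    (xi : inode Dmax -> 'I_n -> R)
    (theta : 'I_K -> 'cV[R]_D.+1) (tau p : 'I_K -> R) (beta : inode Dmax -> 'cV[R]_2)
    (u : inputs) (T : tree Dmax) (z : assignment K T) : R :=
  ln (p_x x u z theta tau * p_z p z * dirichlet_pdf alpha p *
      p_theta_tau mu Lam a b theta tau * h_bound u beta xi * beta_pdf eta L beta)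
  + ln (p_T g T).

Lemma ln_jointE (x : int -> R) (g : node Dmax -> R) (alpha : 'I_K -> R)
    (mu : 'cV[R]_D.+1) (Lam : 'M[R]_D.+1) (a b : R)
    (eta : inode Dmax -> 'cV[R]_2) (L : inode Dmax -> 'M[R]_2)
    (xi : inode Dmax -> 'I_n -> R)
    (theta : 'I_K -> 'cV[R]_D.+1) (tau p : 'I_K -> R) (beta : inode Dmax -> 'cV[R]_2)
    (u : inputs) (T : tree Dmax) (z : assignment K T) :
  0 < p_T g T ->
  0 < p_joint x g alpha mu Lam a b theta tau p u z * h_bound u beta xi *
      beta_pdf eta L beta ->
  ln_joint x g alpha mu Lam a b eta L xi theta tau p beta u z =
  ln (p_joint x g alpha mu Lam a b theta tau p u z * h_bound u beta xi *
      beta_pdf eta L beta).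
Proof.
rewrite /p_joint /ln_joint => T_gt0.
set A := p_x _ _ _ _ _; set B := p_z _ _; set C := dirichlet_pdf _ _.
set E := p_theta_tau _ _ _ _ _ _; set H := h_bound _ _ _; set F := beta_pdf _ _ _.
have -> : A * B * p_T g T * C * E * H * F = (A * B * C * E * H * F) * p_T g T.
  by rewrite !(mulrAC _ (p_T g T)).
by rewrite pmulr_lgt0// => rest_gt0; rewrite [RHS]lnM ?posrE.
Qed.

Definition q_ut (varpi : 'I_n -> inode Dmax -> bool -> R) (t : 'I_n)
    (v : Dmax.-tuple bool) : R :=
  \prod_(s : inode Dmax) \prod_(b : bool)
    varpi t s b ^+ preceq (child s b) (leaf_of v).

Definition q_u (varpi : 'I_n -> inode Dmax -> bool -> R) (u : inputs) : R :=
  \prod_(t < n) q_ut varpi t (u t).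

Definition q_zT (qT : tree Dmax -> R) (pi' : node Dmax -> 'I_K -> R)
    (T : tree Dmax) (z : assignment K T) : R :=
  qT T * \prod_(s : tree_leaf T) \prod_(k < K) pi' (val s) k ^+ entry z s k.

Definition E_u (varpi : 'I_n -> inode Dmax -> bool -> R) (f : inputs -> R) : R :=
  \sum_(u : inputs) q_u varpi u * f u.

Definition E_zT (qT : tree Dmax -> R) (pi' : node Dmax -> 'I_K -> R)
    (f : forall T : tree Dmax, assignment K T -> R) : R :=
  \sum_(T : tree Dmax) \sum_(z : assignment K T) q_zT qT pi' z * f T z.

Definition q_prec (varpi : 'I_n -> inode Dmax -> bool -> R) (s : node Dmax)
    (t : 'I_n) : R :=
  \sum_(v : Dmax.-tuple bool) q_ut varpi t v * (preceq s (leaf_of v))%:R.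

Definition Qmx (varpi : 'I_n -> inode Dmax -> bool -> R) (s : node Dmax) : 'M[R]_n :=
  diag_mx (\row_t q_prec varpi s t).

Definition q_leaf (qT : tree Dmax -> R) (s : node Dmax) : R :=
  \sum_(T : tree Dmax) qT T * (s \in tree_leaves T)%:R.

(* The coordinates of (theta, tau, pi, beta); a point of the simplex is given by its first
   K - 1 coordinates. *)
Definition coords : Type :=
  ((K.-tuple (D.+1.-tuple (measurableTypeR R)) * K.-tuple (measurableTypeR R)) *
   (K.-1).-tuple (measurableTypeR R) *
   #|inode Dmax|.-tuple (2.-tuple (measurableTypeR R)))%type.

Definition beta_mu := power_measure (@lebesgue_pow R 2) #|inode Dmax|.

Definition coords_mu :=
  sfprod (sfprod (sfprod (power_measure (@lebesgue_pow R D.+1) K) (@lebesgue_pow R K))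
                 (@lebesgue_pow R K.-1))
         beta_mu.

Definition vec m (v : m.-tuple (measurableTypeR R)) : 'cV[R]_m := \col_i tnth v i.

Definition beta_of (w : #|inode Dmax|.-tuple (2.-tuple (measurableTypeR R))) (s : inode Dmax) :
    'cV[R]_2 :=
  vec (tnth w (enum_rank s)).

Definition pi_of (w : (K.-1).-tuple (measurableTypeR R)) (k : 'I_K) : R :=
  if (k < K.-1)%N then nth 0 w k else 1 - \sum_(j < K.-1) tnth w j.

Definition at_coords (rT : Type)
    (f : ('I_K -> 'cV[R]_D.+1) -> ('I_K -> R) -> ('I_K -> R) ->
         (inode Dmax -> 'cV[R]_2) -> rT)
    (w : coords) : rT :=
  f (fun k => vec (tnth w.1.1.1 k)) (tnth w.1.1.2) (pi_of w.1.2) (beta_of w.2).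

Definition admissible (theta : 'I_K -> 'cV[R]_D.+1) (tau p : 'I_K -> R)
    (beta : inode Dmax -> 'cV[R]_2) : Prop :=
  (forall k, 0 < tau k) /\ open_simplex p.

Definition is_prob_density
    (q : ('I_K -> 'cV[R]_D.+1) -> ('I_K -> R) -> ('I_K -> R) ->
         (inode Dmax -> 'cV[R]_2) -> R) : Prop :=
  let dom := [set w | at_coords admissible w] in
  [/\ measurable_fun dom (at_coords q),
      forall theta tau p beta, admissible theta tau p beta -> 0 <= q theta tau p beta &
      (\int[coords_mu]_(w in dom) (at_coords q w)%:E = 1)%E].

Definition E_ln_h (varpi : 'I_n -> inode Dmax -> bool -> R)
    (eta : inode Dmax -> 'cV[R]_2) (L : inode Dmax -> 'M[R]_2)
    (xi : inode Dmax -> 'I_n -> R) : R :=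
  E_u varpi (fun u =>
    \int[beta_mu]_w (beta_pdf eta L (beta_of w) * ln (h_bound u (beta_of w) xi))).

End model.

(* Main.v *)
Require Import Defs.
From mathcomp Require Import all_boot all_order all_algebra.
From mathcomp Require Import all_classical all_reals all_analysis.
From mathcomp Require Import measurable_realfun.
From mathcomp Require Import ring lra.
Import Order.TTheory GRing.Theory Num.Theory.
Import numFieldNormedType.Exports.
Local Open Scope classical_set_scope.
Local Open Scope ring_scope.

(* With p(T) split off, the expected log-joint is, up to an additive constant, the
   logarithm of a product of Dirichlet, normal-gamma and normal densities: the
   expectations of the indicators follow from q(s_b <= s(u_t)) = q(s <= s(u_t))
   varpi_{t,s,b}, and then one completes the square in each theta_k and each beta_s.
   Since q is a probability density proportional to this product, it only remains to
   see that the product integrates to 1. Gaussian integrals are computed by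
   integrating out the first coordinate, which replaces the precision matrix by its
   Schur complement; the Dirichlet integral is an iterated convolution of the kernels
   x^(a-1) / Gamma(a). For the update of xi, the expectation of ln h depends on
   xi_{s,t} through phi(xi) - lambda(xi) (m - xi^2), where phi = ln sigma - id/2 and m
   is the second moment of the linear predictor; as phi is a convex function of the
   squared argument with slope -lambda, this tangent bound is largest at xi^2 = m. *)

Set Implicit Arguments.
Unset Strict Implicit.
Unset Printing Implicit Defensive.

(** * Product and power measures *)

(** Conjugacy is tracked only up to additive constants: each update lemma asserts that some constant
    exists, and comparing total masses fixes its value once, at the end. The price is that the
    updated parameters must be shown admissible (precision matrices positive definite, a' and b'
    positive) before mass 1 can be claimed. Integrals are kept nonnegative as long as possible,
    where Tonelli asks for no integrability: densities are multiplied by the indicators of tau > 0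
    and of the open simplex and integrated over the whole coordinate space, and Gaussian moments are
    taken of squares of affine forms only. The signed integrand of the xi update appears late and is
    recovered from such squares by polarization. One Gaussian induction thus serves both the
    normalization of theta and beta and the second moments. *)

Lemma measurable_fun_bool_natr d (T : measurableType d) (R : realType) (D : set T)
    (b : T -> bool) :
  measurable_fun D b -> measurable_fun D (fun x => (b x)%:R : R).
Proof. exact: (measurableT_comp (f := fun c : bool => c%:R : R)). Qed.

Section product_measures.
Context d1 d2 (T1 : measurableType d1) (T2 : measurableType d2) (R : realType).
Variable m1 : {sigma_finite_measure set T1 -> \bar R}.
Variable m2 : {sigma_finite_measure set T2 -> \bar R}.
Local Open Scope ereal_scope.

Lemma integral_sfprod (f : T1 * T2 -> \bar R) :
  measurable_fun setT f -> (forall z, 0 <= f z) ->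
  \int[sfprod m1 m2]_z f z = \int[m1]_x \int[m2]_y f (x, y).
Proof. by move=> mf f0; exact: fubini_tonelli1. Qed.

Lemma integral_sfprod_swap (f : T1 * T2 -> \bar R) :
  measurable_fun setT f -> (forall z, 0 <= f z) ->
  \int[sfprod m1 m2]_z f z = \int[m2]_y \int[m1]_x f (x, y).
Proof. by move=> mf f0; exact: fubini_tonelli2. Qed.

Lemma integral_sfprod_mul (f : T1 -> R) (g : T2 -> R) :
  measurable_fun setT f -> (forall x, 0 <= f x)%R ->
  measurable_fun setT g -> (forall x, 0 <= g x)%R ->
  \int[sfprod m1 m2]_z (f z.1 * g z.2)%:E =
  \int[m1]_x (f x)%:E * \int[m2]_y (g y)%:E.
Proof.
move=> mf f0 mg g0; rewrite integral_sfprod//=; last 2 first.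
- by apply/measurable_EFinP; apply: measurable_funM; exact: measurableT_comp.
- by move=> z; rewrite lee_fin mulr_ge0.
under eq_integral => x _.
  under eq_integral do rewrite EFinM.
  rewrite ge0_integralZl//; last 3 first.
  - exact/measurable_EFinP.
  - by move=> y _; rewrite lee_fin.
  - by rewrite lee_fin.
  over.
rewrite ge0_integralZr//.
- exact/measurable_EFinP.
- by move=> ? _; rewrite lee_fin.
- by apply: integral_ge0 => y _; rewrite lee_fin.
Qed.

End product_measures.

Section power_measures.
Context d (T : measurableType d) (R : realType).
Variable mu : {sigma_finite_measure set T -> \bar R}.
Local Open Scope ereal_scope.

Lemma integral_power0 (f : 0.-tuple T -> \bar R) :
  measurable_fun setT f -> \int[power_measure mu 0]_w f w = f [tuple].
Proof. by move=> mf; rewrite /= integral_dirac// diracT mul1e. Qed.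

Lemma integral_powerS n (f : n.+1.-tuple T -> \bar R) :
  measurable_fun setT f -> (forall w, 0 <= f w) ->
  \int[power_measure mu n.+1]_w f w =
  \int[sfprod mu (power_measure mu n)]_z f (tcons z).
Proof.
move=> mf f0; rewrite /= ge0_integral_pushforward//.
exact: measurable_tcons.
Qed.

Lemma tnth_tcons0 n (z : T * n.-tuple T) : tnth (tcons z) ord0 = z.1.
Proof. by rewrite (tnth_nth z.1). Qed.

Lemma tnth_tcons_lift n (z : T * n.-tuple T) (i : 'I_n) :
  tnth (tcons z) (lift ord0 i) = tnth z.2 i.
Proof. by rewrite !(tnth_nth z.1). Qed.

Lemma integral_power_prod n (f : 'I_n -> T -> R) :
  (forall i, measurable_fun setT (f i)) -> (forall i x, 0 <= f i x)%R ->
  \int[power_measure mu n]_w (\prod_(i < n) f i (tnth w i))%:E =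
  \prod_(i < n) \int[mu]_x (f i x)%:E.
Proof.
elim: n f => [|n IHn] f mf f0.
  rewrite integral_power0 ?big_ord0//.
  by apply/measurable_EFinP; apply: measurable_prod => -[].
rewrite integral_powerS; last 2 first.
- apply/measurable_EFinP; apply: measurable_prod => i _.
  by apply: measurableT_comp => //; exact: measurable_tnth.
- by move=> w; rewrite lee_fin prodr_ge0.
rewrite big_ord_recl -IHn//.
under eq_integral => z _.
  rewrite big_ord_recl tnth_tcons0; under eq_bigr do rewrite tnth_tcons_lift.
  over.
rewrite (@integral_sfprod_mul _ _ _ _ _ _ _ (f ord0)
  (fun w => \prod_(i < n) f (lift ord0 i) (tnth w i))%R)//.
- apply: measurable_prod => i _.
  by apply: measurableT_comp => //; exact: measurable_tnth.
- by move=> w; rewrite prodr_ge0.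
Qed.

End power_measures.

(** * Gaussian integrals *)

Section affine_change_of_variable.
Context {R : realType}.
Local Notation leb := (@lebesgue_measure R).
Local Open Scope ereal_scope.

Lemma measurable_affine (c e : R) :
  measurable_fun setT ((fun x => c * x + e)%R : measurableTypeR R -> measurableTypeR R).
Proof. by apply: measurable_funD => //; exact: mulrl_measurable. Qed.

(** Lebesgue measure is determined by its values on half-open intervals. A negative slope turns the
    preimage of an interval open on the left into one open on the right, of the same length, hence
    the two cases. *)
Lemma lebesgue_measure_affine (c e : R) (A : set R) : (c != 0)%R ->
  measurable A ->
  leb A = `|c|%:E * pushforward leb ((fun x => c * x + e)%R : measurableTypeR R -> measurableTypeR R) A.
Proof.
move=> c0 mA.
pose phi : measurableTypeR R -> measurableTypeR R := (fun x => c * x + e)%R.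
have mphi : measurable_fun setT phi by exact: measurable_affine.
(* The measure structure of the push-forward depends on the proof [mphi]; hiding it behind an
   equation gives a plain measure [nu0] to work with. *)
have [nu0 nu0E] : exists nu : {measure set (measurableTypeR R) -> \bar R},
    nu = pushforward leb phi :> (set _ -> \bar R).
  by eexists (@measure_function_pushforward__canonical__measure_function_Measure _ _ _ _ _ leb phi mphi).
pose nu := mscale (NngNum (normr_ge0 c)) nu0.
suff -> : leb A = nu A by rewrite /nu /mscale/= nu0E.
apply: lebesgue_measure_unique => //= _ [[a b]] _ <-.
rewrite /nu /mscale /= nu0E /pushforward/= /phi.
have [c_lt0|c_gt0|c_eq0] := ltgtP c 0%R; last by rewrite c_eq0 eqxx in c0.
- rewrite (_ : _ @^-1` _ = `[(b - e) / c, (a - e) / c[%classic)%R; last first.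
    apply/seteqP; split => x /=; rewrite !in_itv/= -ltrBlDr -lerBrDr;
      by rewrite ler_ndivrMr// ltr_ndivlMr// ![(x * c)%R]mulrC => /andP[-> ->].
  rewrite !lebesgue_measure_itv/= !lte_fin ltr_nM2r ?invr_lt0// ltrD2r.
  case: ifPn => ab; last by rewrite mule0.
  by rewrite -!EFinB -EFinM ltr0_norm//; congr EFin; field.
- rewrite (_ : _ @^-1` _ = `](a - e) / c, (b - e) / c]%classic)%R; last first.
    apply/seteqP; split => x /=; rewrite !in_itv/= -ltrBlDr -lerBrDr;
      by rewrite ler_pdivlMr// ltr_pdivrMr// ![(x * c)%R]mulrC => /andP[-> ->].
  rewrite !lebesgue_measure_itv/= !lte_fin ltr_pM2r ?invr_gt0// ltrD2r.
  case: ifPn => ab; last by rewrite mule0.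
  by rewrite -!EFinB -EFinM gtr0_norm//; congr EFin; field.
Qed.

(** Used with slope -1 for reflection, slope 1 for translation, and positive slopes for
    rescaling. *)
Lemma ge0_integral_affine (c e : R) (f : R -> \bar R) : (c != 0)%R ->
  measurable_fun setT f -> (forall x, 0 <= f x) ->
  \int[leb]_x f x = `|c|%:E * \int[leb]_x f (c * x + e)%R.
Proof.
move=> c0 mf f0.
pose phi : measurableTypeR R -> measurableTypeR R := (fun x => c * x + e)%R.
have mphi : measurable_fun setT phi by exact: measurable_affine.
have [nu0 nu0E] : exists nu : {measure set (measurableTypeR R) -> \bar R},
    nu = pushforward leb phi :> (set _ -> \bar R).
  by eexists (@measure_function_pushforward__canonical__measure_function_Measure _ _ _ _ _ leb phi mphi).
transitivity (\int[mscale (NngNum (normr_ge0 c)) nu0]_x f x).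
  apply: eq_measure_integral => A mA _.
  by rewrite [LHS](lebesgue_measure_affine e c0 mA) -/phi -nu0E.
rewrite ge0_integral_mscale//; congr (_ * _).
by rewrite nu0E ge0_integral_pushforward.
Qed.

End affine_change_of_variable.

Section gauss_moments.
Context {R : realType}.
Local Notation leb := (@lebesgue_measure R).
Local Open Scope ereal_scope.

(** [- gauss_fun] is an antiderivative of the integrand and tends to 0 at infinity. *)
Lemma integral_gauss_tail (y : R) : (0 <= y)%R ->
  \int[leb]_(x in `[y, +oo[) (2 * x * gauss_fun x)%:E = (gauss_fun y)%:E.
Proof.
move=> y0.
have dF (x : R) : is_derive x 1%R (fun x => - gauss_fun x)%R (2 * x * gauss_fun x)%R.
  rewrite /gauss_fun; apply: is_derive_eq.
  rewrite /GRing.scale/=; ring.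
have -> : (gauss_fun y)%:E = 0%:E - (- gauss_fun y)%R%:E by rewrite sub0e -EFinN opprK.
apply: (@ge0_continuous_FTC2y _ _ (fun x => - gauss_fun x)%R).
- by move=> x yx; rewrite !mulr_ge0// ?gauss_fun_ge0// (le_trans y0).
- apply: continuous_subspaceT => x.
  apply: cvgM; last exact: continuous_gauss_fun.
  by apply: cvgM; [exact: cvg_cst|exact: cvg_id].
- rewrite -oppr0; apply: cvgN; exact: cvg_gauss_fun.
- by move=> x _; case: (dF x).
- by apply: cvg_at_right_filter; apply: cvgN; exact: continuous_gauss_fun.
- by move=> x _; rewrite derive1E; case: (dF x).
Qed.

Lemma integral_bool_itv (y : R) : (0 <= y)%R ->
  \int[leb]_x ((0 <= x <= y)%R%:R)%:E = y%:E.
Proof.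
move=> y0; transitivity (\int[leb]_(x in `[0%R, y]) 1%:E).
  rewrite [RHS]integral_mkcond; apply: eq_integral => x _.
  by rewrite /patch mem_setE in_itv/=; case: ifPn.
rewrite integral_cst; last exact: measurable_itv.
transitivity (leb `[0%R, y]%classic); first exact: mul1e.
rewrite lebesgue_measure_itv/= lte_fin.
move: y0; rewrite le_eqVlt => /orP[/eqP <-|y0]; first by rewrite ltxx.
by rewrite y0 -EFinB subr0.
Qed.

Lemma measurable_gauss_funT : measurable_fun [set: measurableTypeR R] (@gauss_fun R).
Proof. exact: measurable_gauss_fun. Qed.

(* Write [gauss_fun y] as its tail integral and exchange the two integrals. *)
Lemma integral_sqr_gauss :
  \int[leb]_x (x ^+ 2 * gauss_fun x)%:E = (Num.sqrt pi / 2)%:E.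
Proof.
rewrite ge0_symfun_integralT; last 3 first.
- by move=> x; rewrite mulr_ge0// ?sqr_ge0 ?gauss_fun_ge0.
- move=> x; apply: cvgM; last exact: continuous_gauss_fun.
  exact: sqr_continuous.
- by move=> x /=; rewrite /gauss_fun sqrrN.
rewrite -integral0y_gauss -set_itvcy -ge0_integralZl//; last 2 first.
- apply: measurable_funTS; apply/measurable_EFinP.
  by apply: measurable_funM; [exact: exprn_measurable|exact: measurable_gauss_fun].
- by move=> x _; rewrite lee_fin mulr_ge0// ?sqr_ge0 ?gauss_fun_ge0.
(* [f (x, y)] is 2 y exp(-y^2) on 0 <= x <= y and 0 elsewhere. Integrating over y leaves
   [gauss_fun x]; integrating over x leaves 2 y^2 exp(-y^2). *)
pose f (z : measurableTypeR R * measurableTypeR R) : \bar R :=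
  let x : R := z.1 in let y : R := z.2 in
  (((0 <= x) && (x <= y))%:R * (2 * y * gauss_fun y) : R)%R%:E.
have f0 z : 0 <= f z.
  rewrite /f lee_fin; case: (boolP (_ && _)) => [/andP[z1 z12]|_]; last by rewrite mul0r.
  by rewrite mul1r !mulr_ge0// ?gauss_fun_ge0// (le_trans z1).
have mf : measurable_fun setT f.
  apply/measurable_EFinP; apply: measurable_funM.
    apply: measurable_fun_bool_natr; apply: measurable_and.
      by apply: (@measurable_fun_ler _ _ R _ (cst 0%R) fst) => //; exact: measurable_fst.
    apply: (@measurable_fun_ler _ _ R _ fst snd); [exact: measurable_fst|exact: measurable_snd].
  apply: measurable_funM; last first.
    by apply: (measurableT_comp measurable_gauss_funT); exact: measurable_snd.
  by apply: measurable_funM => //; exact: measurable_snd.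
have fub := @fubini_tonelli _ _ _ _ R leb leb f mf f0.
transitivity (\int[leb]_y \int[leb]_x f (x, y)); last first.
  rewrite -[LHS]fub [RHS]integral_mkcond; apply: eq_integral => y _.
  rewrite /patch mem_setE in_itv/= andbT; case: ifPn => y0; last first.
    under eq_integral do rewrite /f/= (negbTE y0) mul0r.
    by rewrite integral0.
  rewrite -[RHS](integral_gauss_tail y0) [RHS]integral_mkcond; apply: eq_integral => x _.
  by rewrite /patch /f/= y0/= mem_setE in_itv/= andbT; case: ifPn; rewrite ?mul1r ?mul0r.
rewrite integral_mkcond; apply: eq_integral => y _.
rewrite /patch mem_setE in_itv/= andbT; case: ifPn => y0; last first.
  under eq_integral => x _.
    rewrite /f/= (_ : _ && _ = false); last first.
      by apply/negbTE; apply: contra y0 => /andP[]; exact: le_trans.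
    rewrite mul0r; over.
  by rewrite integral0.
under eq_integral => x _ do rewrite /f/= mulrC EFinM.
rewrite (ge0_integralZl leb measurableT); last 3 first.
- apply/measurable_EFinP.
  apply: measurable_fun_bool_natr; apply: measurable_and.
    by apply: (@measurable_fun_ler _ _ R _ (cst 0%R) id).
  by apply: (@measurable_fun_ler _ _ R _ id (cst y)).
- by move=> x _; rewrite lee_fin.
- rewrite lee_fin; apply: mulr_ge0; last exact: gauss_fun_ge0.
  exact: mulr_ge0.
have -> := integral_bool_itv y0.
by rewrite -!EFinM; congr EFin; ring.
Qed.

End gauss_moments.

(** * Algebra and measurability of the dot product *)

Section dot_product.
Context {R : realType}.

Lemma dotE m (v w : 'cV[R]_m) : dot v w = \sum_i v i 0 * w i 0.
Proof. by rewrite /dot mxE; apply: eq_bigr => i _; rewrite mxE. Qed.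

Lemma dotC m (v w : 'cV[R]_m) : dot v w = dot w v.
Proof. by rewrite !dotE; apply: eq_bigr => i _; rewrite mulrC. Qed.

Lemma dotDl m (u v w : 'cV[R]_m) : dot (u + v) w = dot u w + dot v w.
Proof. by rewrite /dot linearD/= mulmxDl mxE. Qed.

Lemma dotDr m (u v w : 'cV[R]_m) : dot w (u + v) = dot w u + dot w v.
Proof. by rewrite dotC dotDl !(dotC w). Qed.

Lemma dotZl m k (v w : 'cV[R]_m) : dot (k *: v) w = k * dot v w.
Proof. by rewrite /dot linearZ/= -scalemxAl mxE. Qed.

Lemma dotZr m k (v w : 'cV[R]_m) : dot w (k *: v) = k * dot w v.
Proof. by rewrite dotC dotZl dotC. Qed.

Lemma dotNl m (v w : 'cV[R]_m) : dot (- v) w = - dot v w.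
Proof. by rewrite -scaleN1r dotZl mulN1r. Qed.

Lemma dotNr m (v w : 'cV[R]_m) : dot w (- v) = - dot w v.
Proof. by rewrite dotC dotNl dotC. Qed.

Lemma dot0l m (w : 'cV[R]_m) : dot 0 w = 0.
Proof. by rewrite -[0](scale0r w) dotZl mul0r. Qed.

Lemma dot0r m (w : 'cV[R]_m) : dot w 0 = 0.
Proof. by rewrite dotC dot0l. Qed.

Lemma dot_suml m (I : Type) (r : seq I) (f : I -> 'cV[R]_m) w :
  dot (\sum_(i <- r) f i) w = \sum_(i <- r) dot (f i) w.
Proof.
by elim/big_rec2: _ => [|i x y _ <-]; rewrite ?dot0l ?dotDl.
Qed.

Lemma dot_sumr m (I : Type) (r : seq I) (f : I -> 'cV[R]_m) w :
  dot w (\sum_(i <- r) f i) = \sum_(i <- r) dot w (f i).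
Proof. by rewrite dotC dot_suml; apply: eq_bigr => i _; rewrite dotC. Qed.

Lemma dot_mulmx m n (A : 'M[R]_(m, n)) v w : dot v (A *m w) = dot (A^T *m v) w.
Proof. by rewrite /dot trmx_mul trmxK mulmxA. Qed.

Lemma dot_rank1 m (a v : 'cV[R]_m) : dot v ((a *m a^T) *m v) = dot a v ^+ 2.
Proof.
by rewrite -mulmxA [a^T *m v]mx11_scalar mul_mx_scalar dotZr -/(dot a v) dotC.
Qed.

Lemma dot_col_mx m1 m2 (a c : 'cV[R]_m1) (b d : 'cV[R]_m2) :
  dot (col_mx a b) (col_mx c d) = dot a c + dot b d.
Proof. by rewrite /dot tr_col_mx mul_row_col mxE. Qed.

Lemma dot_scalar_mx (x y : R) : dot (x%:M : 'cV_1) y%:M = x * y.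
Proof. by rewrite dotE big_ord1 !mxE. Qed.

Lemma measurable_dot d (T : measurableType d) m (f g : T -> 'cV[R]_m) :
  (forall i, measurable_fun setT (fun t => f t i 0)) ->
  (forall i, measurable_fun setT (fun t => g t i 0)) ->
  measurable_fun setT (fun t => dot (f t) (g t)).
Proof.
move=> mf mg; under eq_fun do rewrite dotE.
by apply: measurable_sum => i; exact: measurable_funM.
Qed.

Lemma measurable_mulmx d (T : measurableType d) m n (A : 'M[R]_(m, n))
    (f : T -> 'cV[R]_n) i :
  (forall i, measurable_fun setT (fun t => f t i 0)) ->
  measurable_fun setT (fun t => (A *m f t) i 0).
Proof.
move=> mf; under eq_fun do rewrite mxE.
by apply: measurable_sum => j; exact: measurable_funM.
Qed.

Lemma measurable_vec m (i : 'I_m) :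
  measurable_fun setT (fun w : m.-tuple (measurableTypeR R) => vec w i 0 : R).
Proof. by under eq_fun do rewrite mxE; exact: measurable_tnth. Qed.

Lemma measurable_vecB m (mu : 'cV[R]_m) (i : 'I_m) :
  measurable_fun setT (fun w : m.-tuple (measurableTypeR R) => (vec w - mu) i 0 : R).
Proof.
under eq_fun do rewrite mxE mxE [X in _ + X]mxE.
by apply: measurable_funD => //; exact: measurable_tnth.
Qed.

End dot_product.

(** * Positive definite forms and elimination of the first coordinate *)

Section schur_complement.
Context {R : realType} {m : nat}.
Variable A : 'M[R]_(1 + m).
Hypothesis A_pos : posdefmx A.

Let al := A 0 0.
Let a := dlsubmx A.
Definition schur : 'M[R]_m := drsubmx A - al^-1 *: (a *m a^T).

Lemma posdef_blockE : A = block_mx al%:M a^T a (drsubmx A).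
Proof.
rewrite -[LHS]submxK; congr block_mx.
  rewrite [LHS]mx11_scalar !mxE /al; congr (A _ _)%:M;
  exact: val_inj.
by rewrite /a trmx_dlsub; case: A_pos => ->.
Qed.

Lemma posdef_mul_col (x : R) (w : 'cV[R]_m) :
  A *m col_mx x%:M w = col_mx (al * x + dot a w)%:M (x *: a + drsubmx A *m w).
Proof.
rewrite [in LHS]posdef_blockE mul_block_col; congr col_mx; last by rewrite mul_mx_scalar.
by rewrite [a^T *m w]mx11_scalar -/(dot a w) -scalar_mxM -raddfD.
Qed.

Lemma posdef_corner_gt0 : 0 < al.
Proof.
have [_ /(_ (col_mx 1%:M 0))] := A_pos.
rewrite posdef_mul_col dot_col_mx dot0l dot_scalar_mx dot0r !(mulr1, addr0, mul1r); apply.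
apply/eqP => /(congr1 usubmx); rewrite col_mxKu => /matrixP/(_ 0 0).
by rewrite !mxE/= => /eqP; rewrite oner_eq0.
Qed.

Lemma dot_schur v w : dot v (schur *m w) =
  dot v (drsubmx A *m w) - dot a v * dot a w / al.
Proof.
rewrite /schur mulmxBl dotDr dotNr -scalemxAl dotZr -mulmxA.
by rewrite [a^T *m w]mx11_scalar mul_mx_scalar dotZr -/(dot a w) (dotC v a); ring.
Qed.

(** The square is completed in the first coordinate, whose optimal value is - dot a w / al. *)
Lemma posdef_quad (x : R) (w : 'cV[R]_m) :
  dot (col_mx x%:M w) (A *m col_mx x%:M w) =
  al * (x + dot a w / al) ^+ 2 + dot w (schur *m w).
Proof.
rewrite posdef_mul_col dot_col_mx dot_scalar_mx dotDr dotZr dot_schur (dotC w a).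
have := posdef_corner_gt0; move: al => al' al_gt0.
by field; rewrite gt_eqF.
Qed.

Lemma schur_pos : posdefmx schur.
Proof.
split.
  rewrite /schur linearB/= linearZ/= trmx_mul trmxK; congr (_ - _).
  by rewrite trmx_drsub; case: A_pos => ->.
(* The first coordinate is the minimizing one, so the square in [posdef_quad] vanishes and only the
   Schur form remains. *)
move=> w w0; have [_ /(_ (col_mx (- (dot a w / al))%:M w))] := A_pos.
rewrite posdef_quad addNr expr0n mulr0 add0r; apply.
by apply: contra w0 => /eqP/(congr1 dsubmx); rewrite col_mxKd linear0 => ->.
Qed.

(** Block elimination: [A] is a unit lower triangular matrix times an upper triangular one with
    diagonal blocks [al] and [schur]. *)
Lemma det_schur : \det A = al * \det schur.
Proof.
have al0 : al != 0 by rewrite gt_eqF// posdef_corner_gt0.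
have -> : A = block_mx 1%:M 0 (al^-1 *: a) 1%:M *m block_mx al%:M a^T 0 schur.
  rewrite mulmx_block !mul0mx !mulmx0 !mul1mx !addr0 -!scalemxAl.
  rewrite [LHS]posdef_blockE; congr block_mx.
    by rewrite mul_mx_scalar scalerA mulVf// scale1r.
  by rewrite /schur addrC subrK.
by rewrite det_mulmx det_lblock det_ublock !det1 mul1r mul1r det_scalar expr1.
Qed.

End schur_complement.

Lemma det_posdef {R : realType} m (A : 'M[R]_m) : posdefmx A -> 0 < \det A.
Proof.
elim: m A => [|m IHm] A A_pos; first by rewrite det_mx00.
rewrite (@det_schur R m A A_pos) mulr_gt0 ?IHm//.
  exact: (posdef_corner_gt0 A_pos).
exact: (schur_pos A_pos).
Qed.

(** * Gaussian integrals in one and several variables *)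

Section gaussian_integral.
Context {R : realType}.
Local Notation leb := (@lebesgue_measure R).

(** Expanding the square would leave the signed cross term 2 p q x. Adding the integral with -p in
    place of p, equal to the first by reflection, cancels that term while all integrands stay
    nonnegative. *)
Lemma integral_gauss_quadratic (p q : R) :
  (\int[leb]_x (gauss_fun x * (p * x + q) ^+ 2)%:E =
   (Num.sqrt pi * (p ^+ 2 / 2 + q ^+ 2))%:E)%E.
Proof.
have mg (k : R) : measurable_fun [set: measurableTypeR R]
    (fun x : measurableTypeR R => (gauss_fun x * (k * x + q) ^+ 2)%:E).
  apply/measurable_EFinP; apply: measurable_funM; first exact: measurable_gauss_fun.
  by apply: measurable_funX; exact: measurable_affine.
have g0 (k x : R) : (0 <= (gauss_fun x * (k * x + q) ^+ 2)%:E)%E.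
  by rewrite lee_fin; apply: mulr_ge0; [exact: gauss_fun_ge0|exact: sqr_ge0].
set I := (\int[leb]_x _)%E.
have IN : I = (\int[leb]_x (gauss_fun x * ((- p) * x + q) ^+ 2)%:E)%E.
  rewrite /I (@ge0_integral_affine R (-1) 0); last 3 first.
  - by rewrite oppr_eq0 oner_eq0.
  - exact: mg.
  - exact: g0.
  rewrite normrN1 mul1e; apply: eq_integral => x _.
  by rewrite /gauss_fun mulN1r addr0 sqrrN mulrN mulNr.
have : (I + I = (2 * (Num.sqrt pi * (p ^+ 2 / 2 + q ^+ 2)))%:E)%E.
  rewrite {2}IN /I -ge0_integralD; last 5 first.
  - exact: measurableT.
  - by move=> x _; exact: g0.
  - exact: mg.
  - by move=> x _; exact: g0.
  - exact: mg.
  under eq_integral => x _.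
    rewrite -EFinD.
    have -> : gauss_fun x * (p * x + q) ^+ 2 + gauss_fun x * (- p * x + q) ^+ 2 =
      (2 * p ^+ 2) * (x ^+ 2 * gauss_fun x) + (2 * q ^+ 2) * gauss_fun x by ring.
    rewrite EFinD (EFinM (2 * p ^+ 2)) (EFinM (2 * q ^+ 2)); over.
  have mx2 : measurable_fun [set: measurableTypeR R]
      (fun x : measurableTypeR R => (x ^+ 2 * gauss_fun x)%:E).
    apply/measurable_EFinP.
    by apply: measurable_funM; [exact: exprn_measurable|exact: measurable_gauss_fun].
  have mg1 : measurable_fun [set: measurableTypeR R]
      (fun x : measurableTypeR R => (gauss_fun x)%:E).
    by apply/measurable_EFinP; exact: measurable_gauss_fun.
  have c0 (k : R) : (0 <= (2 * k ^+ 2)%:E)%E.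
    by rewrite lee_fin; apply: mulr_ge0 => //; exact: sqr_ge0.
  have x20 (x : R) : (0 <= (x ^+ 2 * gauss_fun x)%:E)%E.
    by rewrite lee_fin; apply: mulr_ge0; [exact: sqr_ge0|exact: gauss_fun_ge0].
  have gg0 (x : R) : (0 <= (gauss_fun x)%:E)%E.
    by rewrite lee_fin; exact: gauss_fun_ge0.
  rewrite ge0_integralD; last 5 first.
  - exact: measurableT.
  - by move=> x _; apply: mule_ge0.
  - by apply: measurable_funeM.
  - by move=> x _; apply: mule_ge0.
  - by apply: measurable_funeM.
  rewrite !ge0_integralZl//.
  rewrite integral_sqr_gauss integralT_gauss -!EFinM -EFinD; congr EFin.
  by field.
(* [I + I] is finite, which excludes the infinite values of [I]; then one halves in the reals. *)
case: I {IN} => //= r; rewrite -EFinD => -[rr]; congr EFin; lra.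
Qed.

Lemma integral_gauss1 (al m p q : R) : 0 < al ->
  (\int[leb]_x (expR (- (al * (x + m) ^+ 2) / 2) * (p * (x + m) + q) ^+ 2)%:E =
   (Num.sqrt (pi *+ 2 / al) * (p ^+ 2 / al + q ^+ 2))%:E)%E.
Proof.
(* With this scale al (s x)^2 / 2 = x^2, so the exponential becomes [gauss_fun]. *)
move=> al0; pose s := Num.sqrt (2 / al).
have s0 : 0 < s by rewrite sqrtr_gt0 divr_gt0.
have s2 : s ^+ 2 = 2 / al by rewrite sqr_sqrtr// divr_ge0// ltW.
rewrite (@ge0_integral_affine R s (- m)); last 3 first.
- by rewrite gt_eqF.
- apply/measurable_EFinP; apply: measurable_funM.
    apply: measurableT_comp => //; apply: measurable_funM => //.
    apply: measurable_funN; apply: measurable_funM => //.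
    by apply: measurable_funX; apply: measurable_funD.
  apply: measurable_funX; apply: measurable_funD => //; apply: measurable_funM => //.
  exact: measurable_funD.
- by move=> x; rewrite lee_fin; apply: mulr_ge0; [exact: expR_ge0|exact: sqr_ge0].
under eq_integral => x _.
  rewrite subrK exprMn s2 (_ : - _ / 2 = - x ^+ 2); last first.
    by field; rewrite gt_eqF.
  rewrite mulrA; over.
have := integral_gauss_quadratic (p * s) q; rewrite /gauss_fun => ->.
rewrite gtr0_norm// -EFinM; congr EFin; rewrite exprMn s2 mulrA.
have -> : s * Num.sqrt pi = Num.sqrt (pi *+ 2 / al).
  rewrite /s -sqrtrM ?divr_ge0// ?ltW//; congr Num.sqrt.
  by rewrite -mulr_natr; ring.
by congr (_ * (_ + _)); field; rewrite gt_eqF.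
Qed.

Definition gaussk m (A : 'M[R]_m) (v : 'cV[R]_m) : R := expR (- dot v (A *m v) / 2).

Lemma measurable_gaussk m (A : 'M[R]_m) mu :
  measurable_fun setT
    (fun w : m.-tuple (measurableTypeR R) => gaussk A (vec w - mu)).
Proof.
apply: measurableT_comp => //; apply: measurable_funM => //.
apply: measurable_funN; apply: measurable_dot => i; first exact: measurable_vecB.
by apply: measurable_mulmx => j; exact: measurable_vecB.
Qed.

Lemma measurable_dot_vecB m (c : 'cV[R]_m) mu :
  measurable_fun setT
    (fun w : m.-tuple (measurableTypeR R) => dot c (vec w - mu)).
Proof. by apply: measurable_dot => i //; exact: measurable_vecB. Qed.

Lemma vec_tcons m (z : measurableTypeR R * m.-tuple (measurableTypeR R)) :
  vec (tcons z) = col_mx (z.1 : R)%:M (vec z.2).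
Proof.
apply/colP => i; rewrite mxE; case: (unliftP ord0 i) => [j ->|->].
  rewrite tnth_tcons_lift; apply/esym.
  have -> : lift ord0 j = rshift 1 j by exact: val_inj.
  by apply: etrans (col_mxEd _ _ _ _) _; rewrite mxE.
rewrite tnth_tcons0; apply/esym.
have -> : ord0 = lshift m (ord0 : 'I_1) by exact: val_inj.
by apply: etrans (col_mxEu _ _ _ _) _; rewrite mxE eqxx mulr1n.
Qed.

(* The second moment at [c = A *m b] avoids computing [invmx A] blockwise; [b = 0], [e = 1]
   gives the normalizing constant. *)
Lemma gauss_moment m (A : 'M[R]_m) (mu b : 'cV[R]_m) (e : R) : posdefmx A ->
  (\int[lebesgue_pow m]_w
     (gaussk A (vec w - mu) * (dot (A *m b) (vec w - mu) + e) ^+ 2)%:E =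
   (Num.sqrt ((pi *+ 2) ^+ m / \det A) * (dot b (A *m b) + e ^+ 2))%:E)%E.
Proof.
elim: m A mu b e => [|m IHm] A mu b e A_pos.
  rewrite /lebesgue_pow integral_power0; last first.
    apply/measurable_EFinP; apply: measurable_funM; first exact: measurable_gaussk.
    by apply: measurable_funX; apply: measurable_funD => //; exact: measurable_dot_vecB.
  rewrite /gaussk !dotE !big_ord0 oppr0 mul0r expR0 det_mx00 expr0 divr1.
  by rewrite sqrtr1 !add0r.
have mf (k : R) (A' : 'M[R]_m) mu' c e' : measurable_fun setT
    (fun w : m.-tuple (measurableTypeR R) =>
       (k * (gaussk A' (vec w - mu') * (dot c (vec w - mu') + e') ^+ 2))%:E).
  apply/measurable_EFinP; apply: measurable_funM => //.
  apply: measurable_funM; first exact: measurable_gaussk.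
  by apply: measurable_funX; apply: measurable_funD => //; exact: measurable_dot_vecB.
have mF : measurable_fun setT (fun w : m.+1.-tuple (measurableTypeR R) =>
    (gaussk A (vec w - mu) * (dot (A *m b) (vec w - mu) + e) ^+ 2)%:E).
  apply/measurable_EFinP; apply: measurable_funM; first exact: measurable_gaussk.
  by apply: measurable_funX; apply: measurable_funD => //; exact: measurable_dot_vecB.
have F0 (A' : 'M[R]_m.+1) (v : 'cV[R]_m.+1) c e' :
    (0 <= (gaussk A' v * (dot c v + e') ^+ 2)%:E)%E.
  by rewrite lee_fin; apply: mulr_ge0; [exact: expR_ge0|exact: sqr_ge0].
rewrite /lebesgue_pow integral_powerS//.
rewrite integral_sfprod_swap; last 2 first.
- by apply: (measurableT_comp mF); exact: measurable_tcons.
- by move=> z; exact: F0.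
(* [B] is [A] retyped over 1 + m, the index on which the block lemmas are stated. *)
pose B : 'M[R]_(1 + m) := A; have B_pos : posdefmx B by [].
pose al := B 0 0; pose a := dlsubmx B; pose S := schur B.
have al0 : 0 < al := posdef_corner_gt0 B_pos.
pose mu0 := (usubmx (mu : 'cV_(1 + m))) 0 0; pose mu1 := dsubmx (mu : 'cV_(1 + m)).
pose b0 := (usubmx (b : 'cV_(1 + m))) 0 0; pose b1 := dsubmx (b : 'cV_(1 + m)).
have muE : mu = col_mx mu0%:M mu1.
  by rewrite -[LHS](vsubmxK (mu : 'cV_(1 + m))) -mx11_scalar.
have bE : b = col_mx b0%:M b1.
  by rewrite -[LHS](vsubmxK (b : 'cV_(1 + m))) -mx11_scalar.
(* This is the first entry of [A *m b]. *)
pose c0 := al * b0 + dot a b1.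
(* Measured from its minimizer, the first coordinate enters the affine form with coefficient [c0],
   and the rest of the form is dot (S b1) v + e. The one-dimensional integral produces c0^2 / al
   plus the square of that rest: two integrands of the shape of the induction hypothesis, the first
   one with b = 0 and e = 1. *)
have inner (w : m.-tuple (measurableTypeR R)) :
  (\int[leb]_x (gaussk A (vec (tcons (x, w)) - mu) *
      (dot (A *m b) (vec (tcons (x, w)) - mu) + e) ^+ 2)%:E =
   (Num.sqrt (pi *+ 2 / al) * (c0 ^+ 2 / al) *
      (gaussk S (vec w - mu1) * (dot (S *m 0) (vec w - mu1) + 1) ^+ 2))%:E +
   (Num.sqrt (pi *+ 2 / al) *
      (gaussk S (vec w - mu1) * (dot (S *m b1) (vec w - mu1) + e) ^+ 2))%:E)%E.
  pose v := vec w - mu1.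
  pose kp := dot a v / al.
  transitivity (\int[leb]_x ((gaussk S v)%:E * (expR (- (al * (x + (kp - mu0)) ^+ 2) / 2) *
      (c0 * (x + (kp - mu0)) + (dot (S *m b1) v + e)) ^+ 2)%:E)%E)%E.
    apply: eq_integral => x _; rewrite -EFinM; congr EFin.
    have -> : vec (tcons (x, w)) - mu = col_mx (x - mu0)%:M v.
      rewrite vec_tcons muE.
      transitivity ((col_mx (x : R)%:M (vec w) : 'cV_(1 + m)) - col_mx mu0%:M mu1) => //.
      by rewrite opp_col_mx add_col_mx raddfB.
    rewrite [RHS]mulrA; congr (_ * (_ ^+ 2)).
      rewrite /gaussk -expRD; congr expR; rewrite (posdef_quad B_pos) -/al -/a -/S.
      by rewrite /kp; ring.
    rewrite bE (posdef_mul_col B_pos) -/al -/a -/c0 (@dot_col_mx _ 1 m) dot_scalar_mx.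
    rewrite addrA; congr (_ + e).
    have -> : dot (S *m b1) v = dot v (S *m b1) by rewrite dotC.
    rewrite (dot_schur B) -/a -/al dotDl dotZl (dotC (drsubmx B *m b1)) /kp /c0.
    by field; rewrite gt_eqF.
  rewrite ge0_integralZl; last 4 first.
  - exact: measurableT.
  - apply/measurable_EFinP; apply: measurable_funM.
      apply: measurableT_comp => //; apply: measurable_funM => //.
      apply: measurable_funN; apply: measurable_funM => //.
      by apply: measurable_funX; apply: measurable_funD.
    apply: measurable_funX; apply: measurable_funD => //; apply: measurable_funM => //.
    exact: measurable_funD.
  - by move=> x _; rewrite lee_fin; apply: mulr_ge0; [exact: expR_ge0|exact: sqr_ge0].
  - by rewrite lee_fin; exact: expR_ge0.
  rewrite integral_gauss1// -EFinM -EFinD; congr EFin.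
  rewrite -/v mulmx0 dot0l add0r expr1n mulr1; ring.
under eq_integral => w _ do rewrite inner.
have G0 (k : R) v c e' : 0 <= k ->
    (0 <= (k * (gaussk S v * (dot c v + e') ^+ 2))%:E)%E.
  move=> k0; rewrite lee_fin; apply: mulr_ge0 => //.
  by apply: mulr_ge0; [exact: expR_ge0|exact: sqr_ge0].
have k0 : 0 <= Num.sqrt (pi *+ 2 / al) by exact: sqrtr_ge0.
have k1 : 0 <= Num.sqrt (pi *+ 2 / al) * (c0 ^+ 2 / al).
  by apply: mulr_ge0 => //; rewrite divr_ge0 ?sqr_ge0// ltW.
rewrite ge0_integralD; last 5 first.
- exact: measurableT.
- by move=> x _; exact: G0.
- exact: mf.
- by move=> x _; exact: G0.
- exact: mf.
have mf' (A' : 'M[R]_m) mu' c e' : measurable_fun setT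
    (fun w : m.-tuple (measurableTypeR R) =>
       (gaussk A' (vec w - mu') * (dot c (vec w - mu') + e') ^+ 2)%:E).
  by under eq_fun do rewrite -[X in X%:E]mul1r; exact: mf.
have G0' v c e' : (0 <= (gaussk S v * (dot c v + e') ^+ 2)%:E)%E.
  by rewrite -[X in X%:E]mul1r; exact: G0.
under eq_integral do rewrite EFinM.
rewrite ge0_integralZl; last 4 first.
- exact: measurableT.
- exact: mf'.
- by move=> *; exact: G0'.
- by rewrite lee_fin.
under [X in (_ + X)%E]eq_integral do rewrite EFinM.
rewrite [X in (_ + X)%E]ge0_integralZl; last 4 first.
- exact: measurableT.
- exact: mf'.
- by move=> *; exact: G0'.
- by rewrite lee_fin.
have S_pos : posdefmx S := schur_pos B_pos.
rewrite !IHm// -!EFinM -EFinD; congr EFin.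
have dS := det_posdef S_pos.
have -> : Num.sqrt ((pi *+ 2) ^+ m.+1 / \det A) =
    Num.sqrt (pi *+ 2 / al) * Num.sqrt ((pi *+ 2) ^+ m / \det S).
  rewrite -sqrtrM; last first.
    by apply: divr_ge0; [rewrite mulrn_wge0 ?pi_ge0|exact: ltW].
  congr Num.sqrt; rewrite (det_schur B_pos) -/al -/S exprS.
  by field; rewrite !gt_eqF.
(* The contribution c0^2 / al is the square term of [posdef_quad] at [b]. *)
rewrite bE (posdef_quad B_pos) -/al -/a -/S mulmx0 dot0r add0r expr1n /c0.
by field; rewrite gt_eqF.
Qed.

End gaussian_integral.

(** * The Gamma function and the Dirichlet integral *)

Section Gamma_finite.
Context {R : realType}.
Local Notation leb := (@lebesgue_measure R).
Variable a : R.
Hypothesis a0 : 0 < a.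

(** The integrand is unbounded near 0 when a < 1, so the fundamental theorem is applied on
    [1/(n+1), 1]; these intervals exhaust ]0, 1] and the bound survives the monotone limit. *)
Lemma integral_powR_unit :
  (\int[leb]_(x in `]0%R, 1%R]) (x `^ (a - 1))%:E <= (a^-1)%:E)%E.
Proof.
pose F n : set (measurableTypeR R) := `[n.+1%:R^-1, 1]%classic.
have mpow D : measurable_fun D (fun x : R => (x `^ (a - 1))%:E).
  by apply: measurable_funTS; apply/measurable_EFinP; exact: measurable_powR.
have FE : `]0%R, 1%R]%classic = \bigcup_n F n.
  apply/seteqP; split => x /=; rewrite in_itv/=.
    move=> /andP[x0 x1].
    exists (Num.truncn x^-1) => //; rewrite /F /= in_itv/= x1 andbT.
    rewrite -[leRHS]invrK lef_pV2 ?posrE ?invr_gt0//.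
    by apply: ltW; rewrite truncnS_gt// num_real.
  by move=> [n _]; rewrite /F/= in_itv/= => /andP[nx ->]; rewrite (lt_le_trans _ nx)// invr_gt0.
have FS : {homo F : n m / (n <= m)%N >-> (n <= m)%O}.
  move=> n m nm; rewrite subsetEset /F => x/=; rewrite !in_itv/= => /andP[nx ->].
  by rewrite andbT (le_trans _ nx)// lef_pV2 ?posrE// ler_nat ltnS.
have cvgF : (\int[leb]_(x in F n) (x `^ (a - 1))%:E)%E @[n --> \oo] -->
    (\int[leb]_(x in \bigcup_n F n) (x `^ (a - 1))%:E)%E.
  apply: (@ge0_nondecreasing_set_cvg_integral _ (measurableTypeR R)).
  - exact: FS.
  - by move=> i; exact: measurable_itv.
  - by move=> i; exact: (mpow (F i)).
  - by move=> i x _; rewrite lee_fin; exact: powR_ge0.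
rewrite FE -(cvg_lim _ cvgF)//; apply: lime_le; first by apply/cvg_ex; eexists; exact: cvgF.
(* For n = 0 the interval would be a single point. *)
near=> n; have n1 : (0 < n)%N by near: n; exact: nbhs_infty_gt.
have ab : n.+1%:R^-1 < 1 :> R by rewrite invf_lt1// ltr1n.
have ipos : 0 < n.+1%:R^-1 :> R by rewrite invr_gt0.
have dF (x : R) : 0 < x -> is_derive x 1 (fun x => a^-1 * x `^ a) (x `^ (a - 1)).
  move=> x0; have d := is_derive1_powR a x0.
  apply: is_derive_eq; rewrite /GRing.scale/= mulrA mulVf ?mul1r//; last by rewrite gt_eqF.
have cF (x : R) : 0 < x -> {for x, continuous (fun x => a^-1 * x `^ a)}.
  move=> x0; apply: differentiable_continuous; apply/derivable1_diffP.
  by case: (dF x x0).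
rewrite (@continuous_FTC2 _ _ (fun x => a^-1 * x `^ a))//.
- rewrite powR1 mulr1 -EFinB lee_fin lerBlDr lerDl mulr_ge0// ?powR_ge0//.
  by rewrite invr_ge0 ltW.
- apply: continuous_in_subspaceT => x /set_mem; rewrite /= in_itv/= => /andP[x1 _].
  have x0 : 0 < x by exact: lt_le_trans x1.
  apply: differentiable_continuous; apply/derivable1_diffP.
  by case: (is_derive1_powR (a - 1) x0).
- split.
  + move=> x; rewrite in_itv/= => /andP[x1 _].
    have x0 : 0 < x by exact: lt_trans x1.
    by case: (dF x x0).
  + by apply: cvg_at_right_filter; exact: cF.
  + by apply: cvg_at_left_filter; exact: cF.
- move=> x; rewrite in_itv/= => /andP[x1 _].
  have x0 : 0 < x by exact: lt_trans x1.
  by rewrite derive1E; case: (dF x x0).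
Unshelve. all: end_near. Qed.

Lemma powR_expR_bound : exists2 C : R, 0 <= C &
  forall x, 1 <= x -> x `^ (a - 1) * expR (- x) <= C * expR (- x / 2).
Proof.
pose N := (Num.truncn a).+1.
have aN : a <= N%:R by apply: ltW; rewrite truncnS_gt// num_real.
have N0 : 0 < N%:R :> R by rewrite ltr0n.
(* The constant comes from exp(x/2) = exp(x/(2N))^N >= (x/(2N))^N, together with x^(a-1) <= x^N for
   x >= 1. *)
exists ((2 * N%:R) ^+ N); first by rewrite exprn_ge0// mulr_ge0// ltW.
move=> x x1; have x0 : 0 <= x by exact: le_trans x1.
have -> : expR (- x / 2) = expR (x / 2) * expR (- x).
  by rewrite -expRD; congr expR; lra.
rewrite mulrA ler_pM2r ?expR_gt0//.
apply: (@le_trans _ _ (x ^+ N)).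
  by rewrite -powR_mulrn//; apply: ler_powR => //; lra.
have -> : x / 2 = N%:R * (x / (2 * N%:R)) by field; rewrite gt_eqF.
rewrite expRM_natl -exprMn lerXn2r ?nnegrE//.
have N20 : 0 < 2 * N%:R :> R by rewrite mulr_gt0.
rewrite [leRHS]mulrC -ler_pdivrMr//; apply: le_trans (expR_ge1Dx _).
by rewrite lerDr.
Qed.

Lemma Gamma_lty :
  (\int[leb]_(x in `]0%R, +oo[) (x `^ (a - 1) * expR (- x))%:E < +oo)%E.
Proof.
have [C C0 Cb] := powR_expR_bound.
(* The integrand is dominated by x^(a-1) on ]0, 1] and, beyond 1, by C exp(-x/2), which is 2 C times
   the exponential density of rate 1/2. *)
pose h1 (x : R) : R := ((0 < x <= 1)%R)%:R * x `^ (a - 1).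
pose h2 (x : R) : R := 2 * C * exponential_pdf 2^-1 x.
have mh1 : measurable_fun [set: measurableTypeR R] (h1 : measurableTypeR R -> R).
  apply: measurable_funM; last exact: measurable_powR.
  apply: measurable_fun_bool_natr; apply: measurable_and.
    exact: (@measurable_fun_ltr _ _ R _ (cst 0%R) id).
  exact: (@measurable_fun_ler _ _ R _ id (cst 1)).
have mh2 : measurable_fun [set: measurableTypeR R] (h2 : measurableTypeR R -> R).
  by apply: measurable_funM => //; exact: measurable_exponential_pdf.
have h10 x : 0 <= h1 x by rewrite /h1; apply: mulr_ge0 => //; exact: powR_ge0.
have h20 x : 0 <= h2 x.
  rewrite /h2; apply: mulr_ge0; first exact: mulr_ge0.
  by apply: exponential_pdf_ge0.
apply: (@le_lt_trans _ _ (\int[leb]_x ((h1 x)%:E + (h2 x)%:E))%E).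
  rewrite integral_mkcond; apply: ge0_le_integral => //.
  - move=> x _; rewrite /patch; case: ifP => // _.
    by rewrite lee_fin; apply: mulr_ge0; [exact: powR_ge0|exact: expR_ge0].
  - apply/(measurable_restrictT _ _).1 => //.
    apply/measurable_EFinP; apply: measurable_funM.
      by apply: measurable_funTS; exact: measurable_powR.
    apply: measurableT_comp => //.
  - by apply: emeasurable_funD; exact/measurable_EFinP.
  - move=> x _; rewrite /patch mem_setE in_itv/= andbT; case: ifPn => x0; last first.
      by rewrite -EFinD lee_fin; exact: addr_ge0.
    rewrite -EFinD lee_fin; have [x1|x1] := leP x 1.
      apply: (@le_trans _ _ (h1 x)); last by rewrite lerDl.
      rewrite /h1 x0 x1 mul1r ler_piMr ?powR_ge0// -expR0 ler_expR oppr_le0.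
      exact: ltW.
    apply: (@le_trans _ _ (h2 x)); last by rewrite lerDr.
    rewrite /h2 exponential_pdfE ?(ltW x0)//.
    apply: le_trans (Cb x (ltW x1)) _.
    rewrite (_ : - 2^-1 * x = - x / 2); last by lra.
    by rewrite (_ : 2 * C * (2^-1 * _) = C * expR (- x / 2)) //; field.
rewrite ge0_integralD; last 5 first.
- exact: measurableT.
- by move=> x _; rewrite lee_fin; exact: h10.
- exact/measurable_EFinP.
- by move=> x _; rewrite lee_fin; exact: h20.
- exact/measurable_EFinP.
apply: lte_add_pinfty.
  apply: (@le_lt_trans _ _ (a^-1)%:E); last exact: ltry.
  apply: le_trans integral_powR_unit; rewrite [leRHS]integral_mkcond.
  rewrite le_eqVlt; apply/orP; left; apply/eqP; apply: eq_integral => x _.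
  by rewrite /patch mem_setE in_itv/= /h1; case: ifP => _; rewrite ?mul1r ?mul0r.
rewrite /h2; under eq_integral do rewrite EFinM.
rewrite ge0_integralZl//.
- by rewrite integral_exponential_pdf// mule1 ltry.
- by apply/measurable_EFinP; exact: measurable_exponential_pdf.
- by move=> x _; rewrite lee_fin; apply: exponential_pdf_ge0.
- by rewrite lee_fin; exact: mulr_ge0.
Qed.

End Gamma_finite.

(** * Convolutions of powers, the Beta integral and the Dirichlet integral *)

Section Gamma_Dirichlet.
Context {R : realType}.
Local Notation leb := (@lebesgue_measure R).
Implicit Types (a b c : R).

(** The indicator removes the default values of the real power at x <= 0 and lets convolutions be
    integrals over the whole line. *)
Definition powpos a (x : R) : R := (0 < x)%R%:R * x `^ (a - 1).

Lemma powpos_ge0 a x : 0 <= powpos a x.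
Proof. by apply: mulr_ge0 => //; exact: powR_ge0. Qed.

Lemma powpos0 a x : x <= 0 -> powpos a x = 0.
Proof. by move=> x0; rewrite /powpos ltNge x0 mul0r. Qed.

Lemma powpos_gt0 a x : 0 < x -> powpos a x = x `^ (a - 1).
Proof. by move=> x0; rewrite /powpos x0 mul1r. Qed.

Lemma measurable_powpos a d (T : measurableType d) (f : T -> R) :
  measurable_fun setT f -> measurable_fun setT (fun x => powpos a (f x)).
Proof.
move=> mf; apply: measurable_funM.
  by apply: measurable_fun_bool_natr; exact: (@measurable_fun_ltr _ _ R _ (cst 0) f).
by apply: (measurableT_comp (measurable_powR _)).
Qed.

Lemma powposM a x y : 0 < x -> powpos a (x * y) = x `^ (a - 1) * powpos a y.
Proof.
move=> x0; rewrite /powpos pmulr_rgt0//; have [y0|y0] := ltP 0 y.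
  by rewrite !mul1r powRM// ltW.
by rewrite !mul0r mulr0.
Qed.

Lemma integral_Gamma a : 0 < a ->
  (\int[leb]_x (powpos a x * expR (- x))%:E = (Gamma a)%:E)%E.
Proof.
move=> a0; rewrite /Gamma /Rintegral fineK.
  rewrite [RHS]integral_mkcond; apply: eq_integral => x _.
  by rewrite /patch mem_setE in_itv/= andbT /powpos; case: ifP => _; rewrite ?mul1r ?mul0r.
rewrite ge0_fin_numE; first exact: Gamma_lty.
apply: integral_ge0 => x _; rewrite lee_fin.
by apply: mulr_ge0; [exact: powR_ge0|exact: expR_ge0].
Qed.

Lemma Gamma_gt0 a : 0 < a -> 0 < Gamma a.
Proof.
move=> a0; rewrite -lte_fin -integral_Gamma//.
(* On [1, 2] one has x^(a-1) >= 1/x >= 1/2, because a > 0, and exp(-x) >= exp(-2). *)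
apply: (@lt_le_trans _ _ (\int[leb]_(x in `[1%R, 2%R]) (2^-1 * expR (- 2))%:E)%E).
  rewrite integral_cst; last exact: measurable_itv.
  have l12 : leb `[1%R, 2%R]%classic = 1%E.
    rewrite lebesgue_measure_itv/= lte_fin ltrDl ltr01 -EFinB; congr EFin; lra.
  by rewrite [X in (_ * X)%E]l12 mule1 lte_fin mulr_gt0 ?expR_gt0.
rewrite integral_mkcond; apply: ge0_le_integral.
- exact: measurableT.
- move=> x _; rewrite /patch; case: ifP => // _; rewrite lee_fin.
- by apply/(measurable_restrictT _ _).1 => //; exact: measurable_cst.
- apply/measurable_EFinP; apply: measurable_funM; first exact: measurable_powpos.
  by apply: measurableT_comp.
- move=> x _; rewrite /patch mem_setE in_itv/=; case: ifPn => [/andP[x1 x2]|_]; last first.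
    by rewrite lee_fin; apply: mulr_ge0; [exact: powpos_ge0|exact: expR_ge0].
  have x0 : 0 < x by exact: lt_le_trans x1.
  rewrite lee_fin powpos_gt0//; apply: ler_pM => //.
  - apply: (@le_trans _ _ (x `^ (-1))).
      by rewrite powR_inv1 ?(ltW x0)// lef_pV2 ?posrE.
    by apply: ler_powR => //; lra.
  - by rewrite ler_expR lerN2.
Qed.

Definition beta_integral a b : \bar R :=
  (\int[leb]_x (powpos a x * powpos b (1 - x))%:E)%E.

Lemma measurable_powpos_conv a b z : measurable_fun [set: measurableTypeR R]
  (fun x : measurableTypeR R => (powpos a x * powpos b (z - x))%:E).
Proof.
apply/measurable_EFinP; apply: measurable_funM; first exact: measurable_powpos.
by apply: measurable_powpos; apply: measurable_funB.
Qed.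

(* Scaling by [z] shows that the convolution is a multiple of [powpos (a + b)]. *)
Lemma integral_powpos_conv a b z :
  (\int[leb]_x (powpos a x * powpos b (z - x))%:E =
   (powpos (a + b) z)%:E * beta_integral a b)%E.
Proof.
have [z0|z0] := leP z 0.
  rewrite powpos0// mul0e; under eq_integral => x _.
    have -> : powpos a x * powpos b (z - x) = 0.
      have [x0|x0] := leP x 0; first by rewrite powpos0 ?mul0r.
      by rewrite [X in _ * X]powpos0 ?mulr0//; lra.
    over.
  by rewrite integral0.
rewrite (@ge0_integral_affine R z 0); last 3 first.
- by rewrite gt_eqF.
- exact: measurable_powpos_conv.
- by move=> x; rewrite lee_fin; apply: mulr_ge0; exact: powpos_ge0.
rewrite gtr0_norm//.
under eq_integral => x _.
  have -> : powpos a (z * x + 0) * powpos b (z - (z * x + 0)) =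
      (z `^ (a - 1) * z `^ (b - 1)) * (powpos a x * powpos b (1 - x)).
    have -> : z - (z * x + 0) = z * (1 - x) by ring.
    by rewrite addr0 !powposM//; ring.
  rewrite EFinM; over.
rewrite ge0_integralZl; last 4 first.
- exact: measurableT.
- exact: measurable_powpos_conv.
- by move=> x _; rewrite lee_fin; apply: mulr_ge0; exact: powpos_ge0.
- by rewrite lee_fin; apply: mulr_ge0; exact: powR_ge0.
rewrite muleA -EFinM; congr (_ * _)%E; congr EFin.
rewrite powpos_gt0// -{1}(powRr1 (ltW z0)) -!powRD; last 2 first.
- by apply/implyP => _; rewrite gt_eqF.
- by apply/implyP => _; rewrite gt_eqF.
by congr (_ `^ _); lra.
Qed.

(** The function powpos a x * powpos b (z - x) * exp(-z) is integrated over the plane in both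
    orders: over x first, the convolution formula yields Gamma(a + b) times the Beta integral; over
    z first, a translation by x separates the variables. *)
Lemma beta_integralE a b : 0 < a -> 0 < b ->
  beta_integral a b = (Gamma a * Gamma b / Gamma (a + b))%:E.
Proof.
move=> a0 b0; have ab0 : 0 < a + b by exact: addr_gt0.
(* The Beta integral is not yet known to be finite, so the division waits; the product form rules
   out both infinities. *)
suff : ((Gamma (a + b))%:E * beta_integral a b = (Gamma a * Gamma b)%:E)%E.
  have := Gamma_gt0 ab0; case: (beta_integral a b) => [r| |] G0.
  - rewrite -EFinM => -[<-]; congr EFin; rewrite mulrC mulKf// gt_eqF//.
  - by rewrite gt0_muley// lte_fin.
  - by rewrite gt0_muleNy// lte_fin.
pose f (z : measurableTypeR R * measurableTypeR R) : \bar R :=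
  (powpos a z.1 * powpos b (z.2 - z.1) * expR (- (z.2 : R)))%:E.
have mf : measurable_fun setT f.
  apply/measurable_EFinP; apply: measurable_funM; last first.
    by apply: measurableT_comp => //; apply: measurable_funN; exact: measurable_snd.
  apply: measurable_funM; first by apply: measurable_powpos; exact: measurable_fst.
  apply: measurable_powpos.
  by apply: (@measurable_funB _ _ R _ snd fst); [exact: measurable_snd|exact: measurable_fst].
have f0 z : (0 <= f z)%E.
  rewrite lee_fin; apply: mulr_ge0; last exact: expR_ge0.
  by apply: mulr_ge0; exact: powpos_ge0.
have mg c : measurable_fun [set: measurableTypeR R]
    (fun x : measurableTypeR R => (powpos c x * expR (- (x : R)))%:E).
  apply/measurable_EFinP; apply: measurable_funM; first exact: measurable_powpos.
  by apply: measurableT_comp.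
have g0 c (x : R) : (0 <= (powpos c x * expR (- x))%:E)%E.
  by rewrite lee_fin; apply: mulr_ge0; [exact: powpos_ge0|exact: expR_ge0].
have B0 : (0 <= beta_integral a b)%E.
  by apply: integral_ge0 => x _; rewrite lee_fin; apply: mulr_ge0; exact: powpos_ge0.
have fub := @fubini_tonelli _ _ _ _ R leb leb f mf f0.
transitivity (\int[leb]_z \int[leb]_x f (x, z))%E.
  rewrite -(integral_Gamma ab0) -ge0_integralZr; last 4 first.
  - exact: measurableT.
  - exact: mg.
  - by move=> x _; exact: g0.
  - exact: B0.
  apply: eq_integral => z _; rewrite EFinM muleAC -integral_powpos_conv.
  rewrite -ge0_integralZr; last 4 first.
  - exact: measurableT.
  - exact: measurable_powpos_conv.
  - by move=> x _; rewrite lee_fin; apply: mulr_ge0; exact: powpos_ge0.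
  - by rewrite lee_fin; exact: expR_ge0.
  by apply: eq_integral => x _; rewrite -EFinM.
rewrite -[LHS]fub EFinM -(integral_Gamma a0) -(integral_Gamma b0).
rewrite -ge0_integralZr; last 4 first.
- exact: measurableT.
- exact: mg.
- by move=> x _; exact: g0.
- by apply: integral_ge0 => x _; exact: g0.
apply: eq_integral => x _.
rewrite (@ge0_integral_affine R 1 (- x)); last 3 first.
- by rewrite oner_eq0.
- exact: mg.
- by move=> y; exact: g0.
rewrite normr1 mul1e -ge0_integralZl; last 4 first.
- exact: measurableT.
- apply/measurable_EFinP; apply: measurable_funM.
    by apply: measurable_powpos; exact: measurable_affine.
  apply: (measurableT_comp (@measurable_expR R)); apply: measurable_funN.
  exact: (measurable_affine 1 (- x)).
- by move=> y _; exact: g0.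
- exact: g0.
apply: eq_integral => y _; rewrite /f/= -EFinM mul1r; congr EFin.
rewrite [RHS]mulrACA -expRD; congr (_ * expR _); by rewrite opprB addKr.
Qed.

(** Kernel of the Riemann-Liouville fractional integral of order [a]. The division by Gamma makes
    these kernels a convolution semigroup in [a]. *)
Definition gamma_kernel a (x : R) : R := powpos a x / Gamma a.

Lemma gamma_kernel_ge0 a x : 0 < a -> 0 <= gamma_kernel a x.
Proof.
by move=> a0; rewrite /gamma_kernel divr_ge0 ?powpos_ge0// ltW// Gamma_gt0.
Qed.

Lemma measurable_gamma_kernel a d (T : measurableType d) (f : T -> R) :
  measurable_fun setT f -> measurable_fun setT (fun x => gamma_kernel a (f x)).
Proof. by move=> mf; apply: measurable_funM => //; exact: measurable_powpos. Qed.

Lemma integral_gamma_kernel_conv a b z : 0 < a -> 0 < b ->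
  (\int[leb]_x (gamma_kernel a x * gamma_kernel b (z - x))%:E =
   (gamma_kernel (a + b) z)%:E)%E.
Proof.
move=> a0 b0; under eq_integral => x _.
  rewrite /gamma_kernel mulrACA EFinM; over.
have G0 c : 0 < c -> Gamma c != 0 by move=> c0; rewrite gt_eqF// Gamma_gt0.
rewrite ge0_integralZr; last 4 first.
- exact: measurableT.
- exact: measurable_powpos_conv.
- by move=> x _; rewrite lee_fin; apply: mulr_ge0; exact: powpos_ge0.
- by rewrite lee_fin mulr_ge0// invr_ge0 ltW// Gamma_gt0.
rewrite integral_powpos_conv beta_integralE// -!EFinM; congr EFin.
rewrite /gamma_kernel; move: (G0 _ a0) (G0 _ b0) (G0 _ (addr_gt0 a0 b0)).
move: (Gamma a) (Gamma b) (Gamma (a + b)) (powpos _ _) => ga gb gab p nga ngb ngab.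
by field; rewrite ?nga ?ngb ?ngab.
Qed.

(** The total [c] is kept general for the induction: splitting off the first coordinate [x] leaves
    the total [c - x]. The parameter [b] belongs to the dependent last coordinate. *)
Lemma integral_Dirichlet m (al : 'I_m -> R) b c : (forall i, 0 < al i) -> 0 < b ->
  (\int[lebesgue_pow m]_w
     (\prod_(i < m) gamma_kernel (al i) (tnth w i) *
      gamma_kernel b (c - \sum_(i < m) (tnth w i : R)))%:E =
   (gamma_kernel (\sum_(i < m) al i + b) c)%:E)%E.
Proof.
have mF k (al' : 'I_k -> R) c' : measurable_fun setT
    (fun w : k.-tuple (measurableTypeR R) =>
      (\prod_(i < k) gamma_kernel (al' i) (tnth w i) *
      gamma_kernel b (c' - \sum_(i < k) (tnth w i : R)))%:E).
  apply/measurable_EFinP; apply: measurable_funM.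
    by apply: measurable_prod => i _; apply: measurable_gamma_kernel; exact: measurable_tnth.
  apply: measurable_gamma_kernel; apply: measurable_funB => //.
  by apply: measurable_sum => i; exact: measurable_tnth.
move=> al0 b0; have F0 k (al' : 'I_k -> R) (w : 'I_k -> R) x : (forall i, 0 < al' i) ->
    (0 <= (\prod_(i < k) gamma_kernel (al' i) (w i) * gamma_kernel b x)%:E)%E.
  move=> al'0; rewrite lee_fin; apply: mulr_ge0; last exact: gamma_kernel_ge0.
  by apply: prodr_ge0 => i _; exact: gamma_kernel_ge0.
elim: m al c al0 => [|m IHm] al c al0.
  rewrite /lebesgue_pow integral_power0; last exact: mF.
  by rewrite !big_ord0 mul1r subr0 add0r.
rewrite /lebesgue_pow integral_powerS; last 2 first.
- exact: mF.
- by move=> w; exact: F0.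
rewrite integral_sfprod; last 2 first.
- by apply: (measurableT_comp (mF _ _ _)); exact: measurable_tcons.
- by move=> w; exact: F0.
have sal : 0 < \sum_(i < m) al (lift ord0 i) + b.
  by apply: ltr_wpDl => //; apply: sumr_ge0 => i _; exact: ltW.
rewrite [in RHS]big_ord_recl -[in RHS]addrA -integral_gamma_kernel_conv//.
apply: eq_integral => x _.
rewrite EFinM -(IHm (fun i => al (lift ord0 i)) (c - x) (fun i => al0 (lift ord0 i))).
rewrite -ge0_integralZl; last 4 first.
- exact: measurableT.
- exact: mF.
- by move=> w _; exact: F0.
- by rewrite lee_fin; exact: gamma_kernel_ge0.
apply: eq_integral => w _; rewrite -EFinM; congr EFin.
rewrite !big_ord_recl tnth_tcons0 -mulrA; congr (_ * (_ * gamma_kernel b _)).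
  by apply: eq_bigr => i _; rewrite tnth_tcons_lift.
by rewrite opprD addrA; congr (_ - _); apply: eq_bigr => i _; rewrite tnth_tcons_lift.
Qed.

End Gamma_Dirichlet.

(** * Normalization of the densities *)

Section normalized_densities.
Context {R : realType}.
Local Notation leb := (@lebesgue_measure R).

Lemma mvnormal_pdfE m (mu v : 'cV[R]_m) (A : 'M[R]_m) :
  mvnormal_pdf mu (invmx A) v =
  (Num.sqrt ((pi *+ 2) ^+ m / \det A))^-1 * gaussk A (v - mu).
Proof. by rewrite /mvnormal_pdf det_inv invmxK /gaussk mulNr. Qed.

Lemma mvnormal_norm_gt0 m (A : 'M[R]_m) : posdefmx A ->
  0 < Num.sqrt ((pi *+ 2) ^+ m / \det A).
Proof.
move=> A_pos; rewrite sqrtr_gt0 divr_gt0 ?det_posdef// exprn_gt0//.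
by rewrite mulrn_wgt0 ?pi_gt0.
Qed.

Lemma mvnormal_pdf_gt0 m (mu v : 'cV[R]_m) (A : 'M[R]_m) : posdefmx A ->
  0 < mvnormal_pdf mu (invmx A) v.
Proof.
move=> A_pos; rewrite mvnormal_pdfE mulr_gt0 ?expR_gt0// invr_gt0.
exact: mvnormal_norm_gt0.
Qed.

Lemma measurable_mvnormal_pdf m (mu : 'cV[R]_m) (A : 'M[R]_m) :
  measurable_fun setT (fun w : m.-tuple (measurableTypeR R) =>
    mvnormal_pdf mu (invmx A) (vec w)).
Proof.
under eq_fun do rewrite mvnormal_pdfE.
by apply: measurable_funM => //; exact: measurable_gaussk.
Qed.

Lemma integral_mvnormal_sqr m (mu t : 'cV[R]_m) (A : 'M[R]_m) (e : R) : posdefmx A ->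
  (\int[lebesgue_pow m]_w
     (mvnormal_pdf mu (invmx A) (vec w) * (dot t (vec w) + e) ^+ 2)%:E =
   (dot t (invmx A *m t) + (dot t mu + e) ^+ 2)%:E)%E.
Proof.
move=> A_pos; have Au : A \in unitmx by rewrite unitmxE unitfE gt_eqF// det_posdef.
have N0 := mvnormal_norm_gt0 A_pos.
under eq_integral => w _.
  (* [gauss_moment] takes its linear form as [A *m b]; here b is the inverse of [A] applied to [t],
     and the mean moves into the constant. *)
  have -> : mvnormal_pdf mu (invmx A) (vec w) * (dot t (vec w) + e) ^+ 2 =
    (Num.sqrt ((pi *+ 2) ^+ m / \det A))^-1 *
    (gaussk A (vec w - mu) *
     (dot (A *m (invmx A *m t)) (vec w - mu) + (dot t mu + e)) ^+ 2).
    rewrite mvnormal_pdfE mulmxA mulmxV// mul1mx dotDr dotNr -mulrA.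
    by congr (_ * (_ * (_ ^+ 2))); ring.
  rewrite EFinM; over.
rewrite ge0_integralZl; last 4 first.
- exact: measurableT.
- apply/measurable_EFinP; apply: measurable_funM; first exact: measurable_gaussk.
  by apply: measurable_funX; apply: measurable_funD => //; exact: measurable_dot_vecB.
- by move=> w _; rewrite lee_fin; apply: mulr_ge0; [exact: expR_ge0|exact: sqr_ge0].
- by rewrite lee_fin invr_ge0 ltW.
rewrite gauss_moment// -EFinM mulKf ?gt_eqF//; congr EFin; congr (_ + _).
by rewrite mulmxA mulmxV// mul1mx dotC.
Qed.

Lemma integral_mvnormal m (mu : 'cV[R]_m) (A : 'M[R]_m) : posdefmx A ->
  (\int[lebesgue_pow m]_w (mvnormal_pdf mu (invmx A) (vec w))%:E = 1)%E.
Proof.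
move=> A_pos; have := integral_mvnormal_sqr mu 0 1 A_pos.
rewrite !dot0l add0r add0r expr1n => <-; apply: eq_integral => w _.
by rewrite dot0l add0r expr1n mulr1.
Qed.

Lemma gamma_pdf_gt0 (a b x : R) : 0 < a -> 0 < b -> 0 < x -> 0 < gamma_pdf a b x.
Proof.
move=> a0 b0 x0; rewrite /gamma_pdf !mulr_gt0 ?powR_gt0 ?expR_gt0//.
by rewrite invr_gt0 Gamma_gt0.
Qed.

Lemma gamma_pdf_powpos (a b x : R) :
  (0 < x)%R%:R * gamma_pdf a b x = b `^ a / Gamma a * powpos a x * expR (- b * x).
Proof. by rewrite /gamma_pdf /powpos; ring. Qed.

Lemma measurable_gamma_pdf (a b : R) d (T : measurableType d) (f : T -> R) :
  measurable_fun setT f ->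
  measurable_fun setT (fun x => (0 < f x)%R%:R * gamma_pdf a b (f x)).
Proof.
move=> mf; under eq_fun do rewrite gamma_pdf_powpos.
apply: measurable_funM.
  by apply: measurable_funM => //; exact: measurable_powpos.
apply: (measurableT_comp (@measurable_expR R)).
exact: measurable_funM.
Qed.

Lemma integral_gamma_pdf (a b : R) : 0 < a -> 0 < b ->
  (\int[leb]_x ((0 < x)%R%:R * gamma_pdf a b x)%:E = 1)%E.
Proof.
move=> a0 b0.
have G0 := Gamma_gt0 a0.
rewrite (@ge0_integral_affine R b^-1 0); last 3 first.
- by rewrite gt_eqF// invr_gt0.
- by apply/measurable_EFinP; exact: measurable_gamma_pdf.
- move=> x; rewrite gamma_pdf_powpos lee_fin; apply: mulr_ge0; last exact: expR_ge0.
  apply: mulr_ge0; last exact: powpos_ge0.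
  by rewrite divr_ge0 ?powR_ge0// ltW.
rewrite gtr0_norm ?invr_gt0//.
under eq_integral => x _.
  rewrite gamma_pdf_powpos addr0 powposM ?invr_gt0//.
  rewrite (_ : - b * (b^-1 * x) = - x); last by field; rewrite gt_eqF.
  rewrite (_ : _ * _ = b `^ a / Gamma a * b^-1 `^ (a - 1) * (powpos a x * expR (- x))); last by ring.
  rewrite EFinM; over.
rewrite ge0_integralZl; last 4 first.
- exact: measurableT.
- apply/measurable_EFinP; apply: measurable_funM; first exact: measurable_powpos.
  by apply: (measurableT_comp (@measurable_expR R)); exact: measurable_funN.
- by move=> x _; rewrite lee_fin; apply: mulr_ge0; [exact: powpos_ge0|exact: expR_ge0].
- by rewrite lee_fin; apply: mulr_ge0; [rewrite divr_ge0 ?powR_ge0// ltW|exact: powR_ge0].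
rewrite (integral_Gamma a0) -!EFinM; congr EFin.
have -> : b^-1 `^ (a - 1) = b / b `^ a.
  rewrite -powR_inv1 ?ltW// -powRrM mulN1r opprB powRD; last first.
    by apply/implyP => _; rewrite gt_eqF.
  by rewrite powRr1 ?ltW// powRN.
have ba : 0 < b `^ a by rewrite powR_gt0.
by move: (b `^ a) ba (Gamma a) G0 => ba ba0 ga ga0; field; rewrite !gt_eqF.
Qed.

Lemma posdefZ m (A : 'M[R]_m) (t : R) : 0 < t -> posdefmx A -> posdefmx (t *: A).
Proof.
move=> t0 [As Ap]; split; first by rewrite linearZ/= As.
by move=> v v0; rewrite -scalemxAl dotZr mulr_gt0// Ap.
Qed.

Lemma integral_normal_gamma D (mu : 'cV[R]_D.+1) (Lam : 'M[R]_D.+1) (a b ta : R) :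
  posdefmx Lam -> 0 < a -> 0 < b ->
  (\int[lebesgue_pow D.+1]_w
     ((0 < ta)%R%:R * normal_gamma_pdf mu Lam a b (vec w) ta)%:E =
   ((0 < ta)%R%:R * gamma_pdf a b ta)%:E)%E.
Proof.
move=> Lp a0 b0; have [ta0|ta0] := ltP 0 ta; last first.
  under eq_integral do rewrite mul0r.
  by rewrite integral0 mul0r.
under eq_integral => w _.
  rewrite mul1r /normal_gamma_pdf mulrC EFinM; over.
have tLp := posdefZ ta0 Lp.
rewrite ge0_integralZl; last 4 first.
- exact: measurableT.
- by apply/measurable_EFinP; exact: measurable_mvnormal_pdf.
- by move=> w _; rewrite lee_fin ltW// mvnormal_pdf_gt0.
- by rewrite lee_fin ltW// gamma_pdf_gt0.
by rewrite integral_mvnormal// mule1 mul1r.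
Qed.

Lemma measurable_sqrt : measurable_fun [set: R] (@Num.sqrt R).
Proof. by apply: continuous_measurable_fun; exact: sqrt_continuous. Qed.

Lemma measurable_normal_gamma D (mu : 'cV[R]_D.+1) (Lam : 'M[R]_D.+1) (a b : R) : posdefmx Lam ->
  measurable_fun setT (fun z : D.+1.-tuple (measurableTypeR R) * measurableTypeR R =>
    (0 < (z.2 : R))%R%:R * normal_gamma_pdf mu Lam a b (vec z.1) (z.2 : R)).
Proof.
move=> Lp; have mv i : measurable_fun setT
    (fun z : D.+1.-tuple (measurableTypeR R) * measurableTypeR R => (vec z.1 - mu) i 0).
  by apply: (measurableT_comp (measurable_vecB mu i)); exact: measurable_fst.
have m2 : measurable_fun setT
    (fun z : D.+1.-tuple (measurableTypeR R) * measurableTypeR R => z.2 : R).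
  exact: measurable_snd.
(* Joint measurability in theta and tau becomes visible once the determinant and the quadratic form
   of tau Lam are expanded as functions of tau. For tau <= 0 both sides vanish. *)
rewrite [X in measurable_fun _ X](_ : _ = fun z =>
  ((0 < (z.2 : R))%R%:R * gamma_pdf a b (z.2 : R)) *
  (Num.sqrt ((z.2 : R) ^+ D.+1 * \det Lam / (pi *+ 2) ^+ D.+1) *
   expR (- ((z.2 : R) * dot (vec z.1 - mu) (Lam *m (vec z.1 - mu))) / 2))); last first.
  apply/funext => z; have [z0|z0] := ltP 0 (z.2 : R); last by rewrite !mul0r.
  rewrite /normal_gamma_pdf mvnormal_pdfE detZ -sqrtrV; last first.
    apply: divr_ge0; first by rewrite exprn_ge0// mulrn_wge0// pi_ge0.
    by apply: mulr_ge0; [rewrite exprn_ge0// ltW|rewrite ltW// det_posdef].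
  by rewrite invf_div /gaussk -scalemxAl dotZr; ring.
apply: measurable_funM; first exact: measurable_gamma_pdf.
apply: measurable_funM.
  apply: (measurableT_comp measurable_sqrt); do 2 apply: measurable_funM => //.
  exact: measurable_funX.
apply: (measurableT_comp (@measurable_expR R)); apply: measurable_funM => //.
apply: measurable_funN; apply: measurable_funM => //; apply: measurable_dot => // i.
by apply: measurable_mulmx.
Qed.

End normalized_densities.

(** * The Dirichlet density in the first K - 1 coordinates *)

Section dirichlet.
Context {R : realType}.

Definition dirichlet_kernel K (alpha : 'I_K -> R) (w : (K.-1).-tuple (measurableTypeR R)) : R :=
  Gamma (\sum_(k < K) alpha k) * \prod_(k < K) gamma_kernel (alpha k) (Defs.pi_of w k).

Lemma pi_of_widen K (w : K.-tuple (measurableTypeR R)) (k : 'I_K) :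
  Defs.pi_of (K := K.+1) w (widen_ord (leqnSn K) k) = tnth w k.
Proof. by rewrite /Defs.pi_of/= ltn_ord (tnth_nth 0). Qed.

Lemma pi_of_max K (w : K.-tuple (measurableTypeR R)) :
  Defs.pi_of (K := K.+1) w ord_max = 1 - \sum_(j < K) (tnth w j : R).
Proof. by rewrite /Defs.pi_of/= ltnn. Qed.

Lemma pi_of_sum K (w : (K.-1).-tuple (measurableTypeR R)) : (0 < K)%N ->
  \sum_(k < K) Defs.pi_of w k = 1.
Proof.
case: K w => // K w _; rewrite big_ord_recr/= pi_of_max.
by under eq_bigr do rewrite pi_of_widen; rewrite addrC subrK.
Qed.

Lemma dirichlet_kernel_ge0 K (alpha : 'I_K -> R) w : (0 < K)%N ->
  (forall k, 0 < alpha k) -> 0 <= dirichlet_kernel alpha w.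
Proof.
move=> K0 al0; apply: mulr_ge0; last by apply: prodr_ge0 => k _; exact: gamma_kernel_ge0.
apply/ltW/Gamma_gt0; rewrite (bigD1 (Ordinal K0))//= ltr_pwDl//.
by apply: sumr_ge0 => k _; exact: ltW.
Qed.

(** The coordinates given by [pi_of] always sum to 1, so a point off the open simplex has a
    nonpositive coordinate, and the truncation in [powpos] kills the product there. *)
Lemma dirichlet_kernelE K (alpha : 'I_K -> R) w : (0 < K)%N ->
  dirichlet_kernel alpha w =
  if `[< open_simplex (Defs.pi_of w) >] then dirichlet_pdf alpha (Defs.pi_of w) else 0.
Proof.
move=> K0; case: asboolP => [[p0 _]|nS].
  rewrite /dirichlet_kernel /dirichlet_pdf -mulrA -prodfV -big_split/=; congr (_ * _).
  by apply: eq_bigr => k _; rewrite /gamma_kernel powpos_gt0// mulrC.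
have [k pk] : exists k, Defs.pi_of w k <= 0.
  apply: contrapT => nk; apply: nS; split; last exact: pi_of_sum.
  by move=> k; rewrite ltNge; apply/negP => pk; apply: nk; exists k.
have gk0 : gamma_kernel (alpha k) (Defs.pi_of w k) = 0.
  by rewrite /gamma_kernel powpos0// mul0r.
by rewrite /dirichlet_kernel [X in _ * X](bigD1 k)//= gk0 mul0r mulr0.
Qed.

Lemma measurable_dirichlet_kernel K (alpha : 'I_K -> R) : (0 < K)%N ->
  measurable_fun setT (dirichlet_kernel alpha).
Proof.
case: K alpha => // K alpha _; apply: measurable_funM => //.
apply: measurable_prod => k _; apply: measurable_gamma_kernel.
rewrite /Defs.pi_of/=; case: ltnP => kK.
  rewrite (_ : (fun w : K.-tuple _ => nth 0 w k) = (fun w => tnth w (Ordinal kK))).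
    exact: measurable_tnth.
  by apply/funext => w; rewrite (tnth_nth 0).
apply: measurable_funB => //; apply: measurable_sum => j; exact: measurable_tnth.
Qed.

Lemma dirichlet_kernelS K (alpha : 'I_K.+1 -> R) (w : K.-tuple (measurableTypeR R)) :
  dirichlet_kernel alpha w = Gamma (\sum_(k < K.+1) alpha k) *
    (\prod_(k < K) gamma_kernel (alpha (widen_ord (leqnSn K) k)) (tnth w k) *
     gamma_kernel (alpha ord_max) (1 - \sum_(k < K) (tnth w k : R))).
Proof.
rewrite /dirichlet_kernel [X in _ * X]big_ord_recr/= pi_of_max; congr (_ * (_ * _)).
by apply: eq_bigr => k _; rewrite pi_of_widen.
Qed.

Lemma integral_dirichlet_kernel K (alpha : 'I_K -> R) : (0 < K)%N ->
  (forall k, 0 < alpha k) ->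
  (\int[lebesgue_pow K.-1]_w (dirichlet_kernel alpha w)%:E = 1)%E.
Proof.
case: K alpha => // K alpha _ al0 /=.
have s0 : 0 < \sum_(k < K.+1) alpha k.
  by rewrite big_ord_recl ltr_pwDl//; apply: sumr_ge0 => k _; exact: ltW.
have G0 := Gamma_gt0 s0.
under eq_integral => w _.
  rewrite dirichlet_kernelS EFinM; over.
rewrite ge0_integralZl; last 4 first.
- exact: measurableT.
- apply/measurable_EFinP; apply: measurable_funM.
    by apply: measurable_prod => i _; apply: measurable_gamma_kernel; exact: measurable_tnth.
  apply: measurable_gamma_kernel; apply: measurable_funB => //.
  by apply: measurable_sum => i; exact: measurable_tnth.
- move=> w _; rewrite lee_fin; apply: mulr_ge0; last exact: gamma_kernel_ge0.
  by apply: prodr_ge0 => i _; exact: gamma_kernel_ge0.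
- by rewrite lee_fin ltW.
rewrite integral_Dirichlet//.
have sE : \sum_(k < K.+1) alpha k =
    \sum_(i < K) alpha (widen_ord (leqnSn K) i) + alpha ord_max by exact: big_ord_recr.
(* At total 1 the kernel equals 1 / Gamma of the sum of the parameters, which the leading factor
   cancels. *)
rewrite -sE /gamma_kernel powpos_gt0// powR1 mul1r -EFinM; congr EFin.
by rewrite divff// gt_eqF.
Qed.

End dirichlet.

(** * Total mass of the product density *)

Section posterior_normalization.
Context {R : realType}.
Variables (Dmax K D : nat).
Variables (alpha : 'I_K -> R) (mu : 'I_K -> 'cV[R]_D.+1) (Lam : 'I_K -> 'M[R]_D.+1).
Variables (a b : 'I_K -> R).
Variables (eta : inode Dmax -> 'cV[R]_2) (L : inode Dmax -> 'M[R]_2).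
Hypothesis K_gt0 : (0 < K)%N.
Hypothesis alpha_gt0 : forall k, 0 < alpha k.
Hypothesis Lam_pos : forall k, posdefmx (Lam k).
Hypothesis a_gt0 : forall k, 0 < a k.
Hypothesis b_gt0 : forall k, 0 < b k.
Hypothesis L_pos : forall s, posdefmx (L s).

Definition posterior (theta : 'I_K -> 'cV[R]_D.+1) (tau p : 'I_K -> R)
    (beta : inode Dmax -> 'cV[R]_2) : R :=
  dirichlet_pdf alpha p *
  (\prod_(k < K) normal_gamma_pdf (mu k) (Lam k) (a k) (b k) (theta k) (tau k)) *
  Defs.beta_pdf eta L beta.

Definition normal_gamma_kernel
    (z : K.-tuple (D.+1.-tuple (measurableTypeR R)) * K.-tuple (measurableTypeR R)) : R :=
  \prod_(k < K) ((0 < (tnth z.2 k : R))%R%:R *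
    normal_gamma_pdf (mu k) (Lam k) (a k) (b k) (vec (tnth z.1 k)) (tnth z.2 k)).

Lemma normal_gamma_factor_ge0 k (v : 'cV[R]_D.+1) (t : R) :
  0 <= (0 < t)%R%:R * normal_gamma_pdf (mu k) (Lam k) (a k) (b k) v t.
Proof.
have [t0|t0] := ltP 0 t; last by rewrite mul0r.
rewrite mul1r /normal_gamma_pdf mulr_ge0// ltW// ?gamma_pdf_gt0//.
by rewrite mvnormal_pdf_gt0//; exact: posdefZ.
Qed.

Lemma measurable_normal_gamma_kernel : measurable_fun setT normal_gamma_kernel.
Proof.
apply: measurable_prod => k _.
pose g (z : K.-tuple (D.+1.-tuple (measurableTypeR R)) * K.-tuple (measurableTypeR R)) :=
  (tnth z.1 k, tnth z.2 k).
have mg : measurable_fun setT g.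
  apply/measurable_fun_pairP; split => /=.
    by apply: (measurableT_comp (measurable_tnth k)); exact: measurable_fst.
  by apply: (measurableT_comp (measurable_tnth k)); exact: measurable_snd.
exact: (measurableT_comp (measurable_normal_gamma (mu k) (a k) (b k) (Lam_pos k)) mg).
Qed.

Lemma integral_normal_gamma_kernel :
  (\int[sfprod (power_measure (@lebesgue_pow R D.+1) K) (@lebesgue_pow R K)]_z
    (normal_gamma_kernel z)%:E = 1)%E.
Proof.
(* Theta is integrated first, at fixed tau: its precision matrix depends on tau, while its integral
   does not. *)
rewrite integral_sfprod_swap; last 2 first.
- by apply/measurable_EFinP; exact: measurable_normal_gamma_kernel.
- by move=> z; rewrite lee_fin; apply: prodr_ge0 => k _; exact: normal_gamma_factor_ge0.
under eq_integral => t _.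
  rewrite /normal_gamma_kernel/=.
  rewrite (@integral_power_prod _ _ R (lebesgue_pow D.+1) K (fun k w =>
    (0 < (tnth t k : R))%R%:R *
    normal_gamma_pdf (mu k) (Lam k) (a k) (b k) (vec w) (tnth t k))); last 2 first.
  - move=> k; apply: measurable_funM => //; apply: measurable_funM => //.
    exact: measurable_mvnormal_pdf.
  - by move=> k w; exact: normal_gamma_factor_ge0.
  under eq_bigr do rewrite integral_normal_gamma//.
  rewrite prodEFin; over.
rewrite (@integral_power_prod _ _ R lebesgue1 K (fun k t =>
  (0 < (t : R))%R%:R * gamma_pdf (a k) (b k) t)); last 2 first.
- by move=> k; exact: measurable_gamma_pdf.
- move=> k t; have [t0|t0] := ltP 0 (t : R); last by rewrite mul0r.
  by rewrite mul1r ltW// gamma_pdf_gt0.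
by rewrite big1// => k _; exact: integral_gamma_pdf.
Qed.

Lemma beta_pdf_gt0 beta : 0 < Defs.beta_pdf eta L beta.
Proof. by apply: prodr_gt0 => s _; exact: mvnormal_pdf_gt0. Qed.

Lemma beta_pdf_enum w : Defs.beta_pdf eta L (beta_of w) =
  \prod_(i < #|inode Dmax|)
    mvnormal_pdf (eta (enum_val i)) (invmx (L (enum_val i))) (vec (tnth w i)).
Proof.
rewrite /Defs.beta_pdf (reindex (@enum_val (inode Dmax) xpredT))/=; last first.
  by exists enum_rank => i _; [exact: enum_valK|exact: enum_rankK].
by apply: eq_bigr => i _; rewrite /beta_of enum_valK.
Qed.

Lemma measurable_beta_pdf : measurable_fun setT
  (fun w : #|inode Dmax|.-tuple (2.-tuple (measurableTypeR R)) => Defs.beta_pdf eta L (beta_of w)).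
Proof.
apply: measurable_prod => s _.
by apply: (measurableT_comp (measurable_mvnormal_pdf _ _)); exact: measurable_tnth.
Qed.

Lemma integral_beta_pdf :
  (\int[@beta_mu R Dmax]_w (Defs.beta_pdf eta L (beta_of w))%:E = 1)%E.
Proof.
under eq_integral do rewrite beta_pdf_enum.
rewrite /beta_mu (@integral_power_prod _ _ R (lebesgue_pow 2) _ (fun i w =>
  mvnormal_pdf (eta (enum_val i)) (invmx (L (enum_val i))) (vec w))); last 2 first.
- by move=> i; exact: measurable_mvnormal_pdf.
- by move=> i w; rewrite ltW// mvnormal_pdf_gt0.
by rewrite big1// => i _; exact: integral_mvnormal.
Qed.

(* The posterior density extended by 0 off the admissible coordinates. *)
Definition posterior_kernel (w : @coords R Dmax K D) : R :=
  normal_gamma_kernel w.1.1 * dirichlet_kernel alpha w.1.2 *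
  Defs.beta_pdf eta L (beta_of w.2).

Lemma posterior_kernelE w : posterior_kernel w =
  if `[< at_coords (@admissible R Dmax K D) w >] then at_coords posterior w else 0.
Proof.
rewrite /posterior_kernel; case: asboolP => [[t0 ps]|nadm].
  rewrite /at_coords /posterior dirichlet_kernelE// asboolT// (mulrC (dirichlet_pdf _ _)).
  congr (_ * _ * _); apply: eq_bigr => k _.
  by rewrite t0 mul1r.
have [[k tk]|t0] := pselect (exists k, ~~ (0 < (tnth w.1.1.2 k : R))).
  by rewrite /normal_gamma_kernel (bigD1 k)//= (negbTE tk) !mul0r.
rewrite dirichlet_kernelE// asboolF ?mulr0 ?mul0r// => ps.
apply: nadm; split => // k; apply: contrapT => /negP tk; apply: t0; by exists k.
Qed.

Lemma posterior_kernel_ge0 w : 0 <= posterior_kernel w.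
Proof.
apply: mulr_ge0; last exact/ltW/beta_pdf_gt0.
apply: mulr_ge0; last exact: dirichlet_kernel_ge0.
by apply: prodr_ge0 => k _; exact: normal_gamma_factor_ge0.
Qed.

Lemma measurable_posterior_kernel : measurable_fun setT posterior_kernel.
Proof.
apply: measurable_funM; last first.
  by apply: (measurableT_comp measurable_beta_pdf); exact: measurable_snd.
apply: measurable_funM.
  apply: (measurableT_comp measurable_normal_gamma_kernel).
  by apply: (measurableT_comp measurable_fst); exact: measurable_fst.
apply: (measurableT_comp (measurable_dirichlet_kernel alpha K_gt0)).
by apply: (measurableT_comp measurable_snd); exact: measurable_fst.
Qed.

Lemma integral_posterior_kernel :
  (\int[@coords_mu R Dmax K D]_w (posterior_kernel w)%:E = 1)%E.
Proof.
have nd0 z : 0 <= normal_gamma_kernel z.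
  by apply: prodr_ge0 => k _; exact: normal_gamma_factor_ge0.
rewrite /posterior_kernel /coords_mu.
rewrite (@integral_sfprod_mul _ _ _ _ R _ _
  (fun z => normal_gamma_kernel z.1 * dirichlet_kernel alpha z.2)
  (fun z => Defs.beta_pdf eta L (beta_of z))); last 4 first.
- apply: measurable_funM.
    by apply: (measurableT_comp measurable_normal_gamma_kernel); exact: measurable_fst.
  apply: (measurableT_comp (measurable_dirichlet_kernel alpha K_gt0)).
  exact: measurable_snd.
- by move=> z; apply: mulr_ge0; [exact: nd0|exact: dirichlet_kernel_ge0].
- exact: measurable_beta_pdf.
- by move=> z; exact/ltW/beta_pdf_gt0.
rewrite integral_beta_pdf mule1.
rewrite (@integral_sfprod_mul _ _ _ _ R _ _ normal_gamma_kernel (dirichlet_kernel alpha)); last 4 first.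
- exact: measurable_normal_gamma_kernel.
- exact: nd0.
- exact: measurable_dirichlet_kernel.
- by move=> w; exact: dirichlet_kernel_ge0.
by rewrite integral_normal_gamma_kernel integral_dirichlet_kernel// mule1.
Qed.

Lemma prob_density_proportional q (C : R) : 0 <= C ->
  is_prob_density q ->
  (forall theta tau p beta, admissible theta tau p beta ->
     q theta tau p beta = C * posterior theta tau p beta) -> C = 1.
Proof.
move=> C0 [_ _ q1] qE; apply: EFin_inj; rewrite -q1.
transitivity (\int[@coords_mu R Dmax K D]_w (C%:E * (posterior_kernel w)%:E))%E.
  rewrite ge0_integralZl; last 4 first.
  - exact: measurableT.
  - by apply/measurable_EFinP; exact: measurable_posterior_kernel.
  - by move=> w _; rewrite lee_fin; exact: posterior_kernel_ge0.
  - by rewrite lee_fin.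
  by rewrite integral_posterior_kernel mule1.
rewrite [RHS]integral_mkcond; apply: eq_integral => w _.
rewrite posterior_kernelE /patch -EFinM; case: asboolP => adm.
  by rewrite mem_set// /at_coords qE.
by rewrite memNset// mulr0.
Qed.

End posterior_normalization.

(** * Expectations under q(u) and q(z, T) *)

Section path_weights.
Context {R : realType}.
Variables (Dmax n : nat) (varpi : 'I_n -> inode Dmax -> bool -> R).
Hypothesis varpi_sum : forall t s, varpi t s false + varpi t s true = 1.

Lemma prefix_rcons_nth (s v : seq bool) (b : bool) : (size s < size v)%N ->
  prefix (rcons s b) v = prefix s v && (nth false v (size s) == b).
Proof.
by move=> sv; rewrite !prefixE size_rcons (take_nth false)// eqseq_rcons.
Qed.

Lemma preceq_child_leaf (s : inode Dmax) b (v : Dmax.-tuple bool) :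
  preceq (child s b) (leaf_of v) =
  preceq (val s) (leaf_of v) && (tnth v (inode_depth s) == b).
Proof.
rewrite /preceq/= prefix_rcons_nth ?size_tuple; last exact: (valP s).
by rewrite (tnth_nth false).
Qed.

Lemma prefix_rconsr (s p : seq bool) b :
  prefix s (rcons p b) = prefix s p || (s == rcons p b).
Proof.
have [sp|sp] := leqP (size s) (size p).
  rewrite !prefixE -cats1 takel_cat//; case: eqP => //= _; apply/esym/eqP => sE.
  by move: sp; rewrite sE cats1 size_rcons ltnn.
rewrite [X in _ = X || _](_ : _ = false)/=; last first.
  by apply/negbTE/negP => /size_prefix; rewrite leqNgt sp.
rewrite prefixE eq_sym take_oversize//; last by rewrite size_rcons.
Qed.

Lemma preceq_child_child (s s' : inode Dmax) b b' :
  preceq (child s' b') (child s b) =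
  preceq (child s' b') (val s) || ((s' == s) && (b' == b)).
Proof.
rewrite /preceq/= prefix_rconsr; congr (_ || _).
by rewrite eqseq_rcons; congr (_ && _).
Qed.

(** Only the edges on the way from the root to [s] have a nonzero exponent, so this is the product
    of the branch probabilities along that way. At a leaf it has the very form of [q_ut]. *)
Definition path_weight (t : 'I_n) (s : node Dmax) : R :=
  \prod_(s' : inode Dmax) \prod_(b : bool) varpi t s' b ^+ preceq (child s' b) s.

Lemma path_weight_root t : path_weight t (root_node Dmax) = 1.
Proof.
rewrite /path_weight big1// => s _; rewrite big1// => b _.
by rewrite (_ : preceq _ _ = false) //= /preceq/=; case: (val s) => -[].
Qed.

(** Going down to a child adds exactly one edge to the path. *)
Lemma path_weight_child t (s : inode Dmax) b :
  path_weight t (child s b) = path_weight t (val s) * varpi t s b.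
Proof.
have nss : preceq (child s b) (val s) = false.
  by apply/negbTE/negP => /size_prefix; rewrite size_rcons ltnn.
rewrite /path_weight.
rewrite (eq_bigr (fun s' => (\prod_(b' : bool) varpi t s' b' ^+ preceq (child s' b') (val s)) *
  \prod_(b' : bool) varpi t s' b' ^+ ((s' == s) && (b' == b)))); last first.
  move=> s' _; rewrite -big_split/=; apply: eq_bigr => b' _.
  rewrite preceq_child_child -exprD; congr (_ ^+ _).
  have [->|_] := eqVneq s' s; last by rewrite orbF addn0.
  by have [->|_] := eqVneq b' b; rewrite ?nss// orbF addn0.
rewrite big_split/=; congr (_ * _).
rewrite (bigD1 s)//= [X in _ * X]big1 ?mulr1; last first.
  by move=> s' /negbTE ->; rewrite big1// => b' _; rewrite expr0.
rewrite (bigD1 b)//= [X in _ * X]big1 ?mulr1 ?eqxx ?expr1//.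
by move=> b' /negbTE ->; rewrite andbF expr0.
Qed.

(** Induction from the leaves towards the root. A path through an inner node continues through
    exactly one child, and the two branch probabilities sum to 1; below a leaf there is a single
    word. *)
Lemma q_prec_path_weight t s : q_prec varpi s t = path_weight t s.
Proof.
have [k] := ubnP (Dmax - size s); elim: k s => // k IHk s sk.
have [sD|sD] := ltnP (size s) Dmax.
  pose s' : inode Dmax := exist _ s sD.
  have -> : path_weight t s = \sum_(b : bool) path_weight t (child s' b).
    under eq_bigr do rewrite path_weight_child.
    by rewrite -mulr_sumr big_bool/= addrC varpi_sum mulr1.
  transitivity (\sum_(b : bool) q_prec varpi (child s' b) t); last first.
    apply: eq_bigr => b _; apply: IHk; rewrite size_rcons subnS.
    by rewrite prednK ?subn_gt0// -ltnS (leq_trans _ sk)// .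
  rewrite /q_prec exchange_big/=; apply: eq_bigr => v _.
  rewrite -mulr_sumr big_bool/= !(preceq_child_leaf s'); congr (_ * _).
  by case: (tnth v _); rewrite ?andbT ?andbF/= ?addr0 ?add0r.
have sizes : size s == Dmax by rewrite eqn_leq size_bseq.
pose v0 := Tuple sizes.
rewrite /q_prec (bigD1 v0)//= big1 ?addr0; last first.
  move=> v vv0; rewrite (_ : preceq _ _ = false) ?mulr0//.
  apply: contraNF vv0; rewrite /preceq prefixE take_oversize/= => [|//].
    by move/eqP => vs; apply/eqP/val_inj.
  by rewrite size_tuple (eqP sizes).
rewrite /preceq/= prefix_refl mulr1 /q_ut /path_weight.
by apply: eq_bigr => s' _; apply: eq_bigr.
Qed.

Lemma q_prec_child t (s : inode Dmax) b :
  q_prec varpi (child s b) t = q_prec varpi (val s) t * varpi t s b.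
Proof. by rewrite !q_prec_path_weight path_weight_child. Qed.

(** Every path passes through the root, whose weight is 1. *)
Lemma sum_q_ut t : \sum_v q_ut varpi t v = 1.
Proof.
rewrite -(path_weight_root t) -q_prec_path_weight /q_prec.
by apply: eq_bigr => v _; rewrite /preceq prefix0s mulr1.
Qed.

Hypothesis varpi_ge0 : forall t s u, 0 <= varpi t s u.

Lemma q_prec_ge0 t s : 0 <= q_prec varpi s t.
Proof.
rewrite q_prec_path_weight; apply: prodr_ge0 => s' _; apply: prodr_ge0 => b _.
exact: exprn_ge0.
Qed.

End path_weights.

Section product_expectation.
Context {R : realType}.

Lemma sum_ffun_prod (I J : finType) (F : I -> J -> R) :
  (forall i, \sum_j F i j = 1) -> \sum_(u : {ffun I -> J}) \prod_i F i (u i) = 1.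
Proof. by move=> F1; rewrite -bigA_distr_bigA big1. Qed.

Lemma sum_ffun_marginal (I J : finType) (F : I -> J -> R) (i0 : I) (f : J -> R) :
  (forall i, \sum_j F i j = 1) ->
  \sum_(u : {ffun I -> J}) (\prod_i F i (u i)) * f (u i0) = \sum_j F i0 j * f j.
Proof.
(* Absorbing [f] into the factor of index [i0] makes the summand a product over [I], so the sum
   factors and all other factors equal 1. *)
move=> F1; pose G i j := F i j * (if i == i0 then f j else 1).
rewrite (eq_bigr (fun u : {ffun I -> J} => \prod_i G i (u i))); last first.
  move=> u _; rewrite [RHS]big_split/=; congr (_ * _).
  by rewrite (bigD1 i0)//= eqxx big1 ?mulr1// => i /negbTE ->.
rewrite -bigA_distr_bigA (bigD1 i0)//= [X in _ * X]big1 ?mulr1; last first.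
  move=> i ii0; rewrite /G (negbTE ii0); under eq_bigr do rewrite mulr1.
  exact: F1.
by apply: eq_bigr => j _; rewrite /G eqxx.
Qed.

End product_expectation.

Section expectation_u.
Context {R : realType}.
Variables (Dmax n : nat) (varpi : 'I_n -> inode Dmax -> bool -> R).
Hypothesis varpi_sum : forall t s, varpi t s false + varpi t s true = 1.

Lemma E_uD f g : E_u varpi (fun u => f u + g u) = E_u varpi f + E_u varpi g.
Proof. by rewrite /E_u -big_split; apply: eq_bigr => u _; rewrite mulrDr. Qed.

Lemma E_uZ k f : E_u varpi (fun u => k * f u) = k * E_u varpi f.
Proof. by rewrite /E_u mulr_sumr; apply: eq_bigr => u _; rewrite mulrCA. Qed.

Lemma E_u_cst k : E_u varpi (fun=> k) = k.
Proof.
rewrite /E_u -mulr_suml sum_ffun_prod ?mul1r// => t; exact: sum_q_ut.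
Qed.

Lemma E_u_sum (I : Type) (r : seq I) (f : I -> inputs Dmax n -> R) :
  E_u varpi (fun u => \sum_(i <- r) f i u) = \sum_(i <- r) E_u varpi (f i).
Proof.
rewrite /E_u exchange_big/=; apply: eq_bigr => u _; by rewrite mulr_sumr.
Qed.

Lemma E_u_marginal t (f : Dmax.-tuple bool -> R) :
  E_u varpi (fun u => f (u t)) = \sum_v q_ut varpi t v * f v.
Proof. by rewrite /E_u /q_u sum_ffun_marginal// => t'; exact: sum_q_ut. Qed.

Lemma E_u_prec t s :
  E_u varpi (fun u => (preceq s (leaf_of (u t)))%:R) = q_prec varpi s t.
Proof. exact: (E_u_marginal t (fun v => (preceq s (leaf_of v))%:R)). Qed.

(** Passing through [s] and branching to side b means passing through [child s b], whose probability
    is given by [q_prec_child]. *)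
Lemma E_u_branch t (s : inode Dmax) (h : bool -> R) :
  E_u varpi (fun u => (preceq (val s) (leaf_of (u t)))%:R *
                      h (tnth (u t) (inode_depth s))) =
  q_prec varpi (val s) t * (varpi t s false * h false + varpi t s true * h true).
Proof.
rewrite (E_u_marginal t (fun v => (preceq (val s) (leaf_of v))%:R *
  h (tnth v (inode_depth s)))).
rewrite mulrDr !mulrA -!q_prec_child// /q_prec !mulr_suml -big_split/=.
apply: eq_bigr => v _; rewrite !preceq_child_leaf -!mulrA -mulrDr; congr (_ * _).
by case: (tnth v _); rewrite ?andbT ?andbF mul0r ?addr0 ?add0r.
Qed.

End expectation_u.

Section expectation_zT.
Context {R : realType}.
Variables (Dmax K : nat) (qT : tree Dmax -> R) (pi' : node Dmax -> 'I_K -> R).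
Hypothesis qT_sum : \sum_(T : tree Dmax) qT T = 1.
Hypothesis pi'_sum : forall s, \sum_(k < K) pi' s k = 1.

(** One-hot vectors correspond to indices, and at the k-th unit vector the product collapses to
    [P k]. *)
Lemma sum_onehot (P : 'I_K -> R) (f : onehot K -> R) (F : 'I_K -> R) :
  (forall (e : onehot K) k, val e k -> f e = F k) ->
  \sum_(e : onehot K) (\prod_(k < K) P k ^+ val e k) * f e = \sum_(k < K) P k * F k.
Proof.
move=> fF; have oP k : #|[pred j | [ffun i : 'I_K => i == k] j]| == 1%N.
  rewrite -(card1 k); apply/eqP; apply: eq_card => j; by rewrite !inE ffunE.
pose h (k : 'I_K) : onehot K := exist _ [ffun i : 'I_K => i == k] (oP k).
have hinj : bijective h.
  have hex (e : onehot K) : exists k, [pred j | val e j] =i pred1 k.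
    by have /eqP/mem_card1[k ke] := valP e; exists k.
  pose g (e : onehot K) := projT1 (cid (hex e)).
  exists g => [k|e]; rewrite /g; case: cid => /= k' kE.
    by have := kE k; rewrite !inE ffunE eqxx => /esym/eqP.
  by apply/val_inj/ffunP => j; rewrite ffunE; have := kE j; rewrite !inE => ->.
rewrite (reindex h)/=; last exact: onW_bij.
apply: eq_bigr => k _; rewrite (fF _ k) ?ffunE ?eqxx//; congr (_ * _).
rewrite (bigD1 k)//= big1 ?mulr1 ?ffunE ?eqxx ?expr1// => j jk.
by rewrite ffunE (negbTE jk).
Qed.

Let q_zs (T : tree Dmax) (s : tree_leaf T) (e : onehot K) : R :=
  \prod_(k < K) pi' (val s) k ^+ val e k.

Lemma sum_q_zs (T : tree Dmax) (s : tree_leaf T) : \sum_e q_zs s e = 1.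
Proof.
rewrite -[RHS](pi'_sum (val s)) -[RHS](eq_bigr _ (fun k _ => mulr1 _)).
rewrite -(sum_onehot _ (f := fun=> 1))//.
by apply: eq_bigr => e _; rewrite mulr1.
Qed.

Lemma E_zTD f g : E_zT qT pi' (fun T z => f T z + g T z) = E_zT qT pi' f + E_zT qT pi' g.
Proof.
rewrite /E_zT -big_split; apply: eq_bigr => T _; rewrite -big_split.
by apply: eq_bigr => z _; rewrite mulrDr.
Qed.

Lemma E_zT_cst k : E_zT qT pi' (fun _ _ => k) = k.
Proof.
rewrite -[RHS]mul1r -qT_sum mulr_suml; apply: eq_bigr => T _.
rewrite -mulr_suml -mulr_sumr (_ : \sum_(z : assignment K T) _ = 1) ?mulr1//.
exact: (sum_ffun_prod (@sum_q_zs T)).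
Qed.

(** For a fixed tree the z_s are independent, so each summand needs only the marginal of one z_s.
    Extending the sum over leaves of T to all nodes by an indicator and averaging over T produces
    [q_leaf]. *)
Lemma E_zT_leaf (G : node Dmax -> 'I_K -> R) :
  E_zT qT pi' (fun T z => \sum_(s : tree_leaf T) \sum_(k < K) (entry z s k)%:R * G (val s) k) =
  \sum_(s : node Dmax) \sum_(k < K) q_leaf qT s * pi' s k * G s k.
Proof.
transitivity (\sum_(T : tree Dmax) qT T *
  \sum_(s : tree_leaf T) \sum_(k < K) pi' (val s) k * G (val s) k).
  apply: eq_bigr => T _; rewrite mulr_sumr.
  under eq_bigr do rewrite mulr_sumr.
  rewrite exchange_big/=; apply: eq_bigr => s _.
  under eq_bigr do rewrite -mulrA.
  rewrite -mulr_sumr; congr (_ * _).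
  rewrite (sum_ffun_marginal s (fun e : onehot K => \sum_(k < K) (val e k)%:R * G (val s) k)
    (@sum_q_zs T)).
  apply: sum_onehot => e k ek; rewrite (bigD1 k)//= ek mul1r big1 ?addr0// => j jk.
  have /eqP/mem_card1[k' kE] := valP e.
  have := kE k; have := kE j; rewrite !inE ek => -> /esym/eqP kk'.
  by rewrite -kk' (negbTE jk) mul0r.
under [RHS]eq_bigr => s _.
  under eq_bigr => k _ do rewrite /q_leaf mulr_suml mulr_suml.
  rewrite exchange_big/=; over.
rewrite exchange_big/=; apply: eq_bigr => T _.
rewrite (eq_bigr (fun s : node Dmax => qT T * ((s \in tree_leaves T)%:R *
  \sum_(k < K) pi' s k * G s k))); last first.
  move=> s _; rewrite !mulr_sumr; apply: eq_bigr => k _; by rewrite !mulrA.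
rewrite -mulr_sumr; congr (_ * _).
under [RHS]eq_bigr do rewrite -[X in X * _]mulr1n.
rewrite [RHS](bigID (fun s => s \in tree_leaves T))/= [X in _ = _ + X]big1 ?addr0; last first.
  by move=> s /negbTE ->; rewrite mul0r.
rewrite [RHS](eq_bigr (fun s => \sum_(k < K) pi' s k * G s k)); last first.
  by move=> s ->; rewrite mul1r.
exact/esym/(big_sub (mem (tree_leaves T)) (fun s => \sum_(k < K) pi' s k * G s k)).
Qed.

End expectation_zT.

(** * The logistic bound *)

Section logistic_bound.
Context {R : realType}.
Implicit Types x y xi : R.
Local Notation lambda := (@Defs.lambda R).

Lemma sigmoid_gt0 x : 0 < sigmoid x.
Proof. by rewrite invr_gt0 addr_gt0// expR_gt0. Qed.

Lemma is_derive_sigmoid x : is_derive x 1 sigmoid (sigmoid x * (1 - sigmoid x)).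
Proof.
have e0 : 1 + expR (- x) != 0 by rewrite gt_eqF// addr_gt0// expR_gt0.
rewrite /sigmoid; apply: is_derive_eq.
rewrite /GRing.scale/=; field; exact: e0.
Qed.

Lemma sigmoidN x : sigmoid (- x) = sigmoid x * expR (- x).
Proof.
rewrite /sigmoid opprK expRN; have := expR_gt0 x; move: (expR x) => e e0.
by field; rewrite !gt_eqF// addr_gt0.
Qed.

Lemma sigmoid0 : sigmoid (0 : R) = 2^-1.
Proof. by rewrite /sigmoid oppr0 expR0. Qed.

Lemma le_sigmoid : {homo @sigmoid R : x y / x <= y}.
Proof.
move=> x y xy; rewrite lef_pV2 ?posrE ?addr_gt0 ?expR_gt0//.
by rewrite lerD2l ler_expR lerN2.
Qed.

Lemma sigmoid_ge_half x : 0 <= x -> 2^-1 <= sigmoid x.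
Proof. by move=> x0; rewrite -sigmoid0 le_sigmoid. Qed.

Lemma sigmoid_MVT x y : x < y -> exists2 c, c \in `]x, y[ &
  sigmoid y - sigmoid x = sigmoid c * (1 - sigmoid c) * (y - x).
Proof.
move=> xy; apply: (MVT xy) => [c _|]; first exact: is_derive_sigmoid.
apply: continuous_subspaceT => z.
apply: differentiable_continuous; apply/derivable1_diffP.
by case: (is_derive_sigmoid z).
Qed.

(** s (1 - s) decreases for s >= 1/2, a range that [sigmoid] reaches at 0 and then never leaves. *)
Lemma sigmoid_slope_le x y : 0 <= x -> x <= y ->
  sigmoid y * (1 - sigmoid y) <= sigmoid x * (1 - sigmoid x).
Proof.
move=> x0 xy; have := sigmoid_ge_half x0; have := le_sigmoid xy.
by move: (sigmoid x) (sigmoid y) => s t; nra.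
Qed.

Lemma lambda_ge0 x : 0 <= lambda x.
Proof.
rewrite /Defs.lambda; case: eqP => // /eqP x0.
have [xp|xn] := ltP 0 x.
  by rewrite mulr_ge0 ?subr_ge0 ?sigmoid_ge_half ?invr_ge0 ?mulr_ge0// ltW.
rewrite mulr_le0// ?invr_le0 ?subr_le0.
  by rewrite pmulr_rle0.
by rewrite -sigmoid0 le_sigmoid.
Qed.

Lemma lambdaN x : lambda (- x) = lambda x.
Proof.
rewrite /Defs.lambda oppr_eq0; case: eqP => // /eqP x0.
rewrite sigmoidN /sigmoid expRN; have := expR_gt0 x; move: (expR x) => e e0.
by field; rewrite x0 !gt_eqF// addr_gt0.
Qed.

(** 2 lambda(x) is the slope of the chord of [sigmoid] over [0, x], or its tangent slope 1/4 when x
    = 0. These slopes decrease because the derivative of [sigmoid] does on the positive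
    half-line. *)
Lemma lambda_nonincreasing x y : 0 <= x -> x <= y -> lambda y <= lambda x.
Proof.
rewrite le_eqVlt => /predU1P[<-|x0] xy.
  move: xy; rewrite le_eqVlt => /predU1P[<-//|y0].
  have [c] := sigmoid_MVT y0; rewrite in_itv/= => /andP[c0 cy].
  rewrite subr0 sigmoid0 => sE.
  rewrite /Defs.lambda eqxx gt_eqF// sE.
  have := sigmoid_slope_le (lexx 0) (ltW c0); rewrite sigmoid0.
  move: (sigmoid c * _) => k hk.
  have -> : (2 * y)^-1 * (k * y) = k / 2 by field; rewrite gt_eqF.
  lra.
move: xy; rewrite le_eqVlt => /predU1P[->//|xy].
have y0 : 0 < y by exact: lt_trans xy.
have [c] := sigmoid_MVT x0; rewrite in_itv/= => /andP[c0 cx].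
rewrite subr0 sigmoid0 => sx.
have [d] := sigmoid_MVT xy; rewrite in_itv/= => /andP[xd dy] sy.
rewrite /Defs.lambda !gt_eqF// !invfM -!mulrA ler_pM2l ?invr_gt0//.
rewrite ler_pdivrMl// mulrCA ler_pdivlMl//.
have := sigmoid_slope_le (ltW c0) (ltW (lt_trans cx xd)).
move: (sigmoid c * _) (sigmoid d * _) sx sy => k l.
move: (sigmoid x) (sigmoid y) => s t sx sy lk.
have -> : t = s + l * (y - x) by lra.
have -> : s = k * x + 2^-1 by lra.
(* With denominators cleared, the claim is precisely the sign of this product; k and l are mean
   slopes over [0, x] and [x, y]. *)
have : 0 <= x * (y - x) * (k - l) by rewrite !mulr_ge0 ?subr_ge0 // ltW.
nra.
Qed.

(** This is - ln(e^(x/2) + e^(-x/2)): removing the linear part x/2 from ln sigmoid leaves an even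
    function. *)
Definition logistic_potential x : R := ln (sigmoid x) - x / 2.

Lemma logistic_potentialN x : logistic_potential (- x) = logistic_potential x.
Proof.
rewrite /logistic_potential sigmoidN lnM ?posrE ?sigmoid_gt0 ?expR_gt0// expRK.
by lra.
Qed.

Lemma is_derive_logistic_potential x :
  is_derive x 1 logistic_potential (- (2 * x * lambda x)).
Proof.
have s0 := sigmoid_gt0 x.
have ds := is_derive_sigmoid x.
have dl : is_derive (sigmoid x) 1 (@ln R) (sigmoid x)^-1 by exact: is_derive1_ln.
rewrite /logistic_potential; apply: is_derive_eq.
rewrite /GRing.scale/=.
have -> : 2 * x * lambda x = sigmoid x - 2^-1.
  rewrite /Defs.lambda; case: eqP => [->|/eqP x0].
    by rewrite sigmoid0 mulr0 mul0r subrr.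
  by field.
by field; rewrite gt_eqF.
Qed.

(* Jaakkola and Jordan's bound: [logistic_potential] is a convex function of the square of
   its argument. *)
Lemma logistic_potential_bound xi y :
  logistic_potential xi - lambda xi * (y ^+ 2 - xi ^+ 2) <= logistic_potential y.
Proof.
wlog : xi y / 0 <= xi /\ 0 <= y.
  move=> W; have := W `|xi| `|y| (conj (normr_ge0 _) (normr_ge0 _)).
  rewrite !real_normK ?num_real//.
  have E (z : R) : logistic_potential `|z| = logistic_potential z.
    by have [z0|z0] := ler0P z; rewrite ?logistic_potentialN.
  have -> : lambda `|xi| = lambda xi by have [z0|z0] := ler0P xi; rewrite ?lambdaN.
  by rewrite !E.
move=> [xi0 y0].
(* The bound says that [H] is smallest at [xi] among nonnegative arguments. Since [lambda] is
   nonincreasing, [H'] is nonpositive before [xi] and nonnegative after it. *)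
pose H x := logistic_potential x + lambda xi * x ^+ 2.
pose H' x := 2 * x * (lambda xi - lambda x).
have dH x : is_derive x 1 H (H' x).
  have d := is_derive_logistic_potential x.
  rewrite /H /H'; apply: is_derive_eq.
  by rewrite /GRing.scale/=; ring.
have cH a b : {within `[a, b], continuous H}.
  apply: continuous_subspaceT => z.
  apply: differentiable_continuous; apply/derivable1_diffP.
  by case: (dH z).
suff : H xi <= H y by rewrite /H; nra.
have [xiy|yxi|->//] := ltgtP xi y; rewrite -subr_ge0.
  have [c] := MVT xiy (fun x _ => dH x) (cH _ _).
  rewrite in_itv/= => /andP[xic cy] ->.
  apply: mulr_ge0; last by rewrite subr_ge0 ltW.
  rewrite /H' mulr_ge0 ?subr_ge0 ?lambda_nonincreasing ?(ltW xic)//.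
  by rewrite mulr_ge0// (le_trans xi0)// ltW.
have [c] := MVT yxi (fun x _ => dH x) (cH _ _).
rewrite in_itv/= => /andP[yc cxi] HE.
rewrite -oppr_le0 opprB HE; apply: mulr_le0_ge0; last by rewrite subr_ge0 ltW.
have c0 : 0 <= c by rewrite (le_trans y0)// ltW.
rewrite /H' mulr_ge0_le0//; first by rewrite mulr_ge0.
by rewrite subr_le0 lambda_nonincreasing// ltW.
Qed.

End logistic_bound.

(** * Conjugate updates *)

Section log_densities.
Context {R : realType}.

Lemma ln_prod (I : Type) (r : seq I) (P : pred I) (f : I -> R) :
  (forall i, 0 < f i) ->
  ln (\prod_(i <- r | P i) f i) = \sum_(i <- r | P i) ln (f i).
Proof.
move=> f0.
suff [] : 0 < \prod_(i <- r | P i) f i /\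
  ln (\prod_(i <- r | P i) f i) = \sum_(i <- r | P i) ln (f i) by [].
elim/big_rec2: _ => [|i y x _ [x0 xy]]; first by rewrite ltr01 ln1.
by rewrite mulr_gt0// lnM ?posrE// xy.
Qed.

Lemma ln_sqrt (x : R) : 0 < x -> ln (Num.sqrt x) = ln x / 2.
Proof. by move=> x0; rewrite -powR12_sqrt ?ltW// ln_powR mulrC. Qed.

Lemma normal1_pdf_gt0 (m t x : R) : 0 < t -> 0 < normal1_pdf m t^-1 x.
Proof.
move=> t0; have s0 : Num.sqrt t^-1 != 0 by rewrite gt_eqF// sqrtr_gt0 invr_gt0.
by rewrite /normal1_pdf normal_pdfE// mulr_gt0 ?normal_peak_gt0 ?expR_gt0.
Qed.

Lemma ln_normal1_pdf (m t x : R) : 0 < t ->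
  ln (normal1_pdf m t^-1 x) = - (ln (pi *+ 2) / 2) + ln t / 2 - t / 2 * (x - m) ^+ 2.
Proof.
move=> t0; have s0 : Num.sqrt t^-1 != 0 by rewrite gt_eqF// sqrtr_gt0 invr_gt0.
have p0 : 0 < pi *+ 2 :> R by rewrite mulrn_wgt0 ?pi_gt0.
rewrite /normal1_pdf normal_pdfE// lnM ?posrE ?normal_peak_gt0 ?expR_gt0//.
rewrite /normal_peak /normal_fun expRK sqr_sqrtr ?invr_ge0 ?ltW//.
rewrite -mulrnAr lnV ?posrE; last by rewrite sqrtr_gt0 mulr_gt0 ?invr_gt0.
rewrite ln_sqrt ?mulr_gt0 ?invr_gt0// lnM ?posrE ?invr_gt0// lnV ?posrE//.
rewrite -(mulr_natl t^-1 2).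
by move: (ln _) (ln _) => l1 l2; field; rewrite gt_eqF.
Qed.

Lemma ln_mvnormal_pdf m (mu v : 'cV[R]_m) (A : 'M[R]_m) : posdefmx A ->
  ln (mvnormal_pdf mu (invmx A) v) =
  - ln (Num.sqrt ((pi *+ 2) ^+ m / \det A)) - dot (v - mu) (A *m (v - mu)) / 2.
Proof.
move=> Ap; have N0 := mvnormal_norm_gt0 Ap.
by rewrite mvnormal_pdfE lnM ?posrE ?invr_gt0 ?expR_gt0// lnV// /gaussk expRK mulNr.
Qed.

Lemma ln_gamma_pdf (a b x : R) : 0 < a -> 0 < b -> 0 < x ->
  ln (gamma_pdf a b x) = ln (b `^ a / Gamma a) + (a - 1) * ln x - b * x.
Proof.
move=> a0 b0 x0; have G0 := Gamma_gt0 a0.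
rewrite /gamma_pdf lnM ?posrE ?mulr_gt0 ?powR_gt0 ?invr_gt0 ?expR_gt0//.
rewrite lnM ?posrE ?mulr_gt0 ?powR_gt0 ?invr_gt0//.
by rewrite ln_powR expRK mulNr.
Qed.

Lemma normal_gamma_pdf_gt0 D (mu : 'cV[R]_D.+1) Lam (a b t : R) v :
  posdefmx Lam -> 0 < a -> 0 < b -> 0 < t -> 0 < normal_gamma_pdf mu Lam a b v t.
Proof.
move=> Lp a0 b0 t0; rewrite mulr_gt0 ?gamma_pdf_gt0//.
by rewrite mvnormal_pdf_gt0//; exact: posdefZ.
Qed.

Definition ln_normal_gamma_cst D (Lam : 'M[R]_D.+1) (a b : R) : R :=
  - (ln ((pi *+ 2) ^+ D.+1 / \det Lam) / 2) + ln (b `^ a / Gamma a).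

Lemma ln_normal_gamma_pdf D (mu : 'cV[R]_D.+1) Lam (a b t : R) v :
  posdefmx Lam -> 0 < a -> 0 < b -> 0 < t ->
  ln (normal_gamma_pdf mu Lam a b v t) =
  ln_normal_gamma_cst Lam a b + (D.+1%:R / 2 + a - 1) * ln t -
  t * (b + dot (v - mu) (Lam *m (v - mu)) / 2).
Proof.
move=> Lp a0 b0 t0; have tLp := posdefZ t0 Lp.
have p0 : 0 < pi *+ 2 :> R by rewrite mulrn_wgt0 ?pi_gt0.
have c0 : 0 < (pi *+ 2) ^+ D.+1 / \det Lam.
  by rewrite divr_gt0 ?exprn_gt0 ?det_posdef.
rewrite /normal_gamma_pdf lnM ?posrE ?mvnormal_pdf_gt0 ?gamma_pdf_gt0//.
rewrite ln_mvnormal_pdf// ln_gamma_pdf// -scalemxAl dotZr detZ.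
rewrite (_ : _ / (t ^+ D.+1 * _) = (pi *+ 2) ^+ D.+1 / \det Lam * t^-1 ^+ D.+1); last first.
  by rewrite invfM exprVn; ring.
rewrite ln_sqrt; last by rewrite mulr_gt0 ?exprn_gt0 ?invr_gt0.
rewrite lnM ?posrE ?exprn_gt0 ?invr_gt0// lnXn ?invr_gt0// lnV ?posrE//.
rewrite /ln_normal_gamma_cst -[(- ln t) *+ _]mulr_natr.
by move: (ln t) (ln _) (ln _) (dot _ _) => l l1 l2 q; field.
Qed.

Lemma dirichlet_pdf_gt0 K (alpha p : 'I_K -> R) : (0 < K)%N ->
  (forall k, 0 < alpha k) -> (forall k, 0 < p k) -> 0 < dirichlet_pdf alpha p.
Proof.
move=> K0 al0 p0; rewrite mulr_gt0//; last by rewrite prodr_gt0// => k _; rewrite powR_gt0.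
rewrite divr_gt0//; last by rewrite prodr_gt0// => k _; exact: Gamma_gt0.
rewrite Gamma_gt0// (bigD1 (Ordinal K0))//= ltr_pwDl//.
by apply: sumr_ge0 => k _; exact: ltW.
Qed.

Lemma ln_dirichlet_pdf K (alpha p : 'I_K -> R) : (0 < K)%N ->
  (forall k, 0 < alpha k) -> (forall k, 0 < p k) ->
  ln (dirichlet_pdf alpha p) =
  ln (Gamma (\sum_(k < K) alpha k) / (\prod_(k < K) Gamma (alpha k))) +
  \sum_(k < K) (alpha k - 1) * ln (p k).
Proof.
move=> K0 al0 p0; rewrite {1}/dirichlet_pdf [LHS]lnM ?posrE; last 2 first.
- rewrite divr_gt0//; last by rewrite prodr_gt0// => k _; exact: Gamma_gt0.
  rewrite Gamma_gt0// (bigD1 (Ordinal K0))//= ltr_pwDl//.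
  by apply: sumr_ge0 => k _; exact: ltW.
- by rewrite prodr_gt0// => k _; rewrite powR_gt0.
rewrite ln_prod; last by move=> k; rewrite powR_gt0.
by congr (_ + _); apply: eq_bigr => k _; rewrite ln_powR.
Qed.

End log_densities.

(** * Completing the square with matrix coefficients *)

Section completing_the_square.
Context {R : realType}.

Lemma posdef_unit m (A : 'M[R]_m) : posdefmx A -> A \in unitmx.
Proof. by move=> Ap; rewrite unitmxE unitfE gt_eqF// det_posdef. Qed.

Lemma posdefD m (A W : 'M[R]_m) : posdefmx A -> W^T = W ->
  (forall v, 0 <= dot v (W *m v)) -> posdefmx (A + W).
Proof.
move=> [As Ap] Ws Wp; split; first by rewrite linearD/= As Ws.
by move=> v v0; rewrite mulmxDl dotDr ltr_pwDl// Ap.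
Qed.

Lemma dot_symC m (A : 'M[R]_m) v w : A^T = A -> dot v (A *m w) = dot w (A *m v).
Proof. by move=> As; rewrite dot_mulmx As dotC. Qed.

Lemma dot_sqrB m (A : 'M[R]_m) v w : A^T = A ->
  dot (v - w) (A *m (v - w)) =
  dot v (A *m v) - 2 * dot v (A *m w) + dot w (A *m w).
Proof.
move=> As; rewrite mulmxBr !(dotDl, dotDr, dotNl, dotNr) (dot_symC w v As).
by ring.
Qed.

(** Here [A] is the prior precision, while [W] and [c] come from the data. Both sides have the same
    linear part in [v] because (A + W) mu' = A mu + c. *)
Lemma complete_square m (A W : 'M[R]_m) (mu c v : 'cV[R]_m) :
  A^T = A -> W^T = W -> A + W \in unitmx ->
  let mu' := invmx (A + W) *m (A *m mu + c) in
  dot (v - mu) (A *m (v - mu)) + dot v (W *m v) - 2 * dot v c =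
  dot (v - mu') ((A + W) *m (v - mu')) + dot mu (A *m mu) -
  dot mu' ((A + W) *m mu').
Proof.
move=> As Ws AWu mu'.
have AWs : (A + W)^T = A + W by rewrite linearD/= As Ws.
rewrite !dot_sqrB//.
have -> : dot v ((A + W) *m mu') = dot v (A *m mu) + dot v c.
  by rewrite mulmxA mulmxV// mul1mx dotDr.
rewrite [in X in _ = X - _ + _ + _ - _]mulmxDl dotDr.
by ring.
Qed.

End completing_the_square.

(** * Normal-gamma update for weighted linear regression *)

Section regression_update.
Context {R : realType}.
Variables (D n : nat) (x : int -> R).
Variables (S : finType) (r : S -> R) (Q : S -> 'I_n -> R).
Hypothesis r_ge0 : forall s, 0 <= r s.
Hypothesis Q_ge0 : forall s t, 0 <= Q s t.
Variables (mu : 'cV[R]_D.+1) (Lam : 'M[R]_D.+1) (a b : R).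
Hypothesis Lam_pos : posdefmx Lam.
Hypotheses (a_gt0 : 0 < a) (b_gt0 : 0 < b).

Let X := design D n x.
Let xv := xvec n x.
Let Qm s : 'M[R]_n := diag_mx (\row_t Q s t).
Let W := \sum_s r s *: (X^T *m Qm s *m X).
Let c := \sum_s r s *: (X^T *m Qm s *m xv).
(** Expected weight with which observation t belongs to the component at hand; every sum over nodes
    below reduces to a sum over t with these weights. *)
Let w t := \sum_s r s * Q s t.

(** The four updates are written so as to be convertible with the formulas of the theorem. *)
Definition Lam_upd := Lam + W.
Definition mu_upd := invmx Lam_upd *m (Lam *m mu + c).
Definition a_upd := a + 2^-1 * \sum_s r s * \tr (Qm s).
Definition b_upd := b + 2^-1 * (dot mu (Lam *m mu)
                + \sum_s r s * dot xv (Qm s *m xv)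
                - dot mu_upd (Lam_upd *m mu_upd)).

Lemma design_mul (v : 'cV[R]_D.+1) t : (X *m v) t 0 = dot (xtilde D x t) v.
Proof. by rewrite mxE dotE; apply: eq_bigr => i _; rewrite mxE. Qed.

Lemma dot_diag (d : 'I_n -> R) (u v : 'cV[R]_n) :
  dot u (diag_mx (\row_t d t) *m v) = \sum_t d t * u t 0 * v t 0.
Proof.
rewrite dotE; apply: eq_bigr => t _; rewrite mul_diag_mx !mxE; ring.
Qed.

Lemma weight_ge0 t : 0 <= w t.
Proof. by apply: sumr_ge0 => s _; exact: mulr_ge0. Qed.

Lemma quad_W v : dot v (W *m v) = \sum_t w t * dot (xtilde D x t) v ^+ 2.
Proof.
rewrite /W mulmx_suml dot_sumr; under eq_bigr => s _.
  rewrite -scalemxAl dotZr -!mulmxA dot_mulmx trmxK dot_diag.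
  under eq_bigr do rewrite design_mul.
  rewrite mulr_sumr; over.
rewrite exchange_big/=; apply: eq_bigr => t _.
by rewrite mulr_suml; apply: eq_bigr => s _; ring.
Qed.

Lemma dot_c v : dot v c = \sum_t w t * x t.+1%:Z * dot (xtilde D x t) v.
Proof.
rewrite /c dot_sumr; under eq_bigr => s _.
  rewrite dotZr -!mulmxA dot_mulmx trmxK dot_diag.
  under eq_bigr do rewrite design_mul mxE.
  rewrite mulr_sumr; over.
rewrite exchange_big/=; apply: eq_bigr => t _.
by rewrite !mulr_suml; apply: eq_bigr => s _; ring.
Qed.

Lemma quad_xv : \sum_s r s * dot xv (Qm s *m xv) = \sum_t w t * x t.+1%:Z ^+ 2.
Proof.
under eq_bigr => s _.
  rewrite dot_diag mulr_sumr; over.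
rewrite exchange_big/=; apply: eq_bigr => t _.
by rewrite mulr_suml; apply: eq_bigr => s _; rewrite !mxE; ring.
Qed.

Lemma sum_trQ : \sum_s r s * \tr (Qm s) = \sum_t w t.
Proof.
under eq_bigr => s _.
  rewrite mxtrace_diag mulr_sumr; over.
rewrite exchange_big/=; apply: eq_bigr => t _.
by apply: eq_bigr => s _; rewrite mxE.
Qed.

Lemma W_sym : W^T = W.
Proof.
rewrite /W raddf_sum/=; apply: eq_bigr => s _.
by rewrite linearZ/= !trmx_mul trmxK tr_diag_mx mulmxA.
Qed.

Lemma Lam_upd_pos : posdefmx Lam_upd.
Proof.
apply: posdefD => //; first exact: W_sym.
move=> v; rewrite quad_W; apply: sumr_ge0 => t _.
by rewrite mulr_ge0 ?weight_ge0 ?sqr_ge0.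
Qed.

(** This is where b' comes from: 2 (b' - b) is the constant left by completing the square, that is,
    the minimum over [v] of the prior form plus the weighted squared residuals. *)
Lemma regression_square v :
  dot (v - mu) (Lam *m (v - mu)) +
    \sum_t w t * (x t.+1%:Z - dot (xtilde D x t) v) ^+ 2 =
  dot (v - mu_upd) (Lam_upd *m (v - mu_upd)) + 2 * (b_upd - b).
Proof.
have := complete_square mu c v (proj1 Lam_pos) W_sym (posdef_unit Lam_upd_pos).
rewrite -/mu_upd -/Lam_upd /b_upd quad_xv quad_W dot_c => cs.
have -> : \sum_t w t * (x t.+1%:Z - dot (xtilde D x t) v) ^+ 2 =
    \sum_t w t * x t.+1%:Z ^+ 2 - 2 * (\sum_t w t * x t.+1%:Z * dot (xtilde D x t) v) +
    \sum_t w t * dot (xtilde D x t) v ^+ 2.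
  rewrite mulr_sumr -sumrB -big_split/=; apply: eq_bigr => t _; ring.
lra.
Qed.

Lemma a_upd_gt0 : 0 < a_upd.
Proof.
rewrite /a_upd sum_trQ ltr_pwDl// mulr_ge0//.
by apply: sumr_ge0 => t _; exact: weight_ge0.
Qed.

(* [b_upd - b] is half the value at [mu_upd] of a sum of squares. *)
Lemma b_upd_gt0 : 0 < b_upd.
Proof.
have := regression_square mu_upd; rewrite subrr mulmx0 dot0r add0r => E.
suff h : 0 <= b_upd - b by rewrite -(subrK b b_upd) ltr_wpDl.
suff : 0 <= 2 * (b_upd - b) by rewrite pmulr_rge0.
rewrite -E addr_ge0//.
  have [->|v0] := eqVneq (mu_upd - mu) 0; first by rewrite dot0l.
  by apply: ltW; case: Lam_pos => _; exact.
by apply: sumr_ge0 => t _; rewrite mulr_ge0 ?weight_ge0 ?sqr_ge0.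
Qed.

(** The term (D + 1)/2 ln tau of the Gaussian determinant is the same before and after the update,
    so a grows only by the 1/2 ln tau of each weighted observation. The terms linear in tau match by
    [regression_square]. *)
Lemma normal_gamma_update : exists C : R, forall th ta, 0 < ta ->
  ln (normal_gamma_pdf mu Lam a b th ta) +
    \sum_t w t * ln (normal1_pdf (dot (xtilde D x t) th) ta^-1 (x t.+1%:Z)) =
  ln (normal_gamma_pdf mu_upd Lam_upd a_upd b_upd th ta) + C.
Proof.
exists (ln_normal_gamma_cst Lam a b - ln_normal_gamma_cst Lam_upd a_upd b_upd
  - (\sum_t w t) * (ln (pi *+ 2) / 2)) => th ta ta0.
rewrite !ln_normal_gamma_pdf//; [|exact: Lam_upd_pos|exact: a_upd_gt0|exact: b_upd_gt0].
under eq_bigr do rewrite ln_normal1_pdf//.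
have -> : \sum_t w t * (- (ln (pi *+ 2) / 2) + ln ta / 2 -
      ta / 2 * (x t.+1%:Z - dot (xtilde D x t) th) ^+ 2) =
    (\sum_t w t) * (- (ln (pi *+ 2) / 2) + ln ta / 2) -
    ta / 2 * \sum_t w t * (x t.+1%:Z - dot (xtilde D x t) th) ^+ 2.
  by rewrite mulr_suml mulr_sumr -sumrB; apply: eq_bigr => t _; ring.
have := regression_square th.
have : a_upd = a + 2^-1 * \sum_t w t by rewrite /a_upd sum_trQ.
set q := dot (th - mu) _; set q' := dot (th - mu_upd) _.
set s := \sum_t w t * (_ ^+ 2).
move: a_upd q q' s b_upd (\sum_t w t) (ln_normal_gamma_cst Lam a b)
  (ln_normal_gamma_cst Lam_upd a_upd _) (ln ta) (ln (pi *+ 2)).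
move=> a' q q' s b' sw c1 c2 l lp -> E.
have -> : s = q' + 2 * (b' - b) - q by rewrite -E addrC addKr.
by field.
Qed.

End regression_update.

(** * Gaussian update for the logistic weights *)

Section logistic_update.
Context {R : realType}.
Variables (n : nat) (Q : 'I_n -> R) (v : 'I_n -> R) (xi : 'I_n -> R).
Hypothesis Q_ge0 : forall t, 0 <= Q t.
Variables (eta : 'cV[R]_2) (L : 'M[R]_2).
Hypothesis L_pos : posdefmx L.
Local Notation tt := (@ttilde R n).

Definition L_upd := L + 2 *: \sum_(t < n) (Q t * Defs.lambda (xi t)) *: (tt t *m (tt t)^T).
Definition eta_upd := invmx L_upd *m (L *m eta + \sum_(t < n) (Q t * (v t - 2^-1)) *: tt t).

Let W := 2 *: \sum_(t < n) (Q t * Defs.lambda (xi t)) *: (tt t *m (tt t)^T).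

Lemma quad_logistic be :
  dot be (W *m be) = 2 * \sum_t Q t * Defs.lambda (xi t) * dot be (tt t) ^+ 2.
Proof.
rewrite -scalemxAl dotZr mulmx_suml dot_sumr; congr (_ * _).
by apply: eq_bigr => t _; rewrite -scalemxAl dotZr dot_rank1 dotC.
Qed.

Lemma W_logistic_sym : W^T = W.
Proof.
rewrite /W linearZ/= raddf_sum/=; congr (_ *: _); apply: eq_bigr => t _.
by rewrite linearZ/= trmx_mul trmxK.
Qed.

Lemma L_upd_pos : posdefmx L_upd.
Proof.
apply: posdefD => //; first exact: W_logistic_sym.
move=> be; rewrite quad_logistic mulr_ge0//; apply: sumr_ge0 => t _.
by rewrite mulr_ge0 ?sqr_ge0// mulr_ge0// lambda_ge0.
Qed.

Lemma ln_h_loc bit be t y :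
  ln (h_loc bit be t y) = ln (sigmoid y) +
    (dot be (tt t) * bit%:R - 2^-1 * (dot be (tt t) + y)
     - Defs.lambda y * (dot be (tt t) ^+ 2 - y ^+ 2)).
Proof. by rewrite /h_loc lnM ?posrE ?sigmoid_gt0 ?expR_gt0// expRK. Qed.

Lemma h_loc_gt0 bit be t y : 0 < h_loc bit be (t : 'I_n) (y : R).
Proof. by rewrite /h_loc mulr_gt0 ?sigmoid_gt0 ?expR_gt0. Qed.

(** In the predictor y, ln h is quadratic with coefficients bit - 1/2 and - lambda. Averaging the
    bit gives v - 1/2; the factor 2 in [L_upd] compensates the 1/2 of the Gaussian exponent. *)
Lemma logistic_update : exists C : R, forall be,
  ln (mvnormal_pdf eta (invmx L) be) +
    \sum_t Q t * ((1 - v t) * ln (h_loc false be t (xi t)) +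
                  v t * ln (h_loc true be t (xi t))) =
  ln (mvnormal_pdf eta_upd (invmx L_upd) be) + C.
Proof.
eexists (- ln (Num.sqrt ((pi *+ 2) ^+ 2 / \det L)) +
   ln (Num.sqrt ((pi *+ 2) ^+ 2 / \det L_upd)) +
   \sum_t Q t * (ln (sigmoid (xi t)) - xi t / 2 + Defs.lambda (xi t) * xi t ^+ 2)
   - 2^-1 * (dot eta (L *m eta) - dot eta_upd (L_upd *m eta_upd))) => be.
rewrite !ln_mvnormal_pdf//; last exact: L_upd_pos.
pose c := \sum_(t < n) (Q t * (v t - 2^-1)) *: tt t.
have : dot (be - eta) (L *m (be - eta)) +
    2 * (\sum_t Q t * Defs.lambda (xi t) * dot be (tt t) ^+ 2) - 2 * dot be c =
    dot (be - eta_upd) (L_upd *m (be - eta_upd)) + dot eta (L *m eta) -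
    dot eta_upd (L_upd *m eta_upd).
  rewrite -quad_logistic.
  exact: (complete_square eta c be (proj1 L_pos) W_logistic_sym (posdef_unit L_upd_pos)).
rewrite /c dot_sumr.
have -> : \sum_t Q t * ((1 - v t) * ln (h_loc false be t (xi t)) +
                  v t * ln (h_loc true be t (xi t))) =
   \sum_t Q t * (ln (sigmoid (xi t)) - xi t / 2 + Defs.lambda (xi t) * xi t ^+ 2) +
   \sum_t dot be ((Q t * (v t - 2^-1)) *: tt t) -
   \sum_t Q t * Defs.lambda (xi t) * dot be (tt t) ^+ 2.
  rewrite -big_split/= -sumrB; apply: eq_bigr => t _.
  by rewrite !ln_h_loc dotZr/=; field.
set s1 := \sum_t _ * (_ - _ + _); set s2 := \sum_t dot be _.
set s3 := \sum_t _ * dot be _ ^+ 2.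
set q1 := dot (be - eta) _; set q2 := dot (be - eta_upd) _.
set q3 := dot eta _; set q4 := dot eta_upd _.
set l1 := ln _; set l2 := ln _.
move: s1 s2 s3 q1 q2 q3 q4 l1 l2 => s1 s2 s3 q1 q2 q3 q4 l1 l2 E.
have -> : q1 = q2 + q3 - q4 + 2 * s2 - 2 * s3 by rewrite -E; ring.
by field.
Qed.

End logistic_update.

(** * The update of xi *)

Section integral_value.
Context d (T : measurableType d) (R : realType) (mu : {measure set T -> \bar R}).
Implicit Types f g : T -> R.

(** Integrability travels with the value because the real-valued integral is used on signed sums,
    where linearity depends on it. *)
Definition has_integral f (v : R) : Prop :=
  mu.-integrable setT (EFin \o f) /\ \int[mu]_x f x = v.

Lemma has_integral_ge0 f v : measurable_fun setT f -> (forall x, 0 <= f x) ->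
  (\int[mu]_x (f x)%:E = v%:E)%E -> has_integral f v.
Proof.
move=> mf f0 fv; split; last by rewrite /Rintegral fv.
apply/integrableP; split; first exact/measurable_EFinP.
under eq_integral => x _ do rewrite /= ger0_norm//.
by rewrite fv ltry.
Qed.

Lemma has_integralD f g v w : has_integral f v -> has_integral g w ->
  has_integral (fun x => f x + g x) (v + w).
Proof.
move=> [fi fv] [gi gw]; split; last by rewrite RintegralD// fv gw.
exact: (integrableD measurableT fi gi).
Qed.

Lemma has_integralZ f v k : has_integral f v -> has_integral (fun x => k * f x) (k * v).
Proof.
move=> [fi fv]; split; last by rewrite RintegralZl// fv.
exact: (integrableZl measurableT k fi).
Qed.

Lemma has_integral_sum (I : Type) (r : seq I) (f : I -> T -> R) (v : I -> R) :
  (forall i, has_integral (f i) (v i)) ->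
  has_integral (fun x => \sum_(i <- r) f i x) (\sum_(i <- r) v i).
Proof.
move=> fv; elim: r => [|i r IHr].
  rewrite big_nil; under eq_fun do rewrite big_nil.
  by apply: has_integral_ge0 => //; rewrite integral0.
rewrite big_cons; under eq_fun do rewrite big_cons.
exact: has_integralD.
Qed.

End integral_value.

(** * The expected logarithm of the local bound as a function of xi *)

Section variational_bound.
Context {R : realType}.
Variables (Dmax n : nat) (varpi : 'I_n -> inode Dmax -> bool -> R).
Hypothesis varpi_ge0 : forall t s u, 0 <= varpi t s u.
Variables (eta : inode Dmax -> 'cV[R]_2) (L : inode Dmax -> 'M[R]_2).
Hypothesis L_pos : forall s, posdefmx (L s).
Local Notation B := (fun w => Defs.beta_pdf eta L (beta_of w)).
Local Notation tt := (@ttilde R n).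
Local Notation y s t := (fun w : #|inode Dmax|.-tuple (2.-tuple (measurableTypeR R)) =>
  dot (beta_of w s) (tt t)).

Definition second_moment s t : R :=
  dot (tt t) ((invmx (L s) + eta s *m (eta s)^T) *m tt t).

Lemma second_momentE s t :
  second_moment s t = dot (tt t) (invmx (L s) *m tt t) + (dot (tt t) (eta s)) ^+ 2.
Proof. by rewrite /second_moment mulmxDl dotDr dot_rank1 (dotC (eta s)). Qed.

Lemma measurable_beta_dot s t : measurable_fun setT (y s t).
Proof.
apply: measurable_dot => i //.
by apply: (measurableT_comp (measurable_vec i)); exact: measurable_tnth.
Qed.

Lemma integral_beta_sqr s t (e : R) :
  (\int[@beta_mu R Dmax]_w (B w * (y s t w + e) ^+ 2)%:E =
   (dot (tt t) (invmx (L s) *m tt t) + (dot (tt t) (eta s) + e) ^+ 2)%:E)%E.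
Proof.
(* The square rides on the factor of node [s] only; the other factors have mass 1. *)
pose f (i : 'I_#|inode Dmax|) (v : 2.-tuple (measurableTypeR R)) : R :=
  mvnormal_pdf (eta (enum_val i)) (invmx (L (enum_val i))) (vec v) *
  (if i == enum_rank s then (dot (tt t) (vec v) + e) ^+ 2 else 1).
have -> : (\int[@beta_mu R Dmax]_w (B w * (y s t w + e) ^+ 2)%:E =
    \int[@beta_mu R Dmax]_w (\prod_i f i (tnth w i))%:E)%E.
  apply: eq_integral => w _; congr EFin; rewrite beta_pdf_enum /f [RHS]big_split/=.
  congr (_ * _); rewrite (bigD1 (enum_rank s))//= eqxx big1 ?mulr1.
    by rewrite dotC.
  by move=> i /negbTE ->.
rewrite /beta_mu (@integral_power_prod _ _ R (lebesgue_pow 2) _ f); last 2 first.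
- move=> i; apply: measurable_funM; first exact: measurable_mvnormal_pdf.
  case: (i == enum_rank s); last exact: measurable_cst.
  apply: measurable_funX; apply: measurable_funD => //.
  by apply: measurable_dot => // j; exact: measurable_vec.
- move=> i v; apply: mulr_ge0; first by rewrite ltW// mvnormal_pdf_gt0.
  by case: (i == _) => //; exact: sqr_ge0.
rewrite (bigD1 (enum_rank s))//= [X in (_ * X)%E]big1 ?mule1.
  rewrite /f; under eq_integral do rewrite eqxx enum_rankK.
  exact: integral_mvnormal_sqr.
move=> i /negbTE iE; rewrite /f iE; under eq_integral do rewrite mulr1.
exact: integral_mvnormal.
Qed.

Lemma has_integral_beta1 : has_integral (@beta_mu R Dmax) B 1.
Proof.
apply: has_integral_ge0; [exact: measurable_beta_pdf| |exact: integral_beta_pdf].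
by move=> w; rewrite ltW// beta_pdf_gt0.
Qed.

Lemma has_integral_beta_sqr s t e :
  has_integral (@beta_mu R Dmax) (fun w => B w * (y s t w + e) ^+ 2)
    (dot (tt t) (invmx (L s) *m tt t) + (dot (tt t) (eta s) + e) ^+ 2).
Proof.
apply: has_integral_ge0; last exact: integral_beta_sqr.
- apply: measurable_funM; first exact: measurable_beta_pdf.
  by apply: measurable_funX; apply: measurable_funD => //; exact: measurable_beta_dot.
- by move=> w; rewrite mulr_ge0 ?sqr_ge0// ltW// beta_pdf_gt0.
Qed.

(* Polarization: a quadratic polynomial in [y] is a combination of [(y + 1)^2], [y^2], [1]. *)
Lemma has_integral_beta_quad s t (k l m : R) :
  has_integral (@beta_mu R Dmax)
    (fun w => B w * (k + l * y s t w + m * y s t w ^+ 2))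
    (k + l * dot (tt t) (eta s) + m * second_moment s t).
Proof.
have := has_integralD (has_integralD
  (has_integralZ (k - l / 2) has_integral_beta1)
  (has_integralZ (l / 2) (has_integral_beta_sqr s t 1)))
  (has_integralZ (m - l / 2) (has_integral_beta_sqr s t 0)).
rewrite (_ : (fun x => _) = (fun w => B w * (k + l * y s t w + m * y s t w ^+ 2))); last first.
  by apply/funext => w; field.
rewrite (_ : (_ + _) = k + l * dot (tt t) (eta s) + m * second_moment s t)//.
by rewrite second_momentE; field.
Qed.

Lemma ln_h_bound (u : inputs Dmax n) beta (xi : inode Dmax -> 'I_n -> R) :
  ln (h_bound u beta xi) =
  \sum_t \sum_(s : inode Dmax) (preceq (val s) (leaf_of (u t)))%:R *
    ln (h_loc (tnth (u t) (inode_depth s)) (beta s) t (xi s t)).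
Proof.
rewrite /h_bound ln_prod; last first.
  by move=> t; apply: prodr_gt0 => s _; rewrite exprn_gt0// h_loc_gt0.
apply: eq_bigr => t _; rewrite ln_prod; last first.
  by move=> s; rewrite exprn_gt0// h_loc_gt0.
by apply: eq_bigr => s _; rewrite lnXn ?h_loc_gt0// mulr_natl.
Qed.

(** The last summand is free of xi and cancels when two choices of xi are compared. *)
Lemma integral_ln_h_bound (u : inputs Dmax n) (xi : inode Dmax -> 'I_n -> R) :
  \int[@beta_mu R Dmax]_w (B w * ln (h_bound u (beta_of w) xi)) =
  \sum_t \sum_(s : inode Dmax) (preceq (val s) (leaf_of (u t)))%:R *
   (logistic_potential (xi s t) - Defs.lambda (xi s t) * (second_moment s t - xi s t ^+ 2) +
    ((tnth (u t) (inode_depth s))%:R - 2^-1) * dot (tt t) (eta s)).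
Proof.
pose f (t : 'I_n) (s : inode Dmax)
    (w : #|inode Dmax|.-tuple (2.-tuple (measurableTypeR R))) : R :=
  (preceq (val s) (leaf_of (u t)))%:R * (B w * ((logistic_potential (xi s t) + Defs.lambda (xi s t) * xi s t ^+ 2) +
     ((tnth (u t) (inode_depth s))%:R - 2^-1) * y s t w +
     (- Defs.lambda (xi s t)) * y s t w ^+ 2)).
have -> : (fun w => B w * ln (h_bound u (beta_of w) xi)) =
    (fun w => \sum_t \sum_(s : inode Dmax) f t s w).
  apply/funext => w; rewrite ln_h_bound mulr_sumr; apply: eq_bigr => t _.
  rewrite mulr_sumr; apply: eq_bigr => s _; rewrite ln_h_loc /f /logistic_potential.
  by field.
have [_ ->] := has_integral_sum (index_enum _) (fun t =>
  has_integral_sum (index_enum _) (fun s =>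
   has_integralZ (preceq (val s) (leaf_of (u t)))%:R (has_integral_beta_quad s t
    (logistic_potential (xi s t) + Defs.lambda (xi s t) * xi s t ^+ 2)
    ((tnth (u t) (inode_depth s))%:R - 2^-1) (- Defs.lambda (xi s t))))).
apply: eq_bigr => t _; apply: eq_bigr => s _; congr (_ * _); ring.
Qed.

(** The value is read off from the integral of a nonnegative function, which spares an analysis of
    the inverse matrix. *)
Lemma second_moment_ge0 s t : 0 <= second_moment s t.
Proof.
rewrite second_momentE -lee_fin -[X in (X ^+ 2)]addr0 -integral_beta_sqr.
by apply: integral_ge0 => w _; rewrite lee_fin mulr_ge0 ?sqr_ge0// ltW// beta_pdf_gt0.
Qed.

Lemma E_ln_h_max (xi : inode Dmax -> 'I_n -> R) :
  E_ln_h varpi eta L xi <= E_ln_h varpi eta L (fun s t => Num.sqrt (second_moment s t)).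
Proof.
apply: ler_sum => u _; apply: ler_wpM2l.
  apply: prodr_ge0 => t _; apply: prodr_ge0 => s _; apply: prodr_ge0 => b _.
  exact: exprn_ge0.
rewrite !integral_ln_h_bound; apply: ler_sum => t _; apply: ler_sum => s _.
apply: ler_wpM2l => //; rewrite lerD2r.
have m0 := second_moment_ge0 s t.
rewrite sqr_sqrtr// subrr mulr0 subr0.
(* At the new xi the term with [lambda] has vanished; what remains is the tangent bound at y = sqrt
   of the second moment, term by term in u, t and s. *)
by rewrite -[X in _ * (X - _)](sqr_sqrtr m0); exact: logistic_potential_bound.
Qed.

End variational_bound.

(** * The posterior *)

Section expected_log_joint.
Context {R : realType}.
Variables (Dmax K D n : nat).
Variables (x : int -> R) (g : node Dmax -> R) (alpha : 'I_K -> R).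
Variables (mu : 'cV[R]_D.+1) (Lam : 'M[R]_D.+1) (a b : R).
Variables (eta : inode Dmax -> 'cV[R]_2) (L : inode Dmax -> 'M[R]_2).
Variables (varpi : 'I_n -> inode Dmax -> bool -> R).
Variables (qT : tree Dmax -> R) (pi' : node Dmax -> 'I_K -> R).
Variables (xi : inode Dmax -> 'I_n -> R).
Hypothesis K_gt0 : (0 < K)%N.
Hypothesis alpha_gt0 : forall k, 0 < alpha k.
Hypothesis Lam_pos : posdefmx Lam.
Hypotheses (a_gt0 : 0 < a) (b_gt0 : 0 < b).
Hypothesis L_pos : forall s, posdefmx (L s).
Hypothesis varpi_ge0 : forall t s u, 0 <= varpi t s u.
Hypothesis varpi_sum : forall t s, varpi t s false + varpi t s true = 1.
Hypothesis qT_ge0 : forall T, 0 <= qT T.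
Hypothesis qT_sum : \sum_(T : tree Dmax) qT T = 1.
Hypothesis pi'_ge0 : forall s k, 0 <= pi' s k.
Hypothesis pi'_sum : forall s, \sum_(k < K) pi' s k = 1.

Section at_point.
Variables (theta : 'I_K -> 'cV[R]_D.+1) (tau p : 'I_K -> R).
Variable beta : inode Dmax -> 'cV[R]_2.
Hypothesis adm : admissible theta tau p beta.

Let lnN (t : 'I_n) k : R :=
  ln (normal1_pdf (dot (xtilde D x t) (theta k)) (tau k)^-1 (x t.+1%:Z)).
Let prec s (u : inputs Dmax n) (t : 'I_n) : R := (preceq s (leaf_of (u t)))%:R.
Let lnh (s : inode Dmax) (t : 'I_n) (bit : bool) : R :=
  ln (h_loc bit (beta s) t (xi s t)).

Lemma ln_p_x_p_z u (T : tree Dmax) (z : assignment K T) :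
  ln (p_x x u z theta tau * p_z p z) =
  \sum_(s : tree_leaf T) \sum_(k < K) (entry z s k)%:R *
    (\sum_t prec (val s) u t * lnN t k + ln (p k)).
Proof.
have [tau0 [p0 _]] := adm.
have N0 t k m : 0 < normal1_pdf (dot (xtilde D x t) (theta k)) (tau k)^-1 (x t.+1%:Z) ^+ m.
  by rewrite exprn_gt0// normal1_pdf_gt0.
rewrite lnM ?posrE; last 2 first.
- by apply: prodr_gt0 => t _; apply: prodr_gt0 => s _; apply: prodr_gt0.
- by apply: prodr_gt0 => s _; apply: prodr_gt0 => k _; rewrite exprn_gt0.
rewrite /p_x ln_prod; last first.
  by move=> t; apply: prodr_gt0 => s _; apply: prodr_gt0.
have -> : \sum_(t < n) ln (\prod_(s : tree_leaf T) \prod_(k < K)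
      normal1_pdf (dot (xtilde D x t) (theta k)) (tau k)^-1 (x t.+1%:Z)
      ^+ (entry z s k * preceq (val s) (leaf_of (u t)))) =
    \sum_(s : tree_leaf T) \sum_(k < K) \sum_(t < n)
      (entry z s k)%:R * (prec (val s) u t * lnN t k).
  under eq_bigr => t _.
    rewrite ln_prod; last by move=> s; apply: prodr_gt0.
    under eq_bigr => s _.
      rewrite ln_prod//.
      under eq_bigr => k _.
        rewrite lnXn ?normal1_pdf_gt0// -mulr_natl natrM -mulrA -/(lnN t k); over.
      over.
    over.
  rewrite exchange_big/=; apply: eq_bigr => s _.
  by rewrite exchange_big.
rewrite /p_z ln_prod; last by move=> s; apply: prodr_gt0 => k _; rewrite exprn_gt0.
rewrite -big_split/=; apply: eq_bigr => s _.
rewrite ln_prod; last by move=> k; rewrite exprn_gt0.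
rewrite -big_split/=; apply: eq_bigr => k _.
by rewrite lnXn// mulrDr mulr_sumr mulr_natl.
Qed.

Lemma ln_jointD u (T : tree Dmax) (z : assignment K T) :
  ln_joint x g alpha mu Lam a b eta L xi theta tau p beta u z =
  \sum_(s : tree_leaf T) \sum_(k < K) (entry z s k)%:R *
    (\sum_t prec (val s) u t * lnN t k + ln (p k)) +
  (ln (dirichlet_pdf alpha p) +
   \sum_(k < K) ln (normal_gamma_pdf mu Lam a b (theta k) (tau k)) +
   \sum_(s : inode Dmax) ln (mvnormal_pdf (eta s) (invmx (L s)) (beta s)) +
   \sum_t \sum_(s : inode Dmax) prec (val s) u t * lnh s t (tnth (u t) (inode_depth s))) +
  ln (p_T g T).
Proof.
have [tau0 [p0 _]] := adm.
rewrite /ln_joint; congr (_ + _).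
have A0 : 0 < p_x x u z theta tau * p_z p z.
  rewrite mulr_gt0//.
    apply: prodr_gt0 => t _; apply: prodr_gt0 => s _; apply: prodr_gt0 => k _.
    by rewrite exprn_gt0// normal1_pdf_gt0.
  by apply: prodr_gt0 => s _; apply: prodr_gt0 => k _; rewrite exprn_gt0.
have B0 := dirichlet_pdf_gt0 K_gt0 alpha_gt0 p0.
have C0 : 0 < p_theta_tau mu Lam a b theta tau.
  by apply: prodr_gt0 => k _; exact: normal_gamma_pdf_gt0.
have H0 : 0 < h_bound u beta xi.
  by apply: prodr_gt0 => t _; apply: prodr_gt0 => s _; rewrite exprn_gt0// h_loc_gt0.
have F0 : 0 < Defs.beta_pdf eta L beta by exact: beta_pdf_gt0.
rewrite -ln_p_x_p_z -ln_h_bound.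
have -> : \sum_(k < K) ln (normal_gamma_pdf mu Lam a b (theta k) (tau k)) =
    ln (p_theta_tau mu Lam a b theta tau).
  by rewrite /p_theta_tau ln_prod// => k; exact: normal_gamma_pdf_gt0.
have -> : \sum_(s : inode Dmax) ln (mvnormal_pdf (eta s) (invmx (L s)) (beta s)) =
    ln (Defs.beta_pdf eta L beta).
  by rewrite /Defs.beta_pdf ln_prod// => s; exact: mvnormal_pdf_gt0.
move: A0 B0 C0 H0 F0.
move: (p_x _ _ _ _ _ * _) (dirichlet_pdf _ _) (p_theta_tau _ _ _ _ _ _) (h_bound _ _ _)
  (Defs.beta_pdf _ _ _) => A B C H F A0 B0 C0 H0 F0.
rewrite !lnM ?posrE ?mulr_gt0//; ring.
Qed.

Lemma E_ln_joint :
  E_u varpi (fun u => E_zT qT pi' (fun T z =>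
    ln_joint x g alpha mu Lam a b eta L xi theta tau p beta u z)) =
  \sum_(s : node Dmax) \sum_(k < K) q_leaf qT s * pi' s k *
    (\sum_t q_prec varpi s t * lnN t k + ln (p k)) +
  (ln (dirichlet_pdf alpha p) +
   \sum_(k < K) ln (normal_gamma_pdf mu Lam a b (theta k) (tau k)) +
   \sum_(s : inode Dmax) ln (mvnormal_pdf (eta s) (invmx (L s)) (beta s)) +
   \sum_t \sum_(s : inode Dmax) q_prec varpi (val s) t *
     (varpi t s false * lnh s t false + varpi t s true * lnh s t true)) +
  E_zT qT pi' (fun T (_ : assignment K T) => ln (p_T g T)).
Proof.
set B := ln (dirichlet_pdf alpha p) + _ + _.
(* The inner expectation is taken at fixed u: there only the leaf sum and ln p(T) depend on z and T,
   and the rest is constant. *)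
transitivity (E_u varpi (fun u => (\sum_(s : node Dmax) \sum_(k < K) q_leaf qT s * pi' s k *
    (\sum_t prec s u t * lnN t k + ln (p k)) +
  (B + \sum_t \sum_(s : inode Dmax) prec (val s) u t * lnh s t (tnth (u t) (inode_depth s)))) +
  E_zT qT pi' (fun T (_ : assignment K T) => ln (p_T g T)))).
  congr (E_u _ _); apply/funext => u.
  rewrite -(E_zT_leaf qT pi'_sum (fun s k => \sum_t prec s u t * lnN t k + ln (p k))).
  rewrite -[X in _ + X + _](E_zT_cst qT_sum pi'_sum) -!E_zTD.
  apply: eq_bigr => T _; apply: eq_bigr => z _; congr (_ * _).
  by rewrite ln_jointD.
clearbody B; rewrite !E_uD E_u_cst// E_u_cst//; congr (_ + (_ + _) + _).
  rewrite E_u_sum; apply: eq_bigr => s _.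
  rewrite E_u_sum; apply: eq_bigr => k _.
  rewrite E_uZ E_uD E_u_cst//; congr (_ * (_ + _)).
  rewrite E_u_sum; apply: eq_bigr => t _.
  rewrite [RHS]mulrC -(E_u_prec varpi_sum) -E_uZ; congr (E_u _ _).
  by apply/funext => u; rewrite mulrC.
rewrite E_u_sum; apply: eq_bigr => t _.
rewrite E_u_sum; apply: eq_bigr => s _.
exact: E_u_branch.
Qed.

End at_point.

Let r k s := q_leaf qT s * pi' s k.
Let Qr s t := q_prec varpi s t.
Let Qi (s : inode Dmax) t := q_prec varpi (val s) t.
Definition alpha_upd k := alpha k + \sum_(s : node Dmax) r k s.
Let Lam' k := Lam_upd x (r k) Qr Lam.
Let mu' k := mu_upd x (r k) Qr mu Lam.
Let a' k := a_upd (r k) Qr a.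
Let b' k := b_upd x (r k) Qr mu Lam b.
Let L' s := L_upd (Qi s) (xi s) (L s).
Let eta' s := eta_upd (Qi s) (fun t => varpi t s true) (xi s) (eta s) (L s).

Lemma leaf_weight_ge0 k s : 0 <= r k s.
Proof. by rewrite mulr_ge0// sumr_ge0// => T _; rewrite mulr_ge0. Qed.

Lemma alpha_upd_gt0 k : 0 < alpha_upd k.
Proof. by rewrite ltr_pwDl// sumr_ge0// => s _; exact: leaf_weight_ge0. Qed.

Lemma expected_ln_joint_posterior : exists C : R, forall theta tau p beta,
  admissible theta tau p beta ->
  E_u varpi (fun u => E_zT qT pi' (fun T z =>
    ln_joint x g alpha mu Lam a b eta L xi theta tau p beta u z)) =
  ln (posterior alpha_upd mu' Lam' a' b' eta' L' theta tau p beta) + C.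
Proof.
have Qr0 s t : 0 <= Qr s t by exact: q_prec_ge0.
have Qi0 s t : 0 <= Qi s t by exact: q_prec_ge0.
(* Each component k and each node s brings its own constant; [choice] collects them so that they can
   be summed. *)
have [C1 C1E] := choice (fun k => normal_gamma_update x (leaf_weight_ge0 k) Qr0 mu Lam_pos a_gt0 b_gt0).
have [C2 C2E] := choice (fun s => logistic_update (fun t => varpi t s true) (xi s)
  (Qi0 s) (eta s) (L_pos s)).
(* Besides the constants of the conjugate updates, this contains the ratio of the Dirichlet
   normalizers before and after the update, and the expectation of ln p(T). *)
eexists (\sum_k C1 k + \sum_s C2 s +
  (ln (Gamma (\sum_(k < K) alpha k) / (\prod_(k < K) Gamma (alpha k))) -
   ln (Gamma (\sum_(k < K) alpha_upd k) / (\prod_(k < K) Gamma (alpha_upd k)))) +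
  E_zT qT pi' (fun T (_ : assignment K T) => ln (p_T g T))) => theta tau p beta adm.
rewrite E_ln_joint// [RHS]addrA; congr (_ + _).
have [tau0 [p0 _]] := adm.
have Lp k : posdefmx (Lam' k) by apply: Lam_upd_pos => //; exact: leaf_weight_ge0.
have ap k : 0 < a' k by apply: a_upd_gt0 => //; exact: leaf_weight_ge0.
have bp k : 0 < b' k by apply: b_upd_gt0 => //; exact: leaf_weight_ge0.
have L'p s : posdefmx (L' s) by exact: L_upd_pos.
have -> : ln (posterior alpha_upd mu' Lam' a' b' eta' L' theta tau p beta) =
    ln (dirichlet_pdf alpha_upd p) +
    \sum_k ln (normal_gamma_pdf (mu' k) (Lam' k) (a' k) (b' k) (theta k) (tau k)) +
    \sum_s ln (mvnormal_pdf (eta' s) (invmx (L' s)) (beta s)).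
  have B0 := dirichlet_pdf_gt0 K_gt0 alpha_upd_gt0 p0.
  have N0 k : 0 < normal_gamma_pdf (mu' k) (Lam' k) (a' k) (b' k) (theta k) (tau k).
    exact: normal_gamma_pdf_gt0.
  have F0 : 0 < Defs.beta_pdf eta' L' beta by exact: beta_pdf_gt0.
  rewrite /posterior lnM ?posrE//; last by rewrite mulr_gt0// prodr_gt0.
  rewrite lnM ?posrE ?prodr_gt0// ln_prod//; congr (_ + _).
  by rewrite /Defs.beta_pdf ln_prod// => s; exact: mvnormal_pdf_gt0.
have -> : \sum_k ln (normal_gamma_pdf (mu' k) (Lam' k) (a' k) (b' k) (theta k) (tau k)) =
   \sum_k (ln (normal_gamma_pdf mu Lam a b (theta k) (tau k)) +
    \sum_t (\sum_s r k s * Qr s t) *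
      ln (normal1_pdf (dot (xtilde D x t) (theta k)) (tau k)^-1 (x t.+1%:Z))) -
   \sum_k C1 k.
  by rewrite -sumrB; apply: eq_bigr => k _; rewrite C1E// addrK.
have -> : \sum_s ln (mvnormal_pdf (eta' s) (invmx (L' s)) (beta s)) =
   \sum_s (ln (mvnormal_pdf (eta s) (invmx (L s)) (beta s)) +
    \sum_t Qi s t * ((1 - varpi t s true) * ln (h_loc false (beta s) t (xi s t)) +
                  varpi t s true * ln (h_loc true (beta s) t (xi s t)))) -
   \sum_s C2 s.
  by rewrite -sumrB; apply: eq_bigr => s _; rewrite C2E// addrK.
rewrite !ln_dirichlet_pdf//; last exact: alpha_upd_gt0.
(* The expected count of component k adds to the exponent of p_k: this is the Dirichlet update. *)
have -> : \sum_(k < K) (alpha_upd k - 1) * ln (p k) =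
    \sum_(k < K) (alpha k - 1) * ln (p k) + \sum_(k < K) (\sum_s r k s) * ln (p k).
  by rewrite -big_split/=; apply: eq_bigr => k _; rewrite /alpha_upd; ring.
move: (ln (Gamma (\sum_(k < K) alpha_upd k) / _)) (ln (Gamma (\sum_(k < K) alpha k) / _)).
move=> g2 g1; rewrite !big_split/=.
have -> : \sum_s \sum_(k < K) q_leaf qT s * pi' s k *
     (\sum_t q_prec varpi s t *
        ln (normal1_pdf (dot (xtilde D x t) (theta k)) (tau k)^-1 (x t.+1%:Z)) + ln (p k)) =
   \sum_(k < K) \sum_t (\sum_s r k s * Qr s t) *
      ln (normal1_pdf (dot (xtilde D x t) (theta k)) (tau k)^-1 (x t.+1%:Z)) +
   \sum_(k < K) (\sum_s r k s) * ln (p k).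
  rewrite exchange_big/= -big_split/=; apply: eq_bigr => k _.
  rewrite mulr_suml; under [X in _ = X + _]eq_bigr do rewrite mulr_suml.
  rewrite exchange_big/= -big_split/=; apply: eq_bigr => s _.
  rewrite mulrDr mulr_sumr; congr (_ + _); apply: eq_bigr => t _.
  by rewrite mulrA.
have -> : \sum_t \sum_(s : inode Dmax) q_prec varpi (val s) t *
     (varpi t s false * ln (h_loc false (beta s) t (xi s t)) +
      varpi t s true * ln (h_loc true (beta s) t (xi s t))) =
   \sum_(s : inode Dmax) \sum_t Qi s t *
     ((1 - varpi t s true) * ln (h_loc false (beta s) t (xi s t)) +
                  varpi t s true * ln (h_loc true (beta s) t (xi s t))).
  rewrite exchange_big/=; apply: eq_bigr => s _; apply: eq_bigr => t _.
  by rewrite -(varpi_sum t s) addrK.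
move: (\sum_k C1 k) (\sum_s C2 s) => c1 c2.
move: (\sum_(k < K) (alpha k - 1) * _) (\sum_(k < K) (\sum_s r k s) * _) => s1 s2.
ring.
Qed.

Lemma posterior_of_ln q c : is_prob_density q ->
  (forall theta tau p beta, admissible theta tau p beta ->
     0 < q theta tau p beta /\
     ln (q theta tau p beta) =
       E_u varpi (fun u => E_zT qT pi' (fun T z =>
         ln_joint x g alpha mu Lam a b eta L xi theta tau p beta u z)) + c) ->
  forall theta tau p beta, admissible theta tau p beta ->
    q theta tau p beta = posterior alpha_upd mu' Lam' a' b' eta' L' theta tau p beta.
Proof.
move=> qd q_def; have [C CE] := expected_ln_joint_posterior.
have Qr0 s t : 0 <= Qr s t by exact: q_prec_ge0.
have Lp k : posdefmx (Lam' k) by apply: Lam_upd_pos => //; exact: leaf_weight_ge0.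
have ap k : 0 < a' k by apply: a_upd_gt0 => //; exact: leaf_weight_ge0.
have bp k : 0 < b' k by apply: b_upd_gt0 => //; exact: leaf_weight_ge0.
have L'p s : posdefmx (L' s) by apply: L_upd_pos => // t; exact: q_prec_ge0.
(* Both sides are positive at admissible points, so the equation between logarithms becomes
   proportionality with factor exp(C + c). *)
have qE theta tau p beta : admissible theta tau p beta ->
    q theta tau p beta =
    expR (C + c) * posterior alpha_upd mu' Lam' a' b' eta' L' theta tau p beta.
  move=> adm; have [q0 lnq] := q_def _ _ _ _ adm.
  have P0 : 0 < posterior alpha_upd mu' Lam' a' b' eta' L' theta tau p beta.
    have [tau0 [p0 _]] := adm.
    apply: mulr_gt0; last exact: beta_pdf_gt0.
    apply: mulr_gt0; first exact: (dirichlet_pdf_gt0 K_gt0 alpha_upd_gt0 p0).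
    by apply: prodr_gt0 => k _; exact: normal_gamma_pdf_gt0.
  apply: ln_inj.
  - by rewrite posrE.
  - by rewrite posrE; apply: mulr_gt0; [exact: expR_gt0|].
  - rewrite lnM ?posrE; [|exact: expR_gt0|exact: P0].
    rewrite expRK lnq (CE _ _ _ _ adm). by rewrite -addrA addrC.
have C1 := prob_density_proportional K_gt0 alpha_upd_gt0 Lp ap bp L'p (expR_ge0 _) qd qE.
by move=> theta tau p beta adm; rewrite qE// C1 mul1r.
Qed.

End expected_log_joint.
Unset Implicit Arguments.

Theorem lemma3 (R : realType) (Dmax K D n : nat)
  (x : int -> R) (g : node Dmax -> R) (alpha : 'I_K -> R)
  (mu : 'cV[R]_D.+1) (Lam : 'M[R]_D.+1) (a b : R)
  (eta : inode Dmax -> 'cV[R]_2) (L : inode Dmax -> 'M[R]_2)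
  (varpi : 'I_n -> inode Dmax -> bool -> R)
  (qT : tree Dmax -> R) (pi' : node Dmax -> 'I_K -> R)
  (xi : inode Dmax -> 'I_n -> R)
  (q : ('I_K -> 'cV[R]_D.+1) -> ('I_K -> R) -> ('I_K -> R) ->
       (inode Dmax -> 'cV[R]_2) -> R) (c : R)
  (Dmax_gt0 : (0 < Dmax)%N) (K_gt0 : (0 < K)%N)
  (g01 : forall s, 0 <= g s <= 1)
  (g_leaf : forall s, ~~ is_inner s -> g s = 0)
  (alpha_gt0 : forall k, 0 < alpha k)
  (Lam_pos : posdefmx Lam) (a_gt0 : 0 < a) (b_gt0 : 0 < b)
  (L_pos : forall s, posdefmx (L s))
  (varpi_ge0 : forall t s u, 0 <= varpi t s u)
  (varpi_sum : forall t s, varpi t s false + varpi t s true = 1)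
  (qT_ge0 : forall T, 0 <= qT T) (qT_sum : \sum_(T : tree Dmax) qT T = 1)
  (pi'_ge0 : forall s k, 0 <= pi' s k)
  (pi'_sum : forall s, \sum_(k < K) pi' s k = 1)
  (q_density : is_prob_density q)
  (q_def : forall theta tau p beta, admissible theta tau p beta ->
     0 < q theta tau p beta /\
     ln (q theta tau p beta) =
       E_u varpi (fun u => E_zT qT pi' (fun T z =>
         ln_joint x g alpha mu Lam a b eta L xi theta tau p beta u z)) + c) :
  let X := design D n x in
  let xv := xvec n x in
  let r s k := q_leaf qT s * pi' s k in
  let alpha' k := alpha k + \sum_(s : node Dmax) r s k in
  let Lam' k :=
    Lam + \sum_(s : node Dmax) r s k *: (X^T *m Qmx varpi s *m X) in
  let mu' k :=
    invmx (Lam' k) *m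
      (Lam *m mu + \sum_(s : node Dmax) r s k *: (X^T *m Qmx varpi s *m xv)) in
  let a' k := a + 2^-1 * \sum_(s : node Dmax) r s k * \tr (Qmx varpi s) in
  let b' k :=
    b + 2^-1 * (dot mu (Lam *m mu)
                + \sum_(s : node Dmax) r s k * dot xv (Qmx varpi s *m xv)
                - dot (mu' k) (Lam' k *m mu' k)) in
  let L' (s : inode Dmax) :=
    L s + 2 *: \sum_(t < n) (q_prec varpi (val s) t * lambda (xi s t))
                              *: (ttilde t *m (ttilde t)^T) in
  let eta' (s : inode Dmax) :=
    invmx (L' s) *m
      (L s *m eta s + \sum_(t < n) (q_prec varpi (val s) t * (varpi t s true - 2^-1))
                                    *: ttilde t) in
  let xi_new s t :=
    Num.sqrt (dot (ttilde t)
                  ((invmx (L' s) + eta' s *m (eta' s)^T) *m ttilde t)) in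
  (forall theta tau p beta, admissible theta tau p beta ->
     q theta tau p beta =
       dirichlet_pdf alpha' p
       * (\prod_(k < K) normal_gamma_pdf (mu' k) (Lam' k) (a' k) (b' k) (theta k) (tau k))
       * (\prod_(s : inode Dmax) mvnormal_pdf (eta' s) (invmx (L' s)) (beta s)))
  /\ (forall xi1 : inode Dmax -> 'I_n -> R,
        E_ln_h varpi eta' L' xi1 <= E_ln_h varpi eta' L' xi_new).
Proof.
move=> X xv r alpha' Lam' mu' a' b' L' eta' xi_new; split.
  move=> theta tau p beta adm.
  exact: (posterior_of_ln K_gt0 alpha_gt0 Lam_pos a_gt0 b_gt0 L_pos varpi_ge0 varpi_sum
    qT_ge0 qT_sum pi'_ge0 pi'_sum q_density q_def adm).
move=> xi1; apply: E_ln_h_max => // s.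
by apply: L_upd_pos => // t; exact: q_prec_ge0.
Qed.
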